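(* Let $(\xi_n)_{n\ge 1}$ be a stationary Gaussian sequence with $\mathbb{E}\xi_1=0$, $\operatorname{Var}\xi_1=1$ and $\gamma(k)=\operatorname{Cov}(\xi_1,\xi_{k+1})\sim k^{-D}L(k)$ as $k\to\infty$, for some $D\in(0,1)$ and slowly varying $L$. Let $G$ be measurable, $X_n=G(\xi_n)$, with marginal distribution function $F(x)=x$ on $[0,1]$. Let $r$ be the Hermite rank of $\{1_{\{G(\xi_1)\le x\}}-x: x\in[0,1]\}$ and assume $Dr<1$. Let $\lambda<1/3$ and $\vartheta>0$ be such that $$\sup_{t,x\in[0,1]} d_{n,r}^{-1}(\min\{x,1-x\})^{-\lambda}\Big|\sum_{j=1}^{\lfloor nt\rfloor}\big(1_{\{X_j\le x\}}-x\big)-\tfrac{1}{r!}J_r(x)\sum_{j=1}^{\lfloor nt\rfloor}H_r(\xi_j)\Big|=\mathcal{O}_P(n^{-\vartheta}),$$ and assume $n^{\lambda}=o(d_{n,r}^{1-\lambda})$, $n^{2\lambda}d_{n,r}=o(n)$ and $d_{n,r}^{\lambda}=o(n^{\vartheta})$. Then $$\sup_{t\in[0,1],x\in[0,1]} d_{n,r}^{-1}(\min\{x,1-x\})^{-\lambda}\Big|\Big(\hat G_{\lfloor nt\rfloor}(x-)-\frac{\lfloor nt\rfloor}{n}\hat G_n(x-)\Big)-\frac{1}{r!}J_r(x)\Big(\sum_{i=1}^{\lfloor nt\rfloor}H_r(\xi_i)-\frac{\lfloor nt\rfloor}{n}\sum_{i=1}^{n}H_r(\xi_i)\Big)\Bi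g|=o_P(1).$$
   Context: $H_q$ is the $q$-th Hermite polynomial $H_q(x)=(-1)^q e^{x^2/2}\frac{d^q}{dx^q}e^{-x^2/2}$; $J_q(y)=\mathbb{E}[1_{\{G(\xi_1)\le y\}}H_q(\xi_1)]$; $r(y)=\min\{q\ge1:J_q(y)\ne0\}$ and $r=\min_y r(y)$. $d_{n,r}^2=\operatorname{Var}(\sum_{i=1}^nH_r(\xi_i))$. $R_i=\sum_{j=1}^n 1_{\{X_j\le X_i\}}$ is the rank of $X_i$ among $X_1,\dots,X_n$, $\hat G_k(x)=\sum_{i=1}^k 1_{\{R_i/(n+1)\le x\}}$, and $\hat G_k(x-)$ denotes the left limit at $x$. *)

(* Defs.v *)
From HB Require Import structures.
From mathcomp Require Import all_boot all_order all_algebra.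
From mathcomp Require Import all_classical all_reals all_analysis.
Set Implicit Arguments. Unset Strict Implicit. Unset Printing Implicit Defensive.
Import Order.TTheory GRing.Theory Num.Theory.
Import numFieldNormedType.Exports.
Local Open Scope classical_set_scope.
Local Open Scope ring_scope.

Section defs.
Context {R : realType}.

(* Probabilists' Hermite polynomial via the Rodrigues formula
   H_q(x) = (-1)^q e^{x^2/2} d^q/dx^q e^{-x^2/2}. *)
Definition hermite (q : nat) (x : R) : R :=
  (-1) ^+ q * expR (x ^+ 2 / 2) * derive1n q (fun y : R => expR (- (y ^+ 2) / 2)) x.

Definition slowly_varying (L : R -> R) : Prop :=
  measurable_fun [set: R] L /\
  (exists x0 : R, forall x, x0 < x -> 0 < L x) /\
  (forall a : R, 0 < a -> (fun x => L (a * x) / L x) @ +oo --> (1 : R)).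

Definition little_o (a b : nat -> R) : Prop := (fun n => a n / b n) @ \oo --> (0 : R).

Definition asymp_equiv (a b : nat -> R) : Prop := (fun n => a n / b n) @ \oo --> (1 : R).

Definition npow (n : nat) (p : R) : R := powR (n%:R) p.

Definition nfloor (n : nat) (t : R) : nat := Num.truncn (n%:R * t).

Context {d : measure_display} {T : measurableType d} (P : probability T R).

Definition gaussian_rv (Y : T -> R) : Prop :=
  measurable_fun [set: T] Y /\
  exists (mu s : R), forall A : set R, measurable A ->
    P (Y @^-1` A) = (if s == 0 then \d_mu A else normal_prob mu s A).

Definition gaussian_sequence (xi : nat -> T -> R) : Prop :=
  forall (m : nat) (a : nat -> R), gaussian_rv (fun w => \sum_(i < m) a i * xi i w).

(* strict stationarity: finite-dimensional distributions are shift invariant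
   (tested on measurable rectangles) *)
Definition stationary (xi : nat -> T -> R) : Prop :=
  forall (m k : nat) (A : nat -> set R), (forall i, measurable (A i)) ->
    P (\bigcap_(i in [set j | (j < m)%N]) (xi (k + i)%N @^-1` A i)) =
    P (\bigcap_(i in [set j | (j < m)%N]) (xi i @^-1` A i)).

(* Outer-probability versions of O_P and o_P for (possibly non-measurable,
   extended-real valued) statistics Z_n. *)
Definition bigO_P (Z : nat -> T -> \bar R) (a : nat -> R) : Prop :=
  forall eps : R, 0 < eps -> exists M : R, 0 < M /\ exists N : nat, forall n, (N <= n)%N ->
    exists B : set T, measurable B /\
      [set w | ((M * a n)%:E < `|Z n w|)%E] `<=` B /\ (P B < eps%:E)%E.

Definition smallo_P1 (Z : nat -> T -> \bar R) : Prop :=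
  forall eps delta : R, 0 < eps -> 0 < delta -> exists N : nat, forall n, (N <= n)%N ->
    exists B : set T, measurable B /\
      [set w | (eps%:E < `|Z n w|)%E] `<=` B /\ (P B < delta%:E)%E.

(* J_q(y) = E[1_{G(xi_1) <= y} H_q(xi_1)]  (xi_1 is xi 0 here) *)
Definition Jcoef (G : R -> R) (xi : nat -> T -> R) (q : nat) (y : R) : R :=
  fine ('E_P[fun w => ((if G (xi 0%N w) <= y then 1 else 0) * hermite q (xi 0%N w))%R])%E.

Definition hermite_rank (G : R -> R) (xi : nat -> T -> R) (r : nat) : Prop :=
  (1 <= r)%N /\ (exists x, 0 <= x <= 1 /\ Jcoef G xi r x != 0) /\
  (forall q, (1 <= q < r)%N -> forall x, 0 <= x <= 1 -> Jcoef G xi q x = 0).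

Definition dnr (xi : nat -> T -> R) (r n : nat) : R :=
  Num.sqrt (fine ('V_P[fun w => (\sum_(i < n) hermite r (xi i w))%R])%E).

End defs.

Section ranks.
Context {R : realType} {T : Type}.

Definition rank_ (X : nat -> T -> R) (n i : nat) (w : T) : nat :=
  \sum_(j < n) (if (X j w <= X i w)%R then 1%N else 0%N).

Definition Ghat (X : nat -> T -> R) (n k : nat) (w : T) (x : R) : R :=
  \sum_(i < k) (if (rank_ X n i w)%:R / (n.+1)%:R <= x then 1 else 0).

Definition Ghat_left (X : nat -> T -> R) (n k : nat) (w : T) (x : R) : R :=
  lim (Ghat X n k w @ x^'-).

End ranks.

(* Main.v *)
(** Write [S_k(z) = sum_(j<k) (1_{X_j <= z} - z)] and [H_k = sum_(i<k) H_r(xi_i)].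
    Outside the range [1/(n+1) < x <= n/(n+1)], where the rank process vanishes,
    there is a sample quantile [z] with [R_i / (n+1) < x <-> X_i <= z] for all
    [i < n], so that [Ghat_k(x-) - (k/n) Ghat_n(x-) = S_k(z) - (k/n) S_n(z)]. The
    reduction principle replaces the right-hand side by
    [J_r(z)/r! (H_k - (k/n) H_n)]; the defining inequalities of the quantile and
    [S_n = O_P(d_n)] give [|z - x| = O_P(d_n / n)], and [J_r] is Hoelder-1/2 because
    [1_{X <= z}] is Hoelder-1/2 in mean square. When [lam < 0] the remainder
    bound degenerates at the endpoints, where the vanishing weight has to be used: the
    interval is cut at a small distance [e] from them.

    This needs [max_(k<=n) |H_k| = O_P(d_n)], obtained by dyadic chaining and Markov's
    inequality from [v(2m) >= theta v(m)], [theta > 2], for [v(m) = d_m^2]. By Gaussian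
    integration by parts [E H_r(xi_i) H_r(xi_j) = r! gamma(i-j)^r =: rho(i-j)]; uniform
    convergence for slowly varying functions yields [L(k+1)/L(k) -> 1], hence
    [rho(2k), rho(2k+1) >= q rho(k)] eventually with [q > 1/2] as [D r < 1], and two
    summations give the growth of [v]. *)

Require Import Defs.
From mathcomp Require Import all_boot all_order all_algebra.
From mathcomp Require Import all_classical all_reals all_analysis.
From mathcomp Require Import measurable_realfun.
From mathcomp Require Import ring lra zify.
Import Order.TTheory GRing.Theory Num.Theory.
Import numFieldNormedType.Exports.
Local Open Scope classical_set_scope.
Local Open Scope ring_scope.
Set Implicit Arguments. Unset Strict Implicit. Unset Printing Implicit Defensive.
Import HBNNSimple.

(** * Densities and normal moments *)

(** The obstacle is the weight [min(x, 1-x)^(-lam)]. For [lam >= 0] it blows up at the endpoints: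
    within [1/(n+1)] of them the Hoelder bound and [J 0 = J 1 = 0] pay for it, and elsewhere it is
    at most [(n+1)^lam]. Against [|J z - J x| = O(sqrt (d_n / n))] this costs the square root of
    [n^(2 lam) d_n / n]; moving the weight from [x] to [z] costs [(C d_n)^lam] against the rate
    [n^(-vth)]. These are the quantities that the growth assumptions make small. The comparison is
    made path by path for fixed [n]; randomness enters only through three exceptional sets. Joint
    normality is given through linear combinations only, so mixed moments of a pair are read off as
    coefficients in [s] of [E (s X + Y)^p], without a bivariate density. In the chaining, scale [l]
    has [2^(p-l)] blocks of variance [v(2^l)]; since [theta > 2], their total is a geometrically
    small fraction of [v(2^p)], and no logarithm is lost in the maximal inequality. *)

Lemma ge0_integral_density d (T : measurableType d) (R : realType)
    (mu nu : {measure set T -> \bar R}) (g : T -> R) (f : T -> \bar R) :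
  measurable_fun setT g -> (forall x, 0 <= g x) ->
  (forall A, measurable A -> nu A = (\int[mu]_(x in A) (g x)%:E)%E) ->
  measurable_fun setT f -> (forall x, 0 <= f x)%E ->
  (\int[nu]_x f x = \int[mu]_x (f x * (g x)%:E))%E.
Proof.
move=> mg g0 nuE mf f0.
have mge : measurable_fun setT (EFin \o g) by exact/measurable_EFinP.
have step (h : {nnsfun T >-> R}) :
    (\int[nu]_x (h x)%:E = \int[mu]_x ((h x)%:E * (g x)%:E))%E.
  rewrite integralT_nnsfun sintegralE.
  under [RHS]eq_integral.
    move=> x _; rewrite fimfunE -fsumEFin// ge0_mule_fsuml; last first.
      by move=> r; rewrite EFinM nnfun_muleindic_ge0.
    over.
  rewrite ge0_integral_fsum//; last 2 first.
  - move=> r; apply: emeasurable_funM => //; apply/measurable_EFinP.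
    exact: measurableT_comp.
  - move=> r x _; rewrite mule_ge0 ?lee_fin//.
    by rewrite -lee_fin EFinM nnfun_muleindic_ge0.
  apply: eq_fsbigr => r; rewrite inE => -[t _ <-].
  under [RHS]eq_integral do rewrite EFinM -muleA.
  rewrite ge0_integralZl//; last 3 first.
  - apply: emeasurable_funM => //; apply/measurable_EFinP; exact: measurable_indic.
  - by move=> x _; rewrite mule_ge0 ?lee_fin.
  - by rewrite lee_fin.
  congr *%E; rewrite nuE// [LHS]integral_mkcond; apply: eq_integral => x _.
  rewrite patchE indicE.
  by case: ifPn => _; rewrite ?mul1e ?mul0e.
pose f_ := nnsfun_approx measurableT mf.
transitivity (lim (\int[nu]_x (f_ n x)%:E @[n --> \oo])%E).
  rewrite -monotone_convergence//=.
  - apply: eq_integral => x xD; apply/esym/cvg_lim => //=.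
    exact: cvg_nnsfun_approx.
  - by move=> n; exact/measurable_EFinP/measurable_funTS.
  - by move=> n x _; rewrite lee_fin.
  - by move=> x _ a b ab; rewrite lee_fin; exact/lefP/nd_nnsfun_approx.
under eq_fun do rewrite step.
rewrite -monotone_convergence//=.
- apply: eq_integral => x xD; apply/cvg_lim => //=.
  by apply: cvgeZr => //; exact: cvg_nnsfun_approx.
- move=> n; apply: emeasurable_funM => //; exact/measurable_EFinP.
- by move=> n x _; rewrite mule_ge0 ?lee_fin.
- move=> x _ a b ab; rewrite lee_wpmul2r ?lee_fin//.
  exact/lefP/nd_nnsfun_approx.
Qed.

Section normal_moments.
Variables (R : realType) (m s : R).
Hypothesis s0 : s != 0.
Local Notation mu := (@lebesgue_measure R).

Let s2_gt0 : 0 < s ^+ 2. Proof. by rewrite exprn_even_gt0. Qed.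

Lemma expr_le_expR (p : nat) (y : R) : 0 <= y ->
  y ^+ p <= p`!%:R * expR y.
Proof.
move=> y0; case: p => [|p].
  by rewrite expr0 fact0 mul1r; have := expR_ge1Dx y; lra.
have := expR_ge1Dxn p y0; rewrite -ler_pdivrMl ?ltr0n ?fact_gt0// => h.
by apply: le_trans h; rewrite mulrC lerDr.
Qed.

(** Half of the Gaussian exponent absorbs the power, at the price of doubling the variance. Both the
    integrability of all moments and the decay of the boundary terms follow from this. *)
Lemma normal_pdf_moment_bound (p : nat) : exists C : R, forall x,
  `|(x - m) ^+ p * normal_pdf m s x| <= C * normal_pdf m (s * Num.sqrt 2) x.
Proof.
have s20 : s * Num.sqrt 2 != 0 by rewrite mulf_neq0// gt_eqF// sqrtr_gt0.
(* The sign is removed by [|a| <= 1 + a^2]; with [y = (x - m)^2 / (4 s^2)] the even power is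
   [(4 s^2)^p y^p <= (4 s^2)^p p! e^y]. *)
pose K := 1 + (4 * s ^+ 2) ^+ p * p`!%:R.
exists (K * normal_peak s / normal_peak (s * Num.sqrt 2)) => x.
rewrite !normal_pdfE// [X in _ <= X]mulrA divfK; last first.
  by rewrite gt_eqF// normal_peak_gt0.
rewrite mulrCA normrM ger0_norm ?normal_peak_ge0// [K * _]mulrC -[X in _ <= X]mulrA.
rewrite ler_wpM2l ?normal_peak_ge0// normrM [X in _ * X]ger0_norm ?expR_ge0//.
rewrite /normal_fun.
pose y := (x - m) ^+ 2 / (4 * s ^+ 2).
have y0 : 0 <= y by rewrite divr_ge0 ?sqr_ge0// mulr_ge0// ltW.
have -> : - (x - m) ^+ 2 / (s ^+ 2 *+ 2) = - y + - y.
  by rewrite /y -mulr_natr; field; rewrite s0.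
have -> : - (x - m) ^+ 2 / ((s * Num.sqrt 2) ^+ 2 *+ 2) = - y.
  by rewrite exprMn sqr_sqrtr// /y -mulr_natr; field; rewrite s0.
rewrite expRD mulrA ler_wpM2r ?expR_ge0// expRN ler_pdivrMr ?expR_gt0//.
have hX : `|(x - m) ^+ p| <= 1 + ((x - m) ^+ 2) ^+ p.
  set a := (x - m) ^+ p; have -> : ((x - m) ^+ 2) ^+ p = `|a| ^+ 2.
    by rewrite real_normK ?num_real// /a -!exprM mulnC.
  have := sqr_ge0 (`|a| - 1/2); rewrite sqrrB; lra.
apply: le_trans hX _; rewrite /K mulrDl mul1r lerD//.
  by have := expR_ge1Dx y; lra.
have -> : (x - m) ^+ 2 = (4 * s ^+ 2) * y by rewrite /y; field; rewrite s0.
rewrite exprMn -mulrA ler_wpM2l ?expr_le_expR//.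
by rewrite exprn_ge0// mulr_ge0// ltW.
Qed.

Lemma continuous_normal_moment (p : nat) :
  continuous (fun x : R => (x - m) ^+ p * normal_pdf m s x).
Proof.
move=> x; apply: cvgM; last exact: continuous_normal_pdf.
apply: (@cvg_comp _ _ _ (fun x => x - m) (fun y => y ^+ p)).
  by apply: cvgB; [exact: cvg_id|exact: cvg_cst].
exact: exprn_continuous.
Qed.

Lemma integrable_normal_moment (p : nat) :
  mu.-integrable setT (EFin \o (fun x : R => (x - m) ^+ p * normal_pdf m s x)).
Proof.
have [C CP] := normal_pdf_moment_bound p.
apply: (@le_integrable _ _ _ mu _ measurableT _
    (fun x => C%:E * (normal_pdf m (s * Num.sqrt 2) x)%:E)%E).
- apply/measurable_EFinP; apply: continuous_measurable_fun.
  exact: continuous_normal_moment.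
- by move=> x _; rewrite /= lee_fin (le_trans (CP x))// ler_norm.
- apply: integrableZl => //; exact: integrable_normal_pdf.
Qed.

Lemma is_derive_expr_center (p : nat) (x : R) :
  is_derive x 1 (fun x : R => (x - m) ^+ p) (p%:R * (x - m) ^+ p.-1).
Proof.
have h1 : is_derive x 1 (fun x : R => x - m) 1.
  have -> : (fun x : R => x - m) = id - cst m by [].
  by apply: is_derive_eq; rewrite subr0.
rewrite -[F in is_derive _ _ F](exprfctE (fun x : R => x - m) p).
apply: is_derive_eq (is_deriveX p h1) _.
by rewrite /GRing.scale/= mulr1.
Qed.

Lemma is_derive_gauss_center (c x : R) :
  is_derive x 1 (fun x : R => expR (- (x - m) ^+ 2 / c))
    (expR (- (x - m) ^+ 2 / c) * (- (2 * (x - m)) / c)).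
Proof.
apply: (@is_derive1_comp _ expR (fun x : R => - (x - m) ^+ 2 / c)).
have -> : (fun x : R => - (x - m) ^+ 2 / c) =
    (- c^-1) *: (fun x : R => (x - m) ^+ 2).
  by apply/funext => y; rewrite mulNr mulrC -mulNr.
apply: is_derive_eq (is_deriveZ _ (is_derive_expr_center 2 x)) _.
by rewrite /GRing.scale/= expr1; ring.
Qed.

(** An exact derivative, whose integral over the line vanishes, combining the moments of orders
    [p.+1] and [p.-1]. For [p = 0] the truncated predecessor is multiplied by [p%:R = 0]. *)
Lemma is_derive_normal_moment (p : nat) (x : R) :
  is_derive x 1 (fun x : R => - (s ^+ 2) * ((x - m) ^+ p * normal_pdf m s x))
    ((x - m) ^+ p.+1 * normal_pdf m s x
     - s ^+ 2 * p%:R * ((x - m) ^+ p.-1 * normal_pdf m s x)).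
Proof.
have pdfE y : normal_pdf m s y =
    normal_peak s * expR (- (y - m) ^+ 2 / (s ^+ 2 *+ 2)).
  by rewrite normal_pdfE.
have -> : (fun x : R => - s ^+ 2 * ((x - m) ^+ p * normal_pdf m s x)) =
    (- s ^+ 2 * normal_peak s) *: ((fun x : R => (x - m) ^+ p) *
      (fun x : R => expR (- (x - m) ^+ 2 / (s ^+ 2 *+ 2)))).
  apply/funext => y; rewrite pdfE.
  transitivity (- s ^+ 2 * normal_peak s * ((y - m) ^+ p * expR (- (y - m) ^+ 2 / (s ^+ 2 *+ 2)))); last by [].
  by set e := expR _; ring.
apply: is_derive_eq (is_deriveZ _
  (is_deriveM (is_derive_expr_center p x) (is_derive_gauss_center _ x))) _.
rewrite pdfE; set e := expR _; set a := x - m; set k := normal_peak s.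
rewrite /GRing.scale/= (exprS a).
have -> : - (2 * a) / (s ^+ 2 *+ 2) = - a / s ^+ 2.
  by rewrite -(mulr_natl (s ^+ 2)); field.
move: (a ^+ p) (a ^+ p.-1) (p%:R : R) => u v q.
by rewrite -[LHS]/(- s ^+ 2 * k * (u * (e * (- a / s ^+ 2)) + e * (q * v))); field.
Qed.

End normal_moments.

Section normal_recursion.
Variables (R : realType) (m s : R).
Hypothesis s0 : s != 0.
Local Notation mu := (@lebesgue_measure R).
Local Notation F p := (fun x : R => - (s ^+ 2) * ((x - m) ^+ p * normal_pdf m s x))%R.
Local Notation f p := (fun x : R => (x - m) ^+ p.+1 * normal_pdf m s x
     - s ^+ 2 * p%:R * ((x - m) ^+ p.-1 * normal_pdf m s x))%R.

Let integrable_f p : mu.-integrable setT (EFin \o f p).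
Proof.
exact: (integrableB measurableT (integrable_normal_moment m s0 p.+1)
  (integrableZl measurableT (s ^+ 2 * p%:R) (integrable_normal_moment m s0 p.-1))).
Qed.

Let continuous_f p : continuous (f p).
Proof.
move=> x; apply: cvgB; first exact: continuous_normal_moment.
by apply: cvgM; [exact: cvg_cst|exact: continuous_normal_moment].
Qed.

Let continuous_F p : continuous (F p).
Proof.
by move=> x; apply: cvgM; [exact: cvg_cst|exact: continuous_normal_moment].
Qed.

Let FTC_f p (n : nat) : (\int[mu]_(x in `[(m - n.+1%:R)%R, (m + n.+1%:R)%R]) (f p x)%:E =
  (F p (m + n.+1%:R)%R)%:E - (F p (m - n.+1%:R)%R)%:E)%E.
Proof.
apply: continuous_FTC2.
- by rewrite ltrD2l gtrN.
- exact/continuous_subspaceT/continuous_f.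
- split.
  + by move=> x _; have := is_derive_normal_moment m s0 p x; case.
  + exact/cvg_at_right_filter/continuous_F.
  + exact/cvg_at_left_filter/continuous_F.
- by move=> x _; rewrite derive1E; have := is_derive_normal_moment m s0 p x => -[].
Qed.

Let cvg_F p (sg : R) : `|sg| = 1 -> F p (m + sg * n.+1%:R) @[n --> \oo] --> (0 : R).
Proof.
(* The bound is taken for the power [p.+1]: the spare factor [n.+1%:R] yields decay of order
   [1/(n+1)]. *)
move=> sg1; have [C CP] := normal_pdf_moment_bound m s0 p.+1.
pose K := s ^+ 2 * (`|C| * normal_peak (s * Num.sqrt 2)).
have s20 : s * Num.sqrt 2 != 0 by rewrite mulf_neq0// gt_eqF// sqrtr_gt0.
apply/norm_cvg0P.
apply: (@squeeze_cvgr _ _ _ _ (fun=> 0) (fun n : nat => K / n.+1%:R)).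
- near=> n; rewrite normr_ge0/= ler_pdivlMr//.
  rewrite normrM normrN (ger0_norm (sqr_ge0 s)) /K -mulrA ler_wpM2l ?sqr_ge0//.
  have := CP (m + sg * n.+1%:R); rewrite addrAC subrr add0r => h.
  set w := normal_pdf _ _ _ in h *.
  have -> : `|(sg * n.+1%:R) ^+ p * w| * n.+1%:R = `|(sg * n.+1%:R) ^+ p.+1 * w|.
    by rewrite exprSr !normrM sg1 mul1r [`|n.+1%:R|]ger0_norm// mulrAC.
  apply: le_trans h _.
  have h2 := normal_pdf_ge0 m (s * Num.sqrt 2) (m + sg * n.+1%:R).
  apply: (@le_trans _ _ (`|C| * normal_pdf m (s * Num.sqrt 2) (m + sg * n.+1%:R))).
    by rewrite ler_wpM2r// ler_norm.
  by rewrite ler_wpM2l// normal_pdf_ub.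
- exact: cvg_cst.
- rewrite -[0](mulr0 K); apply: cvgM; first exact: cvg_cst.
  exact: cvg_harmonic.
Unshelve. all: by end_near. Qed.

(** Integrate the derivative [f p] over [[m - (n+1), m + (n+1)]]: the boundary terms tend to 0, and
    dominated convergence identifies the limit with the integral over the line. *)
Lemma normal_moment_recursion (p : nat) :
  \int[mu]_x ((x - m) ^+ p.+1 * normal_pdf m s x) =
  s ^+ 2 * p%:R * \int[mu]_x ((x - m) ^+ p.-1 * normal_pdf m s x).
Proof.
rewrite -RintegralZl//; last exact: integrable_normal_moment.
apply/eqP; rewrite -subr_eq0 -RintegralB//; last 2 first.
- exact: integrable_normal_moment.
- exact: (integrableZl measurableT (s ^+ 2 * p%:R) (integrable_normal_moment m s0 p.-1)).
pose f_ (n : nat) := (EFin \o f p) \_ `[m - n.+1%:R, m + n.+1%:R].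
have limf : (\int[mu]_x f_ n x @[n --> \oo] --> \int[mu]_x (EFin \o f p) x)%E.
  have mF := measurable_int _ (integrable_f p).
  have mf_ n : measurable_fun setT (f_ n).
    by apply/(measurable_restrictT _ _).1 => //; exact: measurable_funTS.
  have cf : {ae mu, forall x, setT x -> f_ ^~ x @ \oo --> (EFin \o f p) x}.
    apply/aeW => x _; apply: cvg_near_cst.
    near=> n; rewrite /f_ patchE ifT// inE/= in_itv/=.
    have : `|x - m| <= n.+1%:R.
      rewrite (@le_trans _ _ n%:R) ?ler_nat//; near: n; exact: nbhs_infty_ger.
    rewrite ler_norml; lra.
  have bf : {ae mu, forall x n, setT x ->
      (`|f_ n x| <= (abse \o (EFin \o f p)) x)%E}.
    apply/aeW => x n _; rewrite /f_ patchE; case: ifPn => //= _.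
    by rewrite normr0 lee_fin.
  by have [_ _] := @dominated_convergence _ _ _ mu _ measurableT f_ _ _ mf_ mF cf
    (integrable_abse (integrable_f p)) bf.
have : (\int[mu]_x f_ n x @[n --> \oo] --> 0%:E)%E.
  have -> : (fun n => \int[mu]_x f_ n x)%E =
    (fun n => (F p (m + n.+1%:R)%R)%:E - (F p (m - n.+1%:R)%R)%:E)%E.
    by apply/funext => n; rewrite -integral_mkcond FTC_f.
  have e0 : (0%:E = 0%:E - 0%:E :> \bar R)%E by rewrite sube0.
  rewrite e0; apply: cvgeB => //.
  - apply/cvg_EFin => //; first exact: nearW.
    have := @cvg_F p 1; under eq_fun do rewrite mul1r.
    by apply; rewrite normr1.
  - apply/cvg_EFin => //; first exact: nearW.
    have := @cvg_F p (-1); under eq_fun do rewrite mulN1r.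
    by apply; rewrite normrN1.
move=> lim0; rewrite /Rintegral.
have -> : (\int[mu]_x (EFin \o f p) x = 0)%E.
  by move/cvg_lim : limf => <- //; exact/cvg_lim.
by [].
Unshelve. all: by end_near. Qed.

End normal_recursion.

Lemma density_integral d (T : measurableType d) (R : realType)
    (mu nu : {measure set T -> \bar R}) (g : T -> R) (f : T -> R) :
  measurable_fun setT g -> (forall x, 0 <= g x) ->
  (forall A, measurable A -> nu A = (\int[mu]_(x in A) (g x)%:E)%E) ->
  measurable_fun setT f -> mu.-integrable setT (EFin \o (fun x => f x * g x)) ->
  nu.-integrable setT (EFin \o f) /\
  \int[nu]_x f x = \int[mu]_x (f x * g x).
Proof.
move=> mg g0 nuE mf fg; have mef : measurable_fun setT (EFin \o f).
  exact/measurable_EFinP.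
split.
  apply/integrableP; split => //.
  rewrite (ge0_integral_density mg g0 nuE)//; last exact: measurableT_comp.
  move/integrableP : fg => [_]; apply: le_lt_trans.
  rewrite le_eqVlt; apply/orP; left; apply/eqP; apply: eq_integral => x _.
  by rewrite /= normrM (ger0_norm (g0 x)).
rewrite /Rintegral integralE [in RHS]integralE.
have D := ge0_integral_density mg g0 nuE.
rewrite (D (EFin \o f)^\+%E)//; last exact/measurable_funepos.
rewrite (D (EFin \o f)^\-%E)//; last exact/measurable_funeneg.
congr (fine (_ - _)%E); apply: eq_integral => x _ /=.
  by rewrite unlock/= -!EFin_max -EFinM maxr_pMl// mul0r.
by rewrite unlock/= -!EFin_max -EFinM maxr_pMl// mul0r mulNr.
Qed.

Section law.
Context d (T : measurableType d) (R : realType) (P : probability T R).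
Variables (Y : T -> R) (nu : {measure set (measurableTypeR R) -> \bar R}).
Hypothesis mY : measurable_fun setT Y.
Hypothesis lawY : forall A, measurable A -> P (Y @^-1` A) = nu A.

Lemma law_integrable (f : R -> R) : measurable_fun [set: R] f ->
  nu.-integrable setT (EFin \o f) -> P.-integrable setT (EFin \o (f \o Y)).
Proof.
move=> mf /integrableP[mef foo]; apply/integrableP; split.
  by apply/measurable_EFinP; exact: measurableT_comp.
apply: le_lt_trans foo; rewrite le_eqVlt; apply/orP; left; apply/eqP.
rewrite -[LHS](@ge0_integral_pushforward _ _ _ (measurableTypeR R) R _ mY P setT
  (abse \o (EFin \o f)))//; last 2 first.
- exact: measurableT_comp.
- by move=> y _; exact: abse_ge0.
by apply: eq_measure_integral => A mA _; exact: lawY.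
Qed.

Lemma law_Rintegral (f : R -> R) : measurable_fun [set: R] f ->
  nu.-integrable setT (EFin \o f) -> \int[P]_w f (Y w) = \int[nu]_x f x.
Proof.
move=> mf If; rewrite /Rintegral; congr fine.
have mef := measurable_int _ If; have Pf := law_integrable mf If.
rewrite -[LHS](@integral_pushforward _ _ _ (measurableTypeR R) R _ mY P setT
  (EFin \o f))//.
by apply: eq_measure_integral => A mA _; exact: lawY.
Qed.
End law.

(** The Dirac case cannot be excluded, since a combination [s X + Y] may be constant; it satisfies
    the same recursion with [s = 0]. *)
Lemma gaussian_rv_moments d (T : measurableType d) (R : realType)
    (P : probability T R) (Y : T -> R) : gaussian_rv P Y ->
  exists m s : R,
    (forall p, P.-integrable setT (EFin \o (fun w => (Y w - m) ^+ p))) /\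
    (forall p, \int[P]_w ((Y w - m) ^+ p.+1) =
       s ^+ 2 * p%:R * \int[P]_w ((Y w - m) ^+ p.-1)).
Proof.
case=> mY [m [s lawY]]; exists m, s.
have mp p : measurable_fun [set: R] (fun x : R => (x - m) ^+ p).
  by apply: measurable_funX; exact: measurable_funB.
have [s0|s0] := eqVneq s 0.
  pose nu : {measure set (measurableTypeR R) -> \bar R} := dirac (m : measurableTypeR R).
  have {}lawY A : measurable A -> P (Y @^-1` A) = nu A.
    by move=> mA; rewrite lawY// s0 eqxx.
  have Id p : nu.-integrable [set: measurableTypeR R] (EFin \o (fun x : R => (x - m) ^+ p)).
    apply/integrableP; split; first by apply/measurable_EFinP; exact: mp.
    rewrite integral_dirac//=; last by apply/measurable_EFinP; apply: measurableT_comp => //; exact: mp.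
    by rewrite -EFinM ltry.
  have Ed p : \int[nu]_x ((x - m) ^+ p) = (p == 0%N)%:R :> R.
    rewrite /Rintegral integral_dirac//=; last by apply/measurable_EFinP; exact: mp.
    by rewrite indicT mul1r subrr expr0n.
  have E p : \int[P]_w ((Y w - m) ^+ p) = (p == 0%N)%:R.
    by rewrite -Ed; exact: (law_Rintegral (nu := nu) mY lawY (mp p) (Id p)).
  split; first by move=> p; exact: (law_integrable mY lawY (mp p) (Id p)).
  by move=> p; rewrite !E/= s0 expr0n/= !mul0r.
have {}lawY A : measurable A -> P (Y @^-1` A) = normal_prob m s A.
  by move=> mA; rewrite lawY// (negbTE s0).
have J p := @density_integral _ (measurableTypeR R) R lebesgue_measure (normal_prob m s)
  (normal_pdf m s) (fun x => (x - m) ^+ p) (measurable_normal_pdf m s)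
  (normal_pdf_ge0 m s) (fun A _ => erefl) (mp p) (integrable_normal_moment m s0 p).
split=> p.
  exact: (law_integrable (f := fun x => (x - m) ^+ p) mY lawY (mp p) (proj1 (J p))).
rewrite (law_Rintegral (f := fun x => (x - m) ^+ p.+1) mY lawY (mp _) (proj1 (J _))).
rewrite (law_Rintegral (f := fun x => (x - m) ^+ p.-1) mY lawY (mp _) (proj1 (J _))).
rewrite (proj2 (J _)) (proj2 (J p.-1)).
exact: normal_moment_recursion.
Qed.

(** * Hermite polynomials of a Gaussian pair *)

Lemma Rintegral_probability_cst d (T : measurableType d) (R : realType)
    (P : probability T R) (c : R) : \int[P]_w c = c.
Proof.
rewrite Rintegral_cst// (_ : fine _ = 1) ?mulr1//.
exact: (congr1 fine (probability_setT P)).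
Qed.

Lemma Rintegral_finsum d (T : measurableType d) (R : realType)
    (P : probability T R) (n : nat) (f : nat -> T -> R) :
  (forall i, P.-integrable setT (EFin \o f i)) ->
  P.-integrable setT (EFin \o (fun w => \sum_(i < n) f i w)) /\
  \int[P]_w (\sum_(i < n) f i w) = \sum_(i < n) \int[P]_w f i w.
Proof.
move=> If; elim: n => [|n [I E]].
  rewrite big_ord0; under eq_Rintegral do rewrite big_ord0.
  under eq_fun do rewrite big_ord0.
  by split; [exact: finite_measure_integrable_cst|exact: Rintegral_probability_cst].
under eq_Rintegral do rewrite big_ord_recr/=.
under eq_fun do rewrite big_ord_recr/=.
rewrite big_ord_recr/= -E; split; last by rewrite RintegralD.
exact: (integrableD measurableT I (If n)).
Qed.

Lemma centered_gaussian_moments d (T : measurableType d) (R : realType)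
    (P : probability T R) (Y : T -> R) : gaussian_rv P Y -> \int[P]_w Y w = 0 ->
  (forall p, P.-integrable setT (EFin \o (fun w => Y w ^+ p))) /\
  (forall p, \int[P]_w (Y w ^+ p.+1) =
       (\int[P]_w (Y w ^+ 2)) * p%:R * \int[P]_w (Y w ^+ p.-1)).
Proof.
move=> gY EY; have [m [s [I E]]] := gaussian_rv_moments gY.
have IY : P.-integrable setT (EFin \o (fun w => Y w)).
  apply: (eq_integrable measurableT ((EFin \o (fun w => (Y w - m) ^+ 1)%R) \+ cst m%:E)%E).
    by move=> w _ /=; rewrite expr1 -EFinD subrK.
  by apply: integrableD => //; exact: finite_measure_integrable_cst.
have m0 : m = 0.
  (* The recursion at [p = 0] says that [Y - m] is centred, so [m] is the mean; at [p = 1] it will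
     identify [s ^+ 2] with the variance. *)
  have := E 0%N; rewrite mulr0 mul0r.
  under eq_Rintegral do rewrite expr1.
  rewrite RintegralB//; last exact: finite_measure_integrable_cst.
  rewrite EY Rintegral_probability_cst sub0r.
  by move/eqP; rewrite oppr_eq0 => /eqP.
have e p : (fun w => (Y w - m) ^+ p) = (fun w => Y w ^+ p).
  by apply/funext => w; rewrite m0 subr0.
split=> p; first by rewrite -e.
have E1 := E 1%N; rewrite /= in E1; rewrite -!e E.
congr (_ * _ * _); rewrite E1 mulr1.
under eq_Rintegral do rewrite expr0.
by rewrite Rintegral_probability_cst mulr1.
Qed.

Lemma horner_inj (R : realType) (p q : {poly R}) :
  (forall x, p.[x] = q.[x]) -> p = q.
Proof.
move=> pq; apply/eqP; rewrite -subr_eq0; apply/negPn/negP => pq0.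
have := max_poly_roots (rs := [seq i%:R | i <- iota 0 (size (p - q))]) pq0.
rewrite size_map size_iota ltnn => H; apply/notF/H.
  by apply/allP => x _; rewrite /root hornerD hornerN pq subrr.
by rewrite map_inj_uniq ?iota_uniq// => i j /eqP; rewrite eqr_nat => /eqP.
Qed.

Lemma poly_linear_ind (R : realType) (Q : {poly R} -> Prop) :
  Q 0 -> (forall p q, Q p -> Q q -> Q (p + q)) ->
  (forall a p, Q p -> Q (a *: p)) -> (forall n, Q 'X^n) -> forall p, Q p.
Proof.
move=> Q0 QD QZ QX p; rewrite -[p]coefK poly_def.
by apply: big_ind => // i _; exact: QZ.
Qed.

Section hermite_poly.
Variable R : realType.

(** The recursion by the raising operator [X - d/dX]: it is what differentiating [e^(-x^2/2)]
    produces, and the form in which integration by parts cancels a term in [hermite_shift]. *)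
Fixpoint hermite_poly (n : nat) : {poly R} :=
  if n is k.+1 then 'X * hermite_poly k - (hermite_poly k)^`() else 1.

Lemma hermite_poly_deriv n : (hermite_poly n)^`() = n%:R *: hermite_poly n.-1.
Proof.
elim: n => [|n IH]; first by rewrite /= derivC scale0r.
rewrite [LHS]/= derivB derivM derivX mul1r IH derivZ -addrA.
rewrite -scalerAr -scalerBr/=; case: n IH => [|n] IH.
  by rewrite scale0r addr0 scale1r.
transitivity (hermite_poly n.+1 + n.+1%:R *: hermite_poly n.+1); first by [].
by rewrite -[X in X + _]scale1r -scalerDl -[in RHS]natr1 addrC.
Qed.

Lemma hermiteE n (x : R) : hermite n x = (hermite_poly n).[x].
Proof.
have D k y : derive1n k (fun y : R => expR (- (y ^+ 2) / 2)) y =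
    (-1) ^+ k * (hermite_poly k).[y] * expR (- (y ^+ 2) / 2).
  elim: k y => [|k IH] y; first by rewrite /= hornerC expr0 !mul1r.
  rewrite derive1nS.
  have -> : derive1n k (fun y : R => expR (- y ^+ 2 / 2)) =
     (-1) ^+ k *: ((fun y => (hermite_poly k).[y]) *
        (fun y : R => expR (- (y - 0) ^+ 2 / 2))).
    apply/funext => z; transitivity
      ((-1) ^+ k * ((hermite_poly k).[z] * expR (- (z - 0) ^+ 2 / 2))) => //.
    by rewrite IH subr0 mulrA.
  rewrite derive1E.
  have := is_deriveZ ((-1) ^+ k) (is_deriveM (is_derive_poly (hermite_poly k) y)
    (is_derive_gauss_center 0 2 y)).
  case=> _ ->; rewrite /GRing.scale/= !subr0 (exprS (-1)) /=
    hornerD hornerN hornerM hornerX.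
  move: (expR _) ((-1) ^+ k) (hermite_poly k).[y] ((hermite_poly k)^`().[y]).
  by move=> e A h h'; field.
have ee : expR (x ^+ 2 / 2) * expR (- x ^+ 2 / 2) = 1.
  by rewrite -expRD mulNr subrr expR0.
have ss : (-1) ^+ n * (-1) ^+ n = 1 :> R by rewrite -expr2 sqrr_sign.
rewrite /hermite D; move: (expR _) (expR _) ((-1) ^+ n) ee ss => e1 e2 A ee ss.
by transitivity ((A * A) * (e2 * e1) * (hermite_poly n).[x]); [ring|rewrite ee ss !mul1r].
Qed.

End hermite_poly.

Section gaussian_pair.
Context d (T : measurableType d) (R : realType) (P : probability T R).
Variables (X Y : T -> R).
Hypothesis gXY : forall a b, gaussian_rv P (fun w => a * X w + b * Y w).
Hypothesis EX : \int[P]_w X w = 0.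
Hypothesis EY : \int[P]_w Y w = 0.
Hypothesis EX2 : \int[P]_w (X w ^+ 2) = 1.
Hypothesis EY2 : \int[P]_w (Y w ^+ 2) = 1.
Let c := \int[P]_w (X w * Y w).

Let gX : gaussian_rv P X.
Proof.
have := gXY 1 0; congr gaussian_rv; apply/funext => w; lra.
Qed.

Let gY : gaussian_rv P Y.
Proof.
have := gXY 0 1; congr gaussian_rv; apply/funext => w; lra.
Qed.

Let mX : measurable_fun setT X. Proof. by case: gX. Qed.
Let mY : measurable_fun setT Y. Proof. by case: gY. Qed.

Lemma integrable_mixed_moment a b :
  P.-integrable setT (EFin \o (fun w => X w ^+ a * Y w ^+ b)).
Proof.
have [IX _] := centered_gaussian_moments gX EX.
have [IY _] := centered_gaussian_moments gY EY.
have := integrableD measurableT (IX (2 * a)%N) (IY (2 * b)%N).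
apply: le_integrable => //.
  by apply/measurable_EFinP; apply: measurable_funM; exact: measurable_funX.
move=> w _; rewrite /= lee_fin normrM.
have -> : X w ^+ (2 * a) = (X w ^+ a) ^+ 2 by rewrite -exprM mulnC.
have -> : Y w ^+ (2 * b) = (Y w ^+ b) ^+ 2 by rewrite -exprM mulnC.
move: (X w ^+ a) (Y w ^+ b) => u v.
rewrite [X in _ <= X]ger0_norm ?addr_ge0 ?sqr_ge0// -(real_normK (num_real u)).
rewrite -(real_normK (num_real v)).
have := sqr_ge0 (`|u| - `|v|); have := sqr_ge0 `|u|; have := sqr_ge0 `|v|.
rewrite sqrrB; lra.
Qed.

Let M a b := \int[P]_w (X w ^+ a * Y w ^+ b).

(* The moments of [s X + Y] satisfy a two-step recursion in [p] with factor its
   variance [V]; differentiating in [s] and comparing coefficients turns it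
   into Gaussian integration by parts. *)
Let Phi (p : nat) : {poly R} := \poly_(k < p.+1) ('C(p, k)%:R * M k (p - k)).

Let PhiE p s : (Phi p).[s] = \int[P]_w ((s * X w + 1 * Y w) ^+ p).
Proof.
rewrite horner_poly.
transitivity (\int[P]_w (\sum_(i < p.+1)
   (s ^+ i *+ 'C(p, i)) * (X w ^+ i * Y w ^+ (p - i)))).
  have IM i (r : R) : P.-integrable setT
     (EFin \o (fun w => r * (X w ^+ i * Y w ^+ (p - i)))).
    exact: (integrableZl measurableT r (integrable_mixed_moment i (p - i))).
  rewrite (proj2 (Rintegral_finsum p.+1 (fun i => IM i (s ^+ i *+ 'C(p, i))))).
  apply: eq_bigr => i _; rewrite RintegralZl//; last exact: integrable_mixed_moment.
  by rewrite -/(M _ _) -mulr_natr; ring.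
apply: eq_Rintegral => w _; rewrite addrC exprDn; apply: eq_bigr => i _.
by rewrite mul1r exprMn mulrnAl; congr (_ *+ _); ring.
Qed.

Let V : {poly R} := 'X^2 + (2 * c) *: 'X + 1.

Let centered_comb s : \int[P]_w (s * X w + 1 * Y w) = 0.
Proof.
have I1 := integrable_mixed_moment 1 0; have I2 := integrable_mixed_moment 0 1.
have I1' : P.-integrable setT (EFin \o X).
  rewrite (_ : X = (fun w => X w ^+ 1 * Y w ^+ 0))//.
  by apply/funext => w; rewrite expr1 expr0 mulr1.
have I2' : P.-integrable setT (EFin \o Y).
  rewrite (_ : Y = (fun w => X w ^+ 0 * Y w ^+ 1))//.
  by apply/funext => w; rewrite expr1 expr0 mul1r.
have J1 : P.-integrable setT (EFin \o (fun w => s * X w)).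
  exact: (integrableZl measurableT s I1').
have J2 : P.-integrable setT (EFin \o (fun w => 1 * Y w)).
  exact: (integrableZl measurableT 1 I2').
rewrite RintegralD//.
by rewrite !RintegralZl// EX EY !mulr0 addr0.
Qed.

Let PhiSS p : Phi p.+2 = p.+1%:R *: (V * Phi p).
Proof.
have V2 : V = Phi 2.
  apply: horner_inj => s; rewrite /V !hornerE /Phi horner_poly !big_ord_recr big_ord0/=.
  rewrite !subnn /M.
  under [X in _ = _ + _ * X * _ + _ + _]eq_Rintegral do rewrite expr0 mul1r.
  under [X in _ = _ + _ * X * _ + _]eq_Rintegral do rewrite !expr1.
  under [X in _ = _ + _ * X * _]eq_Rintegral do rewrite expr0 mulr1.
  by rewrite EX2 EY2 -/c bin0 bin1 binn; ring.
apply: horner_inj => s; rewrite hornerZ hornerM V2 !PhiE.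
have [_ ->] := centered_gaussian_moments (gXY s 1) (centered_comb s).
by rewrite /=; ring.
Qed.

Let Phi1 : Phi 1 = 0.
Proof.
apply: horner_inj => s; rewrite PhiE horner0.
by under eq_Rintegral do rewrite expr1; exact: centered_comb.
Qed.

Let Phi0 : Phi 0 = 1.
Proof.
apply: horner_inj => s; rewrite PhiE hornerC.
by under eq_Rintegral do rewrite expr0; exact: Rintegral_probability_cst.
Qed.

(** For [W = s X + Y] this encodes [E (X W^(p+1)) = (p+1) Cov(X, W) E (W^p)], where
    [Cov(X, W) = s + c]. The argument is purely algebraic: [PhiSS] propagates the identity in steps
    of two from [p = 0] and [p = 1]. *)
Let Phi_deriv p : (Phi p.+2)^`() = (p.+2 * p.+1)%:R *: (('X + c%:P) * Phi p).
Proof.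
have VD : V^`() = 2%:R *: ('X + c%:P).
  rewrite /V !derivD derivXn derivZ derivX derivC/= expr1 -!mul_polyC.
  by rewrite polyCM !rmorph_nat; ring.
elim/ltn_ind: p => -[|[|p]] IH.
- by rewrite PhiSS Phi0 !mulr1 derivZ VD !scalerA; congr (_ *: _); ring.
- by rewrite PhiSS Phi1 !mulr0 !scaler0 derivC.
rewrite PhiSS derivZ derivM VD IH; last by rewrite ltnS leqW.
have -> : V * ((p.+2 * p.+1)%:R *: (('X + c%:P) * Phi p)) =
   p.+2%:R *: (('X + c%:P) * Phi p.+2).
  by rewrite PhiSS -!mul_polyC natrM polyCM; ring.
by rewrite -!mul_polyC natrM polyCM !rmorph_nat; ring.
Qed.

Let mixed_moment_recursion a b :
  M a.+1 b = a%:R * M a.-1 b + c * b%:R * M a b.-1.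
Proof.
case E : (a + b)%N => [|n].
  move/eqP : E; rewrite addn_eq0 => /andP[/eqP -> /eqP ->]; rewrite !mulr0 !mul0r addr0.
  by rewrite /M; under eq_Rintegral do rewrite expr1 expr0 mulr1.
(* Compare coefficients of [s^a], where [a + b = n + 1]. What remains is to match binomial
   coefficients; for [a = 0] or [b = 0] the term with the truncated predecessor vanishes. *)
have := congr1 (fun q : {poly R} => q`_a) (Phi_deriv n).
rewrite coef_deriv coefZ mulrDl coefD coefXM coefCM !coef_poly.
have bE : b = (n.+1 - a)%N by rewrite -E addKn.
have an : (a <= n.+1)%N by rewrite -E leq_addr.
rewrite (_ : (a.+1 < n.+3)%N = true); last by rewrite !ltnS.
rewrite (_ : (n.+2 - a.+1)%N = b); last by rewrite subSS.
move=> H.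
have N0 : ((n.+2 * 'C(n.+1, a))%:R : R) != 0.
  by rewrite pnatr_eq0 muln_eq0 negb_or/= -lt0n bin_gt0.
apply: (mulfI N0).
transitivity ('C(n.+2, a.+1)%:R * M a.+1 b *+ a.+1).
  by have /= -> := mul_bin_diag n.+2 a; rewrite natrM -mulr_natr; ring.
clear N0; rewrite H natrM mulrDr mulrDr; congr (_ + _).
  case: a E bE an H => [|a] E bE an H /=; first by rewrite mul0r !mulr0.
  have a_n : (a < n.+1)%N by lia.
  rewrite a_n; have -> : (n - a = b)%N by lia.
  have := mul_bin_diag n.+1 a; rewrite /= => D.
  have {}D : n.+1%:R * 'C(n, a)%:R = a.+1%:R * 'C(n.+1, a.+1)%:R :> R by rewrite -!natrM D.
  rewrite !natrM; transitivity (n.+2%:R * M a b * (n.+1%:R * 'C(n, a)%:R)); first by ring.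
  by rewrite D; ring.
clear H; case: b E bE => [|b] E bE.
  rewrite !(mulr0, mul0r) (_ : (a < n.+1)%N = false) ?mulr0//; lia.
have a_n : (a < n.+1)%N by lia.
rewrite a_n; have -> : (n - a = b)%N by lia.
have := mul_bin_down n.+1 a; rewrite /= => D.
have {}D : n.+1%:R * 'C(n, a)%:R = b.+1%:R * 'C(n.+1, a)%:R :> R.
  by rewrite -!natrM D -bE.
rewrite !natrM; transitivity (n.+2%:R * c * M a b * (n.+1%:R * 'C(n, a)%:R)); first by ring.
by rewrite D; ring.
Qed.

Lemma integrable_poly_pair (p q : {poly R}) :
  P.-integrable setT (EFin \o (fun w => p.[X w] * q.[Y w])).
Proof.
have addI (f g : T -> R) : P.-integrable setT (EFin \o f) ->
    P.-integrable setT (EFin \o g) -> P.-integrable setT (EFin \o (fun w => f w + g w)).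
  by move=> If Ig; exact: (integrableD measurableT If Ig).
have scaleI a (f : T -> R) : P.-integrable setT (EFin \o f) ->
    P.-integrable setT (EFin \o (fun w => a * f w)).
  by move=> If; exact: (integrableZl measurableT a If).
elim/poly_linear_ind: p => [|p1 p2 I1 I2|a p I1|n].
- under eq_fun do rewrite horner0 mul0r.
  exact: finite_measure_integrable_cst.
- by under eq_fun do rewrite hornerD mulrDl; exact: addI.
- by under eq_fun do rewrite hornerZ -mulrA; exact: scaleI.
elim/poly_linear_ind: q => [|q1 q2 I1 I2|a q I1|k].
- under eq_fun do rewrite horner0 mulr0.
  exact: finite_measure_integrable_cst.
- by under eq_fun do rewrite [(_ + _).[_]]hornerD mulrDr; exact: addI.
- by under eq_fun do rewrite [(_ *: _).[_]]hornerZ mulrCA; exact: scaleI.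
- by under eq_fun do rewrite !hornerXn; exact: integrable_mixed_moment.
Qed.

Let E (p q : {poly R}) := \int[P]_w (p.[X w] * q.[Y w]).

Let E0l q : E 0 q = 0.
Proof.
rewrite /E; under eq_Rintegral do rewrite horner0 mul0r.
exact: Rintegral_probability_cst.
Qed.

Let E0r p : E p 0 = 0.
Proof.
rewrite /E; under eq_Rintegral do rewrite horner0 mulr0.
exact: Rintegral_probability_cst.
Qed.

Let EDl p1 p2 q : E (p1 + p2) q = E p1 q + E p2 q.
Proof.
rewrite /E -RintegralD//; last 2 first.
- exact: integrable_poly_pair.
- exact: integrable_poly_pair.
by apply: eq_Rintegral => w _; rewrite hornerD mulrDl.
Qed.

Let EDr p q1 q2 : E p (q1 + q2) = E p q1 + E p q2.
Proof.
rewrite /E -RintegralD//; last 2 first.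
- exact: integrable_poly_pair.
- exact: integrable_poly_pair.
by apply: eq_Rintegral => w _; rewrite hornerD mulrDr.
Qed.

Let EZl a p q : E (a *: p) q = a * E p q.
Proof.
rewrite /E -RintegralZl//; last exact: integrable_poly_pair.
by apply: eq_Rintegral => w _; rewrite hornerZ mulrA.
Qed.

Let EZr a p q : E p (a *: q) = a * E p q.
Proof.
rewrite /E -RintegralZl//; last exact: integrable_poly_pair.
by apply: eq_Rintegral => w _; rewrite hornerZ mulrCA.
Qed.

Let EXX a b : E 'X^a 'X^b = M a b.
Proof. by apply: eq_Rintegral => w _; rewrite !hornerXn. Qed.

(** Both sides are bilinear, and on monomials this is [mixed_moment_recursion]. *)
Let stein p q : E ('X * p) q = E p^`() q + c * E p q^`().
Proof.
elim/poly_linear_ind: p => [|p1 p2 I1 I2|a p I1|n].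
- by rewrite mulr0 derivC !E0l mulr0 addr0.
- by rewrite mulrDr derivD !EDl I1 I2; ring.
- by rewrite -scalerAr derivZ !EZl I1; ring.
elim/poly_linear_ind: q => [|q1 q2 I1 I2|a q I1|k].
- by rewrite derivC !E0r mulr0 addr0.
- by rewrite derivD !EDr I1 I2; ring.
- by rewrite derivZ !EZr I1; ring.
rewrite -exprS !derivXn -(scaler_nat n 'X^_) -(scaler_nat k 'X^_) EZl EZr !EXX mixed_moment_recursion.
by ring.
Qed.

(** The derivative subtracted in the raising operator cancels the first term of [stein], so only the
    covariance term survives. Iterating it lowers both degrees and collects one factor [c] each
    time. *)
Let hermite_shift m q : E (hermite_poly R m.+1) q = c * E (hermite_poly R m) q^`().
Proof.
rewrite /= EDl -scaleN1r EZl stein; ring.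
Qed.

Lemma hermite_mean m : (0 < m)%N -> \int[P]_w hermite m (X w) = 0.
Proof.
case: m => // m _; transitivity (E (hermite_poly R m.+1) 1).
  by apply: eq_Rintegral => w _; rewrite hermiteE hornerC mulr1.
by rewrite hermite_shift derivC E0r mulr0.
Qed.

Lemma hermite_covariance m :
  \int[P]_w (hermite m (X w) * hermite m (Y w)) =
  m`!%:R * (\int[P]_w (X w * Y w)) ^+ m.
Proof.
transitivity (E (hermite_poly R m) (hermite_poly R m)).
  by apply: eq_Rintegral => w _; rewrite !hermiteE.
elim: m => [|m IH].
  rewrite /E expr0 fact0 mulr1 -[RHS](Rintegral_probability_cst P).
  by apply: eq_Rintegral => w _; rewrite /= !hornerC mulr1.
rewrite hermite_shift hermite_poly_deriv EZr IH factS natrM exprS -/c/=.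
by ring.
Qed.

Lemma integrable_hermite_pair m :
  P.-integrable setT (EFin \o (fun w => hermite m (X w) * hermite m (Y w))).
Proof.
under eq_fun do rewrite !hermiteE; exact: integrable_poly_pair.
Qed.

Lemma integrable_hermite m :
  P.-integrable setT (EFin \o (fun w => hermite m (X w))).
Proof.
rewrite (_ : (fun w => _) = (fun w => (hermite_poly R m).[X w] * 1.[Y w])).
  exact: integrable_poly_pair.
by apply/funext => w; rewrite hermiteE hornerC mulr1.
Qed.

End gaussian_pair.

(** * Hermite functionals of a stationary Gaussian sequence *)

Section pair_law.
Context d (T : measurableType d) (R : realType) (P : probability T R).

(** Stationarity is tested on rectangles only; they form an intersection-stable family generating
    the product sigma-algebra, so the two pushforward measures agree. *)
Lemma pair_law_Rintegral (X1 Y1 X2 Y2 : T -> R) (f : R * R -> R) :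
  measurable_fun setT X1 -> measurable_fun setT Y1 ->
  measurable_fun setT X2 -> measurable_fun setT Y2 ->
  (forall A B, measurable A -> measurable B ->
    P (X1 @^-1` A `&` Y1 @^-1` B) = P (X2 @^-1` A `&` Y2 @^-1` B)) ->
  measurable_fun setT f ->
  P.-integrable setT (EFin \o (fun w => f (X1 w, Y1 w))) ->
  P.-integrable setT (EFin \o (fun w => f (X2 w, Y2 w))) ->
  \int[P]_w f (X1 w, Y1 w) = \int[P]_w f (X2 w, Y2 w).
Proof.
move=> mX1 mY1 mX2 mY2 eqP12 mf I1 I2.
have m1 : measurable_fun setT (fun w => (X1 w, Y1 w)) by exact: measurable_fun_pair.
have m2 : measurable_fun setT (fun w => (X2 w, Y2 w)) by exact: measurable_fun_pair.
have mef : measurable_fun setT (EFin \o f) by exact/measurable_EFinP.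
rewrite /Rintegral; congr fine.
have p1 := @integral_pushforward _ _ _ _ _ _ m1 P setT _ mef I1 measurableT.
have p2 := @integral_pushforward _ _ _ _ _ _ m2 P setT _ mef I2 measurableT.
rewrite -[LHS]p1 -[RHS]p2; apply: eq_measure_integral => A mA _.
pose C : set (set (R * R)) :=
  [set C | exists A, measurable A /\ exists B, measurable B /\ C = A `*` B].
apply: (measure_unique C (fun=> setT)) mA => //.
- rewrite measurable_prod_measurableType//; congr (<<s _ >>).
  rewrite predeqE; split => [[U mU [V mV <-]]|[U [mU [V [mV ->]]]]].
    by exists U; split => //; exists V.
  by exists U => //; exists V.
- move=> _ _ [U1 [mU1 [U2 [mU2 ->]]]] [V1 [mV1 [V2 [mV2 ->]]]].
  rewrite -setXI; exists (U1 `&` V1); split; first exact: measurableI.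
  by exists (U2 `&` V2); split => //; exact: measurableI.
- move=> _; exists setT; split => //; exists setT; split => //.
  by rewrite setXTT.
- by rewrite predeqE => x; split => // _; exists 0%N.
- by move=> _ [U [mU [V [mV ->]]]]; exact: eqP12.
- move=> _; rewrite /= /pushforward preimage_setT.
  by rewrite (le_lt_trans (probability_le1 P measurableT))// ltry.
Qed.

End pair_law.

Section gaussian_stationary.
Context d (T : measurableType d) (R : realType) (P : probability T R).
Variable xi : nat -> T -> R.
Hypothesis mxi : forall n, measurable_fun [set: T] (xi n).
Hypothesis gxi : gaussian_sequence P xi.
Hypothesis sxi : stationary P xi.
Hypothesis Exi : ('E_P[xi 0%N] = 0)%E.
Hypothesis Vxi : ('V_P[xi 0%N] = 1)%E.

Lemma stationary_pair k l A B : measurable A -> measurable B ->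
  P (xi k @^-1` A `&` xi (k + l)%N @^-1` B) = P (xi 0%N @^-1` A `&` xi l @^-1` B).
Proof.
move=> mA mB.
(* Intersecting the two constraints, instead of choosing between them, keeps the case [l = 0]
   correct. *)
pose S i := (if i == 0%N then A else setT) `&` (if i == l then B else setT).
have mS i : measurable (S i) by apply: measurableI; case: ifP.
have E s : \bigcap_(i in [set j | (j < l.+1)%N]) (xi (s + i)%N @^-1` S i) =
    xi s @^-1` A `&` xi (s + l)%N @^-1` B.
  rewrite predeqE => w; split => [H|[wA wB] i _].
    split.
      by have [] := H 0%N isT; rewrite addn0.
    by have [_] := H l (ltnSn l); rewrite eqxx.
  rewrite /S; split; case: eqP => // ->; first by rewrite addn0.
  by [].
have := @sxi l.+1 k S mS; rewrite E => ->.
by rewrite -[in RHS](add0n l) -E.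
Qed.

Let gxi2 i j a b : gaussian_rv P (fun w => a * xi i w + b * xi j w).
Proof.
have := @gxi (maxn i j).+1 (fun k => a *+ (k == i) + b *+ (k == j)).
congr gaussian_rv; apply/funext => w.
have hi : (i < (maxn i j).+1)%N by rewrite ltnS leq_maxl.
have hj : (j < (maxn i j).+1)%N by rewrite ltnS leq_maxr.
under eq_bigr do rewrite mulrDl; rewrite big_split/=; congr (_ + _).
  rewrite (bigD1 (Ordinal hi))//= eqxx big1 ?addr0// => k ki.
  by rewrite (_ : (_ == i) = false) ?mulr0n ?mul0r//; apply: negbTE.
rewrite (bigD1 (Ordinal hj))//= eqxx big1 ?addr0// => k ki.
by rewrite (_ : (_ == j) = false) ?mulr0n ?mul0r//; apply: negbTE.
Qed.

Let gxi1 i : gaussian_rv P (xi i).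
Proof.
by have := gxi2 i i 1 0; congr gaussian_rv; apply/funext => w; rewrite mul1r mul0r addr0.
Qed.

Let Ixi i : P.-integrable setT (EFin \o xi i).
Proof.
have [m [s [I _]]] := gaussian_rv_moments (gxi1 i).
rewrite (_ : xi i = fun w => (xi i w - m) ^+ 1 + m).
  have Im : P.-integrable setT (EFin \o cst m) by exact: finite_measure_integrable_cst.
  exact: (integrableD measurableT (I 1%N) Im).
by apply/funext => w; rewrite expr1 subrK.
Qed.

Lemma gaussian_stationary_mean i : \int[P]_w xi i w = 0.
Proof.
transitivity (\int[P]_w xi 0%N w); last by move: Exi; rewrite unlock /Rintegral => ->.
apply: (@pair_law_Rintegral _ _ _ P (xi i) (xi i) (xi 0%N) (xi 0%N) fst) => //.
- by move=> A B mA mB; rewrite -[X in _ `&` xi X @^-1` _ ]addn0 stationary_pair.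
- exact: Ixi.
- exact: Ixi.
Qed.

Let Ixi2 i : P.-integrable setT (EFin \o (fun w => xi i w ^+ 2)).
Proof.
exact: (proj1 (centered_gaussian_moments (gxi1 i) (gaussian_stationary_mean i))).
Qed.

Lemma covariance_Rintegral k :
  fine (covariance P (xi 0%N) (xi k)) = \int[P]_w (xi 0%N w * xi k w).
Proof.
have E0 i : fine ('E_P[xi i]) = 0.
  by have := gaussian_stationary_mean i; rewrite unlock.
rewrite [in LHS]unlock !E0 unlock /Rintegral; congr fine.
by apply: eq_integral => w _ /=; rewrite /GRing.mul/= !subr0.
Qed.

Lemma gaussian_stationary_var i : \int[P]_w (xi i w ^+ 2) = 1.
Proof.
transitivity (\int[P]_w (xi 0%N w ^+ 2)).
  apply: (@pair_law_Rintegral _ _ _ P (xi i) (xi i) (xi 0%N) (xi 0%N) (fun x => x.1 ^+ 2)) => //.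
  - by move=> A B mA mB; rewrite -[X in _ `&` xi X @^-1` _ ]addn0 stationary_pair.
  - by apply: measurable_funX; exact: measurable_fst.
  - exact: Ixi2.
  - exact: Ixi2.
have := covariance_Rintegral 0; move: Vxi; rewrite /variance => -> /= E1; rewrite [RHS]E1.
by apply: eq_Rintegral => w _; rewrite expr2.
Qed.

Local Notation gam k := (fine (covariance P (xi 0%N) (xi k))).

Lemma covariance_shift i k : \int[P]_w (xi i w * xi (i + k)%N w) = gam k.
Proof.
have I a b : P.-integrable setT (EFin \o (fun w => xi a w * xi b w)).
  have := @integrable_mixed_moment _ _ _ P _ _ (gxi2 a b)
    (gaussian_stationary_mean a) (gaussian_stationary_mean b) 1 1.
  by under eq_fun do rewrite !expr1.
rewrite covariance_Rintegral.
apply: (@pair_law_Rintegral _ _ _ P (xi i) (xi (i + k)%N) (xi 0%N) (xi k)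
  (fun x => x.1 * x.2)) => //.
- by move=> A B mA mB; exact: stationary_pair.
- by apply: measurable_funM; [exact: measurable_fst|exact: measurable_snd].
- exact: I.
- exact: I.
Qed.

Lemma hermite_stationary_mean r i : (0 < r)%N -> \int[P]_w hermite r (xi i w) = 0.
Proof.
exact: (hermite_mean (gxi2 i i) (gaussian_stationary_mean i)
  (gaussian_stationary_mean i) (gaussian_stationary_var i) (gaussian_stationary_var i)).
Qed.

Lemma hermite_stationary_covariance r i k :
  \int[P]_w (hermite r (xi i w) * hermite r (xi (i + k)%N w)) = r`!%:R * gam k ^+ r.
Proof.
rewrite -(covariance_shift i k).
exact: (hermite_covariance (gxi2 i (i + k)%N) (gaussian_stationary_mean _)
  (gaussian_stationary_mean _) (gaussian_stationary_var _) (gaussian_stationary_var _)).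
Qed.

Lemma integrable_hermite_stationary r i :
  P.-integrable setT (EFin \o (fun w => hermite r (xi i w))).
Proof.
exact: (integrable_hermite (gxi2 i i) (gaussian_stationary_mean i)
  (gaussian_stationary_mean i)).
Qed.

Lemma integrable_hermite_stationary_prod r i j :
  P.-integrable setT (EFin \o (fun w => hermite r (xi i w) * hermite r (xi j w))).
Proof.
exact: (integrable_hermite_pair (gxi2 i j) (gaussian_stationary_mean i)
  (gaussian_stationary_mean j)).
Qed.

End gaussian_stationary.

(** * A maximal inequality for stationary partial sums *)

Section second_moments.
Context d (T : measurableType d) (R : realType) (P : probability T R).

Lemma markov_Rintegral (W : T -> R) (a e : R) : 0 < a ->
  P.-integrable setT (EFin \o W) -> (forall w, 0 <= W w) ->
  \int[P]_w W w <= e ->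
  measurable [set w | a <= W w] /\ (P [set w | (a <= W w)%R] <= (e / a)%:E)%E.
Proof.
move=> a0 IW W0 We.
have mW : measurable_fun setT W by apply/measurable_EFinP; exact: measurable_int IW.
have mA : measurable [set w | a <= W w].
  rewrite -[X in measurable X]setTI; have := mW measurableT `[a, +oo[%classic.
  rewrite (_ : W @^-1` _ = [set w | a <= W w]); first by apply.
  by apply/seteqP; split => w /=; rewrite in_itv/= andbT.
split => //.
set A := [set w | a <= W w] in mA *.
have PE : P A = (\int[P]_w (\1_A w)%:E)%E.
  by rewrite integral_indic// setIT.
have fW : (\int[P]_w (W w)%:E = (\int[P]_w W w)%R%:E)%E.
  by rewrite fineK//; exact: integrable_fin_num.
have h : (a%:E * P A <= \int[P]_w (W w)%:E)%E.
  rewrite PE -ge0_integralZl ?lee_fin ?(ltW a0)//; last first.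
    exact/measurable_EFinP/measurable_indic.
  apply: ge0_le_integral => //.
  - by move=> w _; rewrite -EFinM lee_fin mulr_ge0// ltW.
  - apply: measurable_funeM; exact/measurable_EFinP/measurable_indic.
  - exact/measurable_EFinP.
  - move=> w _; rewrite -EFinM lee_fin indicE; case: (boolP (w \in _)) => /=.
      by rewrite inE /= mulr1.
    by rewrite mulr0.
rewrite mulrC EFinM lee_pdivlMl//; apply: le_trans h _.
by rewrite fW lee_fin.
Qed.

Variables (h : nat -> T -> R) (rho : nat -> R).
Hypothesis Ihh : forall i j, P.-integrable setT (EFin \o (fun w => h i w * h j w)).
Hypothesis covh : forall i k, \int[P]_w (h i w * h (i + k)%N w) = rho k.

(** The usual [n rho(0) + 2 sum_(0<k<n) (n-k) rho(k)], arranged by the increments in [n], so that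
    growth of the variance can be obtained by summing twice. *)
Definition sum_var (n : nat) : R :=
  \sum_(j < n) (rho 0%N + 2 * \sum_(k < j) rho k.+1).

Lemma partial_sum_var s n :
  P.-integrable setT (EFin \o (fun w => (\sum_(i < n) h (s + i)%N w) ^+ 2)) /\
  \int[P]_w ((\sum_(i < n) h (s + i)%N w) ^+ 2) = sum_var n.
Proof.
elim: n => [|n [I E]].
  rewrite /sum_var big_ord0; under eq_Rintegral do rewrite big_ord0 expr0n.
  under eq_fun do rewrite big_ord0 expr0n.
  by split; [exact: finite_measure_integrable_cst|exact: Rintegral_probability_cst].
have Ic i : P.-integrable setT (EFin \o (fun w => h (s + i)%N w * h (s + n)%N w)).
  exact: Ihh.
have [I1 E1] := Rintegral_finsum n Ic.
have I2 := integrableZl measurableT 2 I1.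
have Eq w : (\sum_(i < n.+1) h (s + i)%N w) ^+ 2 =
    (\sum_(i < n) h (s + i)%N w) ^+ 2 +
    (2 * (\sum_(i < n) h (s + i)%N w * h (s + n)%N w) + h (s + n)%N w * h (s + n)%N w).
  by rewrite big_ord_recr/= sqrrD -mulr_suml -mulr_natl expr2; ring.
under eq_Rintegral do rewrite Eq.
under eq_fun do rewrite Eq.
have I3 : P.-integrable setT (EFin \o (fun w =>
   2 * (\sum_(i < n) h (s + i)%N w * h (s + n)%N w) + h (s + n)%N w * h (s + n)%N w)).
  exact: (integrableD measurableT I2 (Ihh (s + n) (s + n))).
split; first exact: (integrableD measurableT I I3).
rewrite RintegralD// RintegralD// RintegralZl// E E1 /sum_var big_ord_recr/=.
congr (_ + _); rewrite addrC; congr (_ + 2 * _).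
  by rewrite -(covh (s + n) 0); under [RHS]eq_Rintegral do rewrite addn0.
rewrite (reindex_inj rev_ord_inj)/=; apply: eq_bigr => i _.
have -> : (s + n = s + (n - i.+1) + i.+1)%N by have := ltn_ord i; lia.
exact: covh.
Qed.

(** Two consecutive blocks have the same variance, and [(x + y)^2 <= 2 x^2 + 2 y^2]. This controls
    the next power of two above a general [n]. *)
Lemma sum_var_double n : sum_var (2 * n) <= 4 * sum_var n.
Proof.
have [I1 E1] := partial_sum_var 0 n; have [I2 E2] := partial_sum_var n n.
have [I E] := partial_sum_var 0 (2 * n).
have I1' := integrableZl measurableT 2 I1; have I2' := integrableZl measurableT 2 I2.
have -> : 4 * sum_var n = \int[P]_w (2 * (\sum_(i < n) h (0 + i)%N w) ^+ 2
    + 2 * (\sum_(i < n) h (n + i)%N w) ^+ 2).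
  by rewrite RintegralD// !RintegralZl// E1 E2; ring.
rewrite -E; apply: le_Rintegral => //; first exact: (integrableD measurableT I1' I2').
move=> w _; rewrite mul2n -addnn big_split_ord/=.
under [X in (_ + X) ^+ 2]eq_bigr do rewrite add0n.
move: (\sum_(i < n) _) (\sum_(i < n) _) => x y.
have := sqr_ge0 (x - y); rewrite sqrrB sqrrD; lra.
Qed.

End second_moments.

(* Bisect: at each scale [k] moves by at most one dyadic block. *)
Lemma dyadic_chaining (R : realType) (S c : nat -> R) (p : nat) :
  (forall l b, (l < p)%N -> (b < 2 ^ (p - l))%N ->
     `|S (b.+1 * 2 ^ l)%N - S (b * 2 ^ l)%N| <= c l) ->
  forall k, (k < 2 ^ p)%N -> `|S k - S 0%N| <= \sum_(l < p) c l.
Proof.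
move=> Hc k kp.
suff : forall l b k, (l <= p)%N -> (b < 2 ^ (p - l))%N -> (k < 2 ^ l)%N ->
    `|S (b * 2 ^ l + k)%N - S (b * 2 ^ l)%N| <= \sum_(j < l) c j.
  by move=> /(_ p 0%N k (leqnn p)); rewrite mul0n add0n subnn; apply.
clear k kp; elim=> [|l IH] b k lp bp kl.
  by move: kl; rewrite expn0 ltnS leqn0 => /eqP ->; rewrite addn0 subrr normr0 big_ord0.
have pl : (p - l = (p - l.+1).+1)%N by lia.
have b2 : (b.*2.+1 < 2 ^ (p - l))%N by rewrite pl expnS; lia.
have bE : (b * 2 ^ l.+1 = b.*2 * 2 ^ l)%N by rewrite expnS -muln2; lia.
have [kl'|kl'] := ltnP k (2 ^ l).
  rewrite bE big_ord_recr/= ler_wpDr//; last by apply: IH => //; lia.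
  by apply: le_trans (Hc l 0%N _ _); rewrite ?expn_gt0//.
have -> : (b * 2 ^ l.+1 + k = b.*2.+1 * 2 ^ l + (k - 2 ^ l))%N by rewrite bE mulSn; lia.
rewrite bE big_ord_recr/=.
rewrite -(subrKA (S (b.*2.+1 * 2 ^ l)%N)).
apply: le_trans (ler_normD _ _) _; apply: lerD.
  by apply: IH => //; [lia|move: kl; rewrite expnS; lia].
by apply: Hc => //; lia.
Qed.

Lemma geometric_sum_le (R : realType) (x : R) (p : nat) : 0 <= x < 1 ->
  \sum_(l < p) x ^+ (p - l) <= (1 - x)^-1.
Proof.
move=> /andP[x0 x1]; rewrite -[leRHS]mul1r ler_pdivlMr ?subr_gt0//.
rewrite (reindex_inj rev_ord_inj)/=.
have -> : \sum_(i < p) x ^+ (p - (p - i.+1)) = \sum_(i < p) x ^+ i.+1.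
  by apply: eq_bigr => i _; congr (_ ^+ _); have := ltn_ord i; lia.
have -> : (\sum_(i < p) x ^+ i.+1) * (1 - x) = x - x ^+ p.+1.
  elim: p => [|p IH]; first by rewrite big_ord0 mul0r expr1 subrr.
  by rewrite big_ord_recr/= mulrDl IH [x ^+ p.+2]exprS; ring.
by have := exprn_ge0 p.+1 x0; lra.
Qed.

Section dyadic_maximal_inequality.
Context d (T : measurableType d) (R : realType) (P : probability T R).
Variables (h : nat -> T -> R) (rho : nat -> R).
Hypothesis Ihh : forall i j, P.-integrable setT (EFin \o (fun w => h i w * h j w)).
Hypothesis covh : forall i k, \int[P]_w (h i w * h (i + k)%N w) = rho k.
Local Notation v := (sum_var rho).

(* Blocks of length [2^l] are allowed deviations [~ q^(p-l)], where
   [2 / theta < q^2 < 1]: the deviations are summable and so are the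
   probabilities, of order [(2 / (theta q^2))^(p-l)]. *)
Lemma dyadic_maximal_inequality (theta C : R) (p0 : nat) : 2 < theta -> 0 < C ->
  (forall p, (p0 <= p)%N -> 0 < v (2 ^ p)) ->
  (forall p l, (p0 <= p)%N -> (l <= p)%N ->
     v (2 ^ l) * theta ^+ (p - l) <= C * v (2 ^ p)) ->
  exists K : R, 0 < K /\ forall (M : R) p, 0 < M -> (p0 <= p)%N ->
    exists B, measurable B /\ (P B <= (K / M ^+ 2)%:E)%E /\
      forall w k, ~ B w -> (k < 2 ^ p)%N ->
        `|\sum_(i < k) h i w| <= K * M * Num.sqrt (v (2 ^ p)).
Proof.
move=> th2 C0 vpos vC.
have th0 : 0 < theta by rewrite (lt_trans _ th2).
(* With [q] the midpoint of [u] and 1, [q^2 - u = ((1 - u)/2)^2 > 0], so both ratios [q] and [x] are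
   below 1. *)
pose u : R := 2 / theta; pose q : R := (1 + u) / 2; pose x : R := u / q ^+ 2.
have u0 : 0 < u by rewrite divr_gt0.
have u1 : u < 1 by rewrite ltr_pdivrMr// mul1r.
have q0 : 0 < q by rewrite divr_gt0// addr_gt0.
have q1 : q < 1 by rewrite /q; lra.
have q20 : 0 < q ^+ 2 by rewrite exprn_gt0.
have uq : u < q ^+ 2.
  rewrite -subr_gt0; have -> : q ^+ 2 - u = ((1 - u) / 2) ^+ 2 by rewrite /q; field.
  by rewrite exprn_gt0// divr_gt0// subr_gt0.
have x0 : 0 < x by rewrite divr_gt0.
have x1 : x < 1 by rewrite ltr_pdivrMr// mul1r.
have xE n : x ^+ n = 2 ^+ n / theta ^+ n / (q ^+ 2) ^+ n.
  by rewrite /x /u; move: (q ^+ 2) => z; rewrite 2!expr_div_n.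
clearbody x q.
exists (C * (1 - x)^-1 + (1 - q)^-1).
have K1 : 0 < C * (1 - x)^-1 by rewrite mulr_gt0// invr_gt0 subr_gt0.
have K2 : 0 < (1 - q)^-1 by rewrite invr_gt0 subr_gt0.
split; first by rewrite addr_gt0.
move=> M p M0 pp0; have vp := vpos p pp0.
pose S k w := \sum_(i < k) h i w.
pose blk l b w := \sum_(i < 2 ^ l) h (b * 2 ^ l + i)%N w.
have blkE l b w : S (b.+1 * 2 ^ l)%N w - S (b * 2 ^ l)%N w = blk l b w.
  rewrite /S mulSn addnC big_split_ord/= addrAC subrr add0r.
  by apply: eq_bigr.
pose Wl l w := \sum_(b < 2 ^ (p - l)) blk l b w ^+ 2.
(* One weighted sum collects all scales, so Markov's inequality is used once: where
   [W w < M^2 v(2^p)], every block of length [2^l] has square at most [q^(2(p-l)) M^2 v(2^p)]. *)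
pose W w := \sum_(l < p) (q ^+ 2) ^- (p - l) * Wl l w.
have Il l : P.-integrable setT (EFin \o Wl l) /\
    \int[P]_w Wl l w = (2 ^ (p - l))%:R * v (2 ^ l).
  have [I E] := Rintegral_finsum (2 ^ (p - l))
    (fun b => proj1 (partial_sum_var Ihh covh (b * 2 ^ l) (2 ^ l))).
  split => //; rewrite /Wl/blk E.
  under eq_bigr do rewrite (proj2 (partial_sum_var Ihh covh _ _)).
  by rewrite sumr_const card_ord mulr_natl.
have [IW EW] := Rintegral_finsum p (fun l =>
  integrableZl measurableT ((q ^+ 2) ^- (p - l)) (proj1 (Il l))).
have Wl0 l w : 0 <= Wl l w by apply: sumr_ge0 => b _; exact: sqr_ge0.
have qpl l : 0 < (q ^+ 2) ^- (p - l) by rewrite invr_gt0 exprn_gt0.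
have W0 w : 0 <= W w by apply: sumr_ge0 => l _; rewrite mulr_ge0// ltW.
have W_le : \int[P]_w W w <= C * (1 - x)^-1 * v (2 ^ p).
  rewrite [leLHS]EW; apply: (@le_trans _ _ (\sum_(l < p) C * v (2 ^ p) * x ^+ (p - l))).
    apply: ler_sum => l _; rewrite RintegralZl//; last exact: (proj1 (Il l)).
    rewrite (proj2 (Il l)) xE.
    have := vC p l pp0 (ltnW (ltn_ord l)).
    rewrite -ler_pdivlMr ?exprn_gt0// => hv.
    rewrite natrX mulrA (mulrC _ (2 ^+ _)).
    have -> : C * v (2 ^ p) * (2 ^+ (p - l) / theta ^+ (p - l) / q ^+ 2 ^+ (p - l)) =
      2 ^+ (p - l) / q ^+ 2 ^+ (p - l) * (C * v (2 ^ p) / theta ^+ (p - l)) by ring.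
    by rewrite ler_wpM2l// mulr_ge0 ?exprn_ge0// ltW.
  rewrite -mulr_sumr [leRHS]mulrAC ler_wpM2l ?mulr_ge0 ?(ltW C0) ?(ltW vp)//.
  by apply: geometric_sum_le; rewrite ltW.
have Mv0 : 0 < M ^+ 2 * v (2 ^ p) by rewrite mulr_gt0// exprn_gt0.
have [mB PB] := markov_Rintegral Mv0 IW W0 W_le.
exists [set w | M ^+ 2 * v (2 ^ p) <= W w]; split; first exact: mB.
split.
  apply: le_trans PB _; rewrite lee_fin.
  have -> : C * (1 - x)^-1 * v (2 ^ p) / (M ^+ 2 * v (2 ^ p)) = C * (1 - x)^-1 / M ^+ 2.
    by field; rewrite !gt_eqF// subr_gt0.
  by rewrite ler_wpM2r ?lerDl ?(ltW K2)// invr_ge0 exprn_ge0// ltW.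
move=> w k /negP; rewrite -ltNge => Ww kp.
have := @dyadic_chaining R (fun k => S k w) (fun l => M * Num.sqrt (v (2 ^ p)) * q ^+ (p - l)) p.
rewrite [S 0%N w]big_ord0 => /(_ _ k kp).
rewrite subr0 => H; apply: le_trans (H _) _ => {H}.
  move=> l b lp bp; rewrite blkE.
  have sv0 : 0 <= M * Num.sqrt (v (2 ^ p)) * q ^+ (p - l).
    by rewrite mulr_ge0 ?exprn_ge0 ?mulr_ge0 ?sqrtr_ge0 ?ltW.
  rewrite -(ger0_norm sv0) -ler_sqr ?nnegrE ?normr_ge0// !real_normK ?num_real//.
  rewrite !exprMn sqr_sqrtr ?(ltW vp)//.
  have h1 : blk l b w ^+ 2 <= Wl l w.
    rewrite /Wl (bigD1 (Ordinal bp))//= lerDl; apply: sumr_ge0 => i _; exact: sqr_ge0.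
  have h2 : (q ^+ 2) ^- (p - l) * Wl l w <= W w.
    rewrite /W (bigD1 (Ordinal lp))//= lerDl; apply: sumr_ge0 => i _.
    by rewrite mulr_ge0// ltW.
  have := le_lt_trans h2 Ww; rewrite mulrC ltr_pdivrMr ?exprn_gt0// => /ltW h3.
  by rewrite -exprM mulnC exprM; exact: le_trans h1 h3.
rewrite -mulr_sumr.
have svM : 0 <= M * Num.sqrt (v (2 ^ p)) by rewrite mulr_ge0 ?sqrtr_ge0 ?ltW.
apply: (@le_trans _ _ (M * Num.sqrt (v (2 ^ p)) * (1 - q)^-1)).
  by rewrite ler_wpM2l// geometric_sum_le// ltW.
rewrite mulrC [leRHS](_ : _ = (C * (1 - x)^-1 + (1 - q)^-1) * (M * Num.sqrt (v (2 ^ p)))).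
  by rewrite ler_wpM2r// lerDr ltW.
by rewrite mulrA.
Qed.

End dyadic_maximal_inequality.

(** * Growth of the variance of partial sums *)

Lemma archi_nat (R : realType) (x : R) : exists N : nat, x <= N%:R.
Proof.
exists (Num.truncn `|x|).+1.
by apply: le_trans (ler_norm x) _; apply/ltW; apply: truncnS_gt.
Qed.

Section growth.
Variables (R : realType) (rho : nat -> R).
Hypothesis rho_lim : forall e : R, 0 < e -> exists N, forall k, (N <= k)%N -> rho k < e.

Local Notation v := (sum_var rho).
Let B (j : nat) : R := rho 0%N + 2 * \sum_(k < j) rho k.+1.

Let BS j : B j.+1 = B j + 2 * rho j.+1.
Proof. by rewrite /B big_ord_recr/= mulrDr addrA. Qed.

Let vS n : v n.+1 = v n + B n.
Proof. by rewrite /sum_var big_ord_recr. Qed.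

(** Once [rho < e/4], the increments [B] grow with slope at most [e/2]; summing again leaves
    [(e/2) n^2] plus a linear term, which the other half of [e] absorbs for large [n]. *)
Lemma sum_var_subquadratic e : 0 < e ->
  exists N, forall n, (N <= n)%N -> v n <= e * n%:R ^+ 2.
Proof.
move=> e0; have e4 : 0 < e / 4 by rewrite divr_gt0.
have [N hN] := rho_lim e4.
have BN j : (N <= j)%N -> B j <= `|B N| + e / 2 * j%:R.
  move=> Nj; rewrite -(subnKC Nj); elim: (j - N)%N => [|k IH].
    have : 0 <= e / 2 * N%:R by rewrite mulr_ge0// divr_ge0// ltW.
    by rewrite addn0; have := ler_norm (B N); lra.
  rewrite addnS BS -(natr1 (N + k)); have := hN (N + k).+1 (leqW (leq_addr _ _)); move: IH; lra.
have vN n : (N <= n)%N -> v n <= `|v N| + (`|B N| + e / 2 * n%:R) * n%:R.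
  move=> Nn; rewrite -(subnKC Nn); elim: (n - N)%N => [|k IH].
    rewrite addn0; have := ler_norm (v N).
    have : 0 <= (`|B N| + e / 2 * N%:R) * N%:R by rewrite mulr_ge0 ?addr_ge0 ?mulr_ge0 ?divr_ge0// ltW.
    lra.
  have := BN (N + k)%N (leq_addr _ _); rewrite addnS vS -(natr1 (N + k)); move: IH.
  move: (v N) (v (N + k)%N) (B N) (B (N + k)%N) => a b c x h1 h2.
  have x0 : 0 <= e / 2 * (N + k)%:R by rewrite mulr_ge0// divr_ge0// ltW.
  have e20 : 0 <= e / 2 by rewrite divr_ge0// ltW.
  nra.
have [N2 hN2] := archi_nat ((`|v N| + `|B N|) / (e / 2)).
exists (maxn N N2).+1 => n; rewrite gtn_max => /andP[Nn N2n].
apply: le_trans (vN n (ltnW Nn)) _.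
have n1 : (1 : R) <= n%:R by rewrite ler1n; lia.
have : (`|v N| + `|B N|) / (e / 2) <= n%:R.
  by apply: le_trans hN2 _; rewrite ler_nat ltnW.
rewrite ler_pdivrMr ?divr_gt0// => h.
have h1 : `|v N| <= `|v N| * n%:R by rewrite ler_peMr.
have h2 : (`|v N| + `|B N|) * n%:R <= n%:R * (e / 2) * n%:R by rewrite ler_wpM2r// ltW// (lt_le_trans _ n1).
rewrite expr2; move: h1 h2; lra.
Qed.

Variables (q : R) (K : nat).
Hypothesis q2 : 1 / 2 < q.
Hypothesis rho_gt0 : forall k, (K <= k)%N -> 0 < rho k.
Hypothesis rho_even : forall k, (K <= k)%N -> q * rho k <= rho (2 * k).
Hypothesis rho_odd : forall k, (K <= k)%N -> q * rho k <= rho (2 * k).+1.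

Let q21 : 1 <= 2 * q. Proof. move: q2; lra. Qed.

Let from_K (f : nat -> R) (k0 : nat) :
  (forall j, (k0 <= j)%N -> f j <= f j.+1) -> forall i j, (k0 <= i)%N -> (i <= j)%N -> f i <= f j.
Proof.
move=> H i j ki ij; rewrite -(subnKC ij); elim: (j - i)%N => [|m IH]; first by rewrite addn0.
by apply: le_trans IH _; rewrite addnS; apply: H; rewrite (leq_trans ki)// leq_addr.
Qed.

Let B_nd i j : (K <= i)%N -> (i <= j)%N -> B i <= B j.
Proof.
apply: from_K => k Kk; rewrite BS lerDl mulr_ge0// ltW//.
by apply: rho_gt0; lia.
Qed.

(* [rho (2k) + rho (2k+1) >= 2 q rho k] in integrated form. *)
Let D_nd i j : (K <= i)%N -> (i <= j)%N ->
  B (2 * i).+1 - 2 * q * B i <= B (2 * j).+1 - 2 * q * B j.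
Proof.
apply: (@from_K (fun j => B (2 * j).+1 - 2 * q * B j)) => k Kk.
rewrite (_ : (2 * k.+1).+1 = (2 * k).+3)%N; last by lia.
rewrite (BS (2 * k).+2) (BS (2 * k).+1) (BS k).
have h1 := @rho_even k.+1 (leqW Kk); have h2 := @rho_odd k.+1 (leqW Kk).
rewrite (_ : (2 * k.+1) = (2 * k).+2)%N in h1 h2; last by lia.
lra.
Qed.

(** Along [s(p+1) = 2 s(p) + 1], [D_nd] says that each increment of [B] is at least [2 q >= 1] times
    the preceding one. They are therefore all at least the first, which is positive. *)
Let B_unbounded Lam : exists N, (K <= N)%N /\ forall j, (N <= j)%N -> Lam <= B j.
Proof.
pose s := fix s p := if p is p'.+1 then (2 * s p').+1 else K.
have sK p : (K <= s p)%N by elim: p => //= p IH; lia.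
have ss p : (s p <= s p.+1)%N by rewrite /=; lia.
pose del := B (s 1%N) - B (s 0%N).
have del0 : 0 < del.
  rewrite subr_gt0 (@lt_le_trans _ _ (B K.+1))//.
    by rewrite BS ltrDl mulr_gt0// rho_gt0.
  by apply: B_nd => /=; lia.
have step p : del <= B (s p.+1) - B (s p).
  elim: p => // p IH; apply: le_trans IH _.
  have D' : B (s p.+1) - 2 * q * B (s p) <= B (s p.+2) - 2 * q * B (s p.+1).
    exact: D_nd (sK p) (ss p).
  move: D' (B_nd (sK p) (ss p)).
  move: (B (s p)) (B (s p.+1)) (B (s p.+2)) => a b c h ab.
  have : 0 <= (2 * q - 1) * (b - a).
    by rewrite mulr_ge0 ?subr_ge0.
  lra.
have low p : B K + p%:R * del <= B (s p).
  elim: p => [|p IH]; first by rewrite mul0r addr0.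
  by rewrite -natr1 mulrDl mul1r; have := step p; lra.
have [p hp] := archi_nat ((Lam - B K) / del).
exists (s p); split => // j sj; apply: le_trans (B_nd (sK p) sj).
apply: le_trans (low p); rewrite -lerBlDl.
by rewrite -ler_pdivrMr.
Qed.

Let v_linear Lam : exists N, (K <= N)%N /\ forall n, (N <= n)%N -> Lam * n%:R <= v n.
Proof.
have [N [KN BN]] := B_unbounded (Lam + 1).
have low n : (N <= n)%N -> v N + (Lam + 1) * (n%:R - N%:R) <= v n.
  move=> Nn; rewrite -(subnKC Nn); elim: (n - N)%N => [|k IH].
    by rewrite addn0 subrr mulr0 addr0.
  have := BN (N + k)%N (leq_addr _ _).
  by rewrite addnS vS -natr1; move: IH; lra.
have [N2 hN2] := archi_nat ((Lam + 1) * N%:R - v N).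
exists (maxn N N2); split; first by rewrite leq_max KN.
move=> n; rewrite geq_max => /andP[Nn N2n]; apply: le_trans (low n Nn).
have : (N2%:R : R) <= n%:R by rewrite ler_nat.
lra.
Qed.

(** The second summation: passing from [m] to [m + 1] adds [B(2j) + B(2j+1)] with [j = m] to the
    left-hand variance [v(2m)], to be compared with [4 q B(j)]. *)
Let v_double_low : exists A, 0 <= A /\ exists N, (K <= N)%N /\
  forall m, (N <= m)%N -> 4 * q * v m - A * m%:R <= v (2 * m).
Proof.
have [N hN] := rho_lim (@ltr01 R).
pose k0 := maxn K N.
(* [D_nd] is applied twice, and [B(2j) = B(2j+1) - 2 rho(2j+1)] loses at most 2 because [rho < 1]
   from [N] on. *)
pose c := 2 * (B (2 * k0).+1 - 2 * q * B k0) - 2.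
have inc j : (k0 <= j)%N -> 4 * q * B j + c <= B (2 * j) + B (2 * j).+1.
  move=> kj; have := @D_nd k0 j (leq_maxl _ _) kj.
  have := BS (2 * j); have : rho (2 * j).+1 < 1 by apply: hN; move: kj; rewrite /k0; lia.
  rewrite /c; lra.
pose A := `|v (2 * k0) - 4 * q * v k0| + `|c|.
exists A; split; first by rewrite addr_ge0.
exists k0.+1; split; first by rewrite /k0; lia.
move=> m km.
suff : v (2 * k0) - 4 * q * v k0 - `|c| * (m%:R - k0%:R) <= v (2 * m) - 4 * q * v m.
  have m1 : (1 : R) <= m%:R by rewrite ler1n; lia.
  have k0m : (k0%:R : R) >= 0 by [].
  have h1 := ler_norm (- (v (2 * k0) - 4 * q * v k0)); rewrite normrN in h1.
  have h2 : `|c| * (m%:R - k0%:R) <= `|c| * m%:R by rewrite ler_wpM2l// lerBlDr lerDl.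
  have h3 : `|v (2 * k0) - 4 * q * v k0| <= `|v (2 * k0) - 4 * q * v k0| * m%:R.
    by rewrite ler_peMr.
  move=> hs; rewrite /A; lra.
have {km} km : (k0 <= m)%N by apply: ltnW.
rewrite -(subnKC km); elim: (m - k0)%N => [|i IH].
  by rewrite addn0 subrr mulr0 subr0.
rewrite addnS (_ : (2 * (k0 + i).+1 = (2 * (k0 + i)).+2)%N); last by lia.
rewrite !vS -natr1; have := inc (k0 + i)%N (leq_addr _ _).
have := ler_norm (- c); rewrite normrN; move: IH; lra.
Qed.

Lemma sum_var_growth : exists theta, 2 < theta /\ exists m0, (0 < m0)%N /\
  (forall m, (m0 <= m)%N -> 0 < v m /\ theta * v m <= v (2 * m)) /\
  (forall m n, (m0 <= m)%N -> (m <= n)%N -> v m <= v n).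
Proof.
have [A [A0 [N [KN H]]]] := v_double_low.
have q1 : 0 < 2 * q - 1 by move: q2; lra.
have [N1 [KN1 H1]] := v_linear (A / (2 * q - 1) + 1).
have [N2 [KN2 H2]] := B_unbounded 0.
(* A value strictly between 2 and [4 q]: the gap [4 q - theta = 2 q - 1] times the superlinear [v m]
   pays for the linear loss [A m]. *)
exists (2 * q + 1); split; first lra.
exists (maxn (maxn N N1) N2).+1; split => //; split.
  move=> m; rewrite gtn_max gtn_max => /andP[/andP[Nm N1m] N2m].
  have m1 : (1 : R) <= m%:R by rewrite ler1n; lia.
  have h1 := H1 m (ltnW N1m); have h := H m (ltnW Nm).
  have Am : 0 <= A / (2 * q - 1) by rewrite divr_ge0// ltW.
  have h2 : 0 <= A / (2 * q - 1) * m%:R by rewrite mulr_ge0.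
  split; first by move: h1; rewrite mulrDl mul1r; lra.
  have : (2 * q - 1) * (A / (2 * q - 1) * m%:R + m%:R) <= (2 * q - 1) * v m.
    by rewrite ler_wpM2l ?(ltW q1)//; move: h1; rewrite mulrDl mul1r.
  have -> : (2 * q - 1) * (A / (2 * q - 1) * m%:R + m%:R) = A * m%:R + (2 * q - 1) * m%:R.
    by field; rewrite gt_eqF.
  have : 0 <= (2 * q - 1) * m%:R by rewrite mulr_ge0 ?(ltW q1).
  lra.
apply: from_K => k kk; rewrite vS lerDl; apply: H2; lia.
Qed.

Lemma sum_var_dyadic : exists theta C p0, 2 < theta /\ 0 < C /\
  (forall p, (p0 <= p)%N -> 0 < v (2 ^ p)) /\
  (forall p l, (p0 <= p)%N -> (l <= p)%N ->
     v (2 ^ l) * theta ^+ (p - l) <= C * v (2 ^ p)).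
Proof.
have [th [th2 [m0 [m00 [H _]]]]] := sum_var_growth.
have th0 : 0 < th by lra.
have m0p p : (m0 <= p)%N -> (m0 <= 2 ^ p)%N.
  by move=> mp; apply: leq_trans mp (ltnW (ltn_expl _ _)).
have H1 l p : (m0 <= l)%N -> (l <= p)%N -> v (2 ^ l) * th ^+ (p - l) <= v (2 ^ p).
  move=> ml lp; rewrite -{2}(subnKC lp); elim: (p - l)%N => [|k IH].
    by rewrite expr0 mulr1 addn0.
  have [_ h] := H (2 ^ (l + k))%N (m0p _ (leq_trans ml (leq_addr _ _))).
  rewrite addnS expnS; apply: le_trans h.
  by rewrite exprS mulrCA ler_wpM2l// ltW.
have vm : 0 < v (2 ^ m0) by have [] := H _ (m0p _ (leqnn m0)).
(* The doubling inequality holds from [m0] on only; the finitely many smaller scales are absorbed in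
   the constant, by comparison with scale [m0]. *)
pose C := 1 + \sum_(l < m0) `|v (2 ^ l)| * th ^+ (m0 - l) / v (2 ^ m0).
have t0 (l : 'I_m0) : 0 <= `|v (2 ^ l)| * th ^+ (m0 - l) / v (2 ^ m0).
  by rewrite divr_ge0 ?mulr_ge0 ?exprn_ge0// ltW.
have C1 : 1 <= C by rewrite lerDl; apply: sumr_ge0 => l _; exact: t0.
exists th, C, m0; split => //; split; first exact: lt_le_trans C1.
have vp p : (m0 <= p)%N -> 0 < v (2 ^ p) by move=> /m0p /H [].
split => // p l mp lp.
have [ml|ml] := leqP m0 l.
  apply: le_trans (H1 _ _ ml lp) _.
  by rewrite ler_peMl// ltW// vp.
have Cl : `|v (2 ^ l)| * th ^+ (m0 - l) / v (2 ^ m0) <= C.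
  rewrite /C (bigD1 (Ordinal ml))//= addrCA lerDl addr_ge0//.
  by apply: sumr_ge0 => i _; exact: t0.
have -> : (p - l = (m0 - l) + (p - m0))%N by lia.
rewrite exprD mulrA.
apply: (@le_trans _ _ (C * v (2 ^ m0) * th ^+ (p - m0))).
  rewrite ler_wpM2r ?exprn_ge0 ?(ltW th0)// -ler_pdivrMr//.
  apply: le_trans Cl; rewrite ler_wpM2r ?invr_ge0 ?(ltW vm)//.
  by rewrite ler_wpM2r ?exprn_ge0 ?(ltW th0)// ler_norm.
by rewrite -mulrA ler_wpM2l ?H1// (le_trans _ C1).
Qed.

End growth.

(** * Uniform convergence for slowly varying functions *)

Section uniform_convergence.
Variable R : realType.
Local Notation mu := (@lebesgue_measure R).

Lemma lebesgue_measure_shift (u : R) (A : set R) : measurable A ->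
  mu ((fun x => x - u) @^-1` A) = mu A.
Proof.
move=> mA.
have ms : measurable_fun [set: measurableTypeR R] ((fun x : R => x - u) : _ -> measurableTypeR R).
  exact: measurable_funB.
pose nu : {measure set (measurableTypeR R) -> \bar R} :=
  measure_function_pushforward__canonical__measure_function_Measure mu ms.
transitivity (nu A) => //.
apply/esym/lebesgue_measure_unique => //= _ [[a b]] _ <-.
rewrite /nu/= /pushforward.
have -> : (fun x : R => x - u) @^-1` `]a, b]%classic = `]a + u, b + u]%classic.
  by apply/seteqP; split => x /=; rewrite !in_itv/= ltrBrDr lerBlDr.
by rewrite !lebesgue_measure_itv/= !lte_fin ltrD2r; case: ifP => // _; rewrite -!EFinB; congr _%:E; ring.
Qed.

Section sequence.
Variables (h : R -> R).
Hypothesis mh : measurable_fun [set: R] h.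
Hypothesis h_slow : forall u e : R, 0 < e ->
  exists X : R, forall x, X <= x -> `|h (x + u) - h x| <= e.

Let good (x : nat -> R) (e : R) (n : nat) : set R :=
  `[0, 2]%classic `&` \bigcap_(m in [set m | (n <= m)%N])
    [set u | `|h (x m + u) - h (x m)| <= e].

Let measurable_good x e n : measurable (good x e n).
Proof.
apply: measurableI; first exact: measurable_itv.
apply: bigcap_measurable; first by exists n => /=.
move=> m _.
have mf : measurable_fun [set: R] (fun u => `|h (x m + u) - h (x m)|).
  apply: measurableT_comp => //; apply: measurable_funB => //.
  by apply: measurableT_comp => //; exact: measurable_funD.
rewrite -[X in measurable X]setTI; have := mf measurableT `]-oo, e]%classic.
rewrite (_ : _ @^-1` _ = [set u | `|h (x m + u) - h (x m)| <= e]); first by apply.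
by apply/seteqP; split => u /=; rewrite in_itv.
Qed.

(** The sets [good x e n] increase with [n], and pointwise convergence makes their union the whole
    of [[0, 2]]; continuity from below gives a measure exceeding any number below 2. *)
Let good_large (x : nat -> R) (e : R) : 0 < e ->
  (forall X, exists N, forall n, (N <= n)%N -> X <= x n) ->
  exists N, forall n, (N <= n)%N -> ((3 / 2)%:E < mu (good x e n))%E.
Proof.
move=> e0 xoo.
have nd : nondecreasing_seq (good x e).
  move=> n m nm; apply/subsetPset => u [u02 H]; split => // k /= mk.
  by apply: H => /=; exact: leq_trans mk.
have cover : \bigcup_n good x e n = `[0, 2]%classic.
  apply/seteqP; split => [u [n _ []]//|u u02].
  have [X hX] := h_slow u e0; have [N hN] := xoo X.
  by exists N => //; split => // m /= Nm; apply: hX; exact: hN.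
have c1 := @nondecreasing_cvg_mu _ _ _ mu _ (measurable_good x e)
  (bigcup_measurable (fun k _ => measurable_good x e k)) nd.
have ndm : nondecreasing_seq (mu \o good x e).
  move=> n m nm; apply: le_measure; rewrite ?inE; [exact: measurable_good..|].
  exact/subsetPset/nd.
have c2 := ereal_nondecreasing_cvgn ndm.
have supE : ereal_sup (range (mu \o good x e)) = 2%:E.
  have := cvg_unique (@ereal_hausdorff R) c2 c1; rewrite cover => ->.
  have m02 := @lebesgue_measure_itv R `[0, 2].
  by rewrite [LHS]m02/= lte_fin ltr0n/= oppr0 adde0.
have : ((3 / 2)%:E < ereal_sup (range (mu \o good x e)))%E.
  by rewrite supE lte_fin; lra.
move=> /ereal_sup_gt [_ [N _ <-] hN]; exists N => n Nn.
by apply: lt_le_trans hN _; exact: ndm.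
Qed.

(* Steinhaus: two subsets of [[0, 3]] of measure > 3/2 meet. *)
Lemma slow_variation_uniform (x u : nat -> R) (e : R) : 0 < e ->
  (forall X, exists N, forall n, (N <= n)%N -> X <= x n) ->
  (forall n, 0 <= u n <= 1) ->
  exists N, forall n, (N <= n)%N -> `|h (x n + u n) - h (x n)| <= e.
Proof.
move=> e0 xoo u01; have e20 : 0 < e / 2 by rewrite divr_gt0.
have yoo X : exists N, forall n, (N <= n)%N -> X <= x n + u n.
  have [N hN] := xoo X; exists N => n Nn.
  by have := hN n Nn; have /andP[] := u01 n; lra.
have [N1 h1] := good_large e20 xoo; have [N2 h2] := good_large e20 yoo.
exists (maxn N1 N2) => n; rewrite geq_max => /andP[N1n N2n].
have {}h1 := h1 n N1n; have {}h2 := h2 n N2n.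
set A := good x (e / 2) n in h1; set C := good _ _ n in h2.
pose C' := (fun v => v - u n) @^-1` C.
have mA : measurable A by exact: measurable_good.
have mC : measurable C by exact: measurable_good.
have mC' : measurable C'.
  have ms : measurable_fun [set: R] (fun v => v - u n) by exact: measurable_funB.
  by rewrite /C' -[X in measurable X]setTI; exact: ms.
(* At a common [v], both [h (x n)] and [h (x n + u n)] are within [e/2] of [h (x n + v)]. The
   shifted set stays in [[0, 3]] because [0 <= u n <= 1]. *)
have [[v [[/= v02 Av] [Cv02 Cv]]]|noI] := pselect (exists v, A v /\ C' v).
  have a1 := Av n (leqnn n); have a2 := Cv n (leqnn n); rewrite /= in a1 a2.
  rewrite (_ : x n + u n + (v - u n) = x n + v) in a2; last by ring.
  rewrite -(subrKA (h (x n + v))); apply: le_trans (ler_normD _ _) _.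
  by rewrite distrC [leRHS](splitr e) lerD.
exfalso; have AC0 : A `&` C' = set0.
  by rewrite -subset0 => v AC; apply: noI; exists v.
have mC'E : mu C' = mu C by rewrite /C' lebesgue_measure_shift.
have sub : A `|` C' `<=` `[0, 3]%classic.
  have /andP[un0 un1] := u01 n.
  move=> v [[v02 _]|[v02 _]]; move: v02; rewrite /= in_itv/= => /andP[a1 a2];
    rewrite /= in_itv/=; apply/andP; split; lra.
have : (mu (A `|` C') <= mu `[0%R, 3%R]%classic)%E.
  by apply: le_measure => //; rewrite inE; [exact: measurableU|exact: measurable_itv].
have mAC : mu (A `|` C') = (mu A + mu C')%E by exact: measureU.
have m03 := @lebesgue_measure_itv R `[0, 3].
rewrite mAC mC'E [leRHS]m03/= lte_fin ltr0n/= oppr0 adde0.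
apply/negP; rewrite -ltNge.
have -> : (3%:E = (3 / 2)%:E + (3 / 2)%:E :> \bar R)%E by rewrite -EFinD; congr _%:E; lra.
exact: lteD.
Qed.

End sequence.
End uniform_convergence.

(** * Regular variation along the integers *)

Section regular_variation.
Variable R : realType.

(** The dilation factor [(n+1)/n] varies with [n], so slow variation at a fixed factor does not
    suffice. In the additive form [h x = ln (L (e^x))] the shifts [ln ((n+2)/(n+1))] lie in
    [[0, 1]], and [slow_variation_uniform] applies. *)
Lemma slowly_varying_succ (L : R -> R) : slowly_varying L ->
  (fun n : nat => L n.+1%:R / L n%:R) @ \oo --> (1 : R).
Proof.
move=> [mL [[x0 Lpos] Lslow]].
pose h x := ln (L (expR x)).
have mh : measurable_fun [set: R] h.
  apply: measurableT_comp; first exact: measurable_ln.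
  apply: measurableT_comp => //; exact: measurable_expR.
have hslow u e : 0 < e -> exists X, forall x, X <= x -> `|h (x + u) - h x| <= e.
  move=> e0.
  have lim : (fun x => ln (L (expR u * x) / L x)) @ +oo --> (0 : R).
    rewrite -(@ln1 R); apply: (@cvg_comp _ _ _ _ (@ln R) _ _ _ (Lslow _ (expR_gt0 u))).
    exact: continuous_ln.
  have /cvgrPdist_le/(_ e e0)[A [_ HA]] := lim.
  pose B := Num.max 1 (Num.max (`|A| + 1) (Num.max (`|x0| + 1) ((`|x0| + 1) / expR u))).
  have B0 : 0 < B by rewrite lt_max ltr01.
  exists (ln B) => x Bx.
  have ex : B <= expR x by rewrite -ler_ln ?posrE ?expR_gt0// expRK.
  have eA : A < expR x.
    rewrite (lt_le_trans _ ex)// !lt_max; apply/orP; right; apply/orP; left.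
    by have := ler_norm A; lra.
  have ex0 : x0 < expR x.
    rewrite (lt_le_trans _ ex)// !lt_max; apply/orP; right; apply/orP; right; apply/orP; left.
    by have := ler_norm x0; lra.
  have exu : x0 < expR (x + u).
    rewrite expRD -ltr_pdivrMr ?expR_gt0// (lt_le_trans _ ex)// !lt_max.
    apply/orP; right; apply/orP; right; apply/orP; right.
    by rewrite ltr_pM2r ?invr_gt0 ?expR_gt0//; have := ler_norm x0; lra.
  have := HA _ eA; rewrite /= sub0r normrN -expRD addrC ln_div ?posrE//; exact: Lpos.
pose x (n : nat) := ln n.+1%:R : R; pose u (n : nat) := ln n.+2%:R - ln n.+1%:R : R.
have xoo X : exists N, forall n, (N <= n)%N -> X <= x n.
  have [N hN] := archi_nat (expR X); exists N => n Nn.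
  rewrite /x -ler_expR lnK ?posrE ?ltr0n//; apply: le_trans hN _.
  by rewrite ler_nat (leq_trans Nn).
have u01 n : 0 <= u n <= 1.
  rewrite /u subr_ge0 ler_ln ?posrE ?ltr0n// ler_nat leqnSn/=.
  rewrite -ln_div ?posrE ?ltr0n//.
  have -> : n.+2%:R / n.+1%:R = 1 + n.+1%:R^-1 :> R.
    by rewrite -[n.+2%:R]natr1; field.
  apply: le_trans (le_ln1Dx _) _; last by rewrite invf_le1 ?ltr0n// ler1n.
  by rewrite (lt_trans (ltrN10 R))// invr_gt0 ltr0n.
have S := @slow_variation_uniform R h mh hslow x u.
have lim : (fun n : nat => ln (L n.+2%:R / L n.+1%:R)) @ \oo --> (0 : R).
  apply/cvgrPdist_le => e e0; have [N hN] := S e e0 xoo u01.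
  have [N0 hN0] := archi_nat (`|x0| + 1).
  exists (maxn N N0) => // n /=; rewrite geq_max => /andP[Nn N0n].
  have pos k : (n < k)%N -> 0 < L k%:R.
    move=> nk; apply: Lpos; have : (N0%:R : R) <= k%:R by rewrite ler_nat; lia.
    by have := ler_norm x0; move: hN0; lra.
  have xu : x n + u n = ln n.+2%:R by rewrite /u /x addrC subrK.
  have := hN n Nn; rewrite xu /h /x !lnK ?posrE ?ltr0n//.
  by rewrite sub0r normrN ln_div ?posrE//; apply: pos.
have lim2 : (fun n : nat => L n.+2%:R / L n.+1%:R) @ \oo --> (1 : R).
  have c : (fun n : nat => expR (ln (L n.+2%:R / L n.+1%:R))) @ \oo --> expR (0 : R).
    by apply: continuous_cvg; [exact: continuous_expR|exact: lim].
  rewrite expR0 in c.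
  apply: cvg_trans c; apply: near_eq_cvg.
  have [N0 hN0] := archi_nat (`|x0| + 1).
  exists N0 => // n /= N0n.
  have pos k : (n < k)%N -> 0 < L k%:R.
    move=> nk; apply: Lpos; have : (N0%:R : R) <= k%:R by rewrite ler_nat; lia.
    by have := ler_norm x0; move: hN0; lra.
  by rewrite lnK// posrE divr_gt0//; apply: pos.
by rewrite -cvg_shiftS.
Qed.

End regular_variation.

Lemma cvgn_eq_near (R : realType) (f g : nat -> R) (l : R) (N : nat) :
  f @ \oo --> l -> (forall n, (N <= n)%N -> f n = g n) -> g @ \oo --> l.
Proof.
by move=> fl fg; apply: cvg_trans fl; apply: near_eq_cvg; exists N.
Qed.

Lemma cvgnM (R : realType) (f g : nat -> R) (a b : R) :
  f @ \oo --> a -> g @ \oo --> b -> (fun n => f n * g n) @ \oo --> a * b.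
Proof. by move=> fa gb; exact: cvgM. Qed.

Lemma half_even_odd k : k = (2 * k./2)%N \/ k = (2 * k./2).+1.
Proof. by have := odd_double_half k; case: (odd k); lia. Qed.

Lemma half_between K k : (2 * K.+1 <= k)%N -> (K <= k./2 < k)%N.
Proof. lia. Qed.

Lemma half_geq_scaled p K k : (2 ^ p.+1 * K.+1 <= k)%N ->
  (2 ^ p * K.+1 <= k./2)%N /\ (K <= k./2)%N.
Proof.
rewrite expnS -mulnA => h; have p0 : (0 < 2 ^ p)%N by rewrite expn_gt0.
have Kh : (2 ^ p * K.+1 <= k./2)%N by move: (2 ^ p * K.+1)%N h => y h; lia.
by split => //; apply: leq_trans Kh; nia.
Qed.

Section regular_covariance.
Variables (R : realType) (g : nat -> R) (L : R -> R) (D : R).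
Hypothesis D01 : 0 < D < 1.
Hypothesis sL : slowly_varying L.
Hypothesis gE : asymp_equiv g (fun k => npow k (- D) * L k%:R).
Local Notation a := (fun k : nat => npow k (- D) * L k%:R).
Let beta : R := 2 `^ (- D).

Let powR_div (y z p : R) : 0 < y -> 0 < z -> (y / z) `^ p = y `^ p / z `^ p.
Proof.
move=> y0 z0; apply: (mulIf (x := z `^ p)); first by rewrite gt_eqF// powR_gt0.
by rewrite -powRM ?divr_ge0 ?ltW// !divfK// gt_eqF// powR_gt0.
Qed.

Let npow_gt0 n (p : R) : (0 < n)%N -> 0 < npow n p.
Proof. by move=> n0; rewrite powR_gt0// ltr0n. Qed.

Let a_gt0 : exists N, forall k, (N <= k)%N -> 0 < a k.
Proof.
have [_ [[x0 Lpos] _]] := sL; have [N hN] := archi_nat (`|x0| + 1).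
exists (maxn N 1) => k; rewrite geq_max => /andP[Nk k1].
rewrite mulr_gt0 ?npow_gt0// Lpos//; have : (N%:R : R) <= k%:R by rewrite ler_nat.
by have := ler_norm x0; lra.
Qed.

Let a_succ : (fun k => a k.+1 / a k) @ \oo --> (1 : R).
Proof.
have h1 : (fun n : nat => npow n.+1 (- D) / npow n (- D)) @ \oo --> (1 : R).
  (* The ratio is [(n/(n+1))^D], which lies between [n/(n+1)] and 1 because [0 < D < 1]. *)
  apply: (@squeeze_cvgr _ _ _ _ (fun n : nat => 1 - n.+1%:R^-1) (fun=> 1)).
  - exists 1%N => // n /= n1.
    have n0 : 0 < n%:R :> R by rewrite ltr0n.
    have -> : npow n.+1 (- D) / npow n (- D) = (n%:R / n.+1%:R) `^ D.
      by rewrite /npow !powRN invrK powR_div ?ltr0n// mulrC.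
    have x0 : 0 < n%:R / n.+1%:R :> R by rewrite divr_gt0 ?ltr0n.
    have x1 : n%:R / n.+1%:R <= 1 :> R by rewrite ler_pdivrMr ?ltr0n// mul1r ler_nat.
    have /andP[D0 D1] := D01.
    apply/andP; split.
      have -> : 1 - n.+1%:R^-1 = n%:R / n.+1%:R :> R.
        by rewrite -[n.+1%:R]natr1; field; rewrite gt_eqF// ltr_wpDr.
      rewrite -[leLHS]powRr1 ?(ltW x0)//; apply: ger_powR; last exact: ltW.
      by rewrite x0.
    by rewrite -[leRHS](powRr0 (n%:R / n.+1%:R)) ger_powR ?x0// ltW.
  - rewrite -[X in _ --> X]subr0; apply: cvgB; first exact: cvg_cst.
    exact: cvg_harmonic.
  - exact: cvg_cst.
have := cvgnM h1 (slowly_varying_succ sL); rewrite mulr1 => cv.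
apply: (cvgn_eq_near (N := 0) cv) => n _.
by rewrite /= invfM mulrACA.
Qed.

Let a_double : (fun k => a (2 * k)%N / a k) @ \oo --> beta.
Proof.
have [_ [_ Ls]] := sL.
have l1 : (fun n : nat => L (2 * n%:R) / L n%:R) @ \oo --> (1 : R).
  have L2 := Ls 2 (ltr0n _ 2).
  exact: (@cvg_comp _ _ _ (fun n : nat => n%:R : R) (fun x => L (2 * x) / L x) _ _ _ (@cvgr_idn R) L2).
have cb : (fun _ : nat => beta) @ \oo --> beta by exact: cvg_cst.
have := cvgnM cb l1; rewrite mulr1 => cv; apply: (cvgn_eq_near (N := 1) cv) => n n1.
have nD : npow n (- D) != 0 by rewrite gt_eqF// npow_gt0.
have -> : npow (2 * n) (- D) = beta * npow n (- D) by rewrite /npow natrM powRM.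
rewrite natrM; move: (npow n (- D)) nD (L (2 * n%:R)) (L n%:R) => p p0 x y.
transitivity (beta * (p / p) * (x / y)); first by rewrite divff// mulr1.
by rewrite invfM; ring.
Qed.

Let a_double1 : (fun k => a (2 * k).+1 / a k) @ \oo --> beta.
Proof.
have l1 : (fun k => a (2 * k).+1 / a (2 * k)%N) @ \oo --> (1 : R).
  apply: (@cvg_comp _ _ _ (fun k => 2 * k)%N (fun k => a k.+1 / a k) _ \oo _ _ a_succ).
  by move=> /= A [N _ NA]; exists N => // n /= Nn; apply: NA => /=; lia.
have := cvgnM l1 a_double; rewrite mul1r => cv.
have [N hN] := a_gt0; apply: (cvgn_eq_near (N := N) cv) => n Nn.
by rewrite /= mulrA divfK// gt_eqF// hN//; lia.
Qed.

Let ratio (s : nat -> nat) : (forall n, (n <= s n)%N) ->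
  (fun k => a (s k) / a k) @ \oo --> beta -> (fun k => g (s k) / g k) @ \oo --> beta.
Proof.
move=> sn al.
have l1 : (fun k => g (s k) / a (s k)) @ \oo --> (1 : R).
  apply: (@cvg_comp _ _ _ s (fun k => g k / a k) _ \oo _ _ gE).
  by move=> /= A [N _ NA]; exists N => // n /= Nn; apply: NA => /=; rewrite (leq_trans Nn).
have l2 : (fun k => (g k / a k)^-1) @ \oo --> (1 : R).
  by rewrite -[X in _ --> X]invr1; apply: cvgV.
have := cvgnM (cvgnM l1 al) l2; rewrite mul1r mulr1 => cv.
have [N hN] := a_gt0; apply: (cvgn_eq_near (N := N) cv) => n Nn.
have an : a n != 0 by rewrite gt_eqF// hN.
have asn : a (s n) != 0 by rewrite gt_eqF// hN// (leq_trans Nn).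
rewrite /= invf_div; move: an asn; move: (a n) (a (s n)) => x y x0 y0.
transitivity (g (s n) / g n * (y / y) * (x / x)); first by ring.
by rewrite !divff// !mulr1.
Qed.

Lemma regular_covariance_gt0 : exists N, forall k, (N <= k)%N -> 0 < g k.
Proof.
have /cvgrPdist_lt/(_ _ ltr01)[N1 _ h1] := gE; have [N2 h2] := a_gt0.
exists (maxn N1 N2) => k; rewrite geq_max => /andP[N1k N2k].
have := h1 k N1k; rewrite /= ltr_norml => /andP[_ h3].
have : 0 < g k / a k by move: h3; lra.
by rewrite pmulr_lgt0// invr_gt0 h2.
Qed.

Lemma regular_covariance_double (b c : R) : b < beta < c ->
  exists N, forall k, (N <= k)%N ->
    [/\ 0 < g k, b * g k < g (2 * k)%N < c * g k & b * g k < g (2 * k).+1 < c * g k].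
Proof.
move=> /andP[bb bc].
have e0 : 0 < Num.min (beta - b) (c - beta) by rewrite lt_min !subr_gt0 bb.
have r1 := ratio (fun n => leq_pmull n (isT : 0 < 2)%N) a_double.
have s2 n : (n <= (2 * n).+1)%N by lia.
have r2 := ratio s2 a_double1.
have /cvgrPdist_lt/(_ _ e0)[N1 _ h1] := r1.
have /cvgrPdist_lt/(_ _ e0)[N2 _ h2] := r2.
have [N3 h3] := regular_covariance_gt0.
exists (maxn (maxn N1 N2) N3) => k; rewrite !geq_max => /andP[/andP[N1k N2k] N3k].
have gk := h3 k N3k; have {}h1 := h1 k N1k; have {}h2 := h2 k N2k.
rewrite /= !lt_min !ltr_norml in h1 h2.
have dv w : b < w / g k -> w / g k < beta + (c - beta) -> b * g k < w < c * g k.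
  by rewrite addrCA subrr addr0 ltr_pdivlMr// ltr_pdivrMr// => -> ->.
split => //; apply: dv.
- move: h1; lra.
- move: h1; lra.
- move: h2; lra.
- move: h2; lra.
Qed.

(** [L] may be unbounded, so decay is drawn from the doubling ratio: [beta < c < 1] gives
    [g k <= c g(k/2)] for large [k]. Repeated halving first bounds [g] by [M], then by [c^p M]. *)
Lemma regular_covariance_lim (e : R) : 0 < e ->
  exists N, forall k, (N <= k)%N -> g k < e.
Proof.
move=> e0.
have b1 : beta < 1.
  have /andP[D0 _] := D01.
  rewrite /beta powRN invf_lt1 ?powR_gt0// /powR ifF ?pnatr_eq0//.
  by rewrite expR_gt1 mulr_gt0// ln_gt0// ltr1n.
have b0 : 0 < beta by rewrite powR_gt0.
pose c := (1 + beta) / 2.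
have c1 : c < 1 by rewrite /c; lra.
have c0 : 0 < c by rewrite /c; lra.
have bc : 0 < beta < c by rewrite b0 /c; lra.
have [K hK] := regular_covariance_double bc.
pose M := \sum_(k < 2 * K.+1) `|g k|.
have M0 : 0 <= M by apply: sumr_ge0.
have gM k : (K <= k)%N -> g k <= M.
  elim/ltn_ind: k => k IH Kk.
  have [k2|k2] := ltnP k (2 * K.+1).
    rewrite /M (bigD1 (Ordinal k2))//=; apply: le_trans (ler_norm _) _.
    by rewrite lerDl; apply: sumr_ge0.
  have h2 := half_between k2.
  have /andP[Kh hk] := h2; have := IH _ hk Kh.
  have [gh /andP[_ g1] /andP[_ g2]] := hK _ Kh.
  have cg : c * g k./2 <= g k./2 by rewrite ler_piMl// ltW.
  by case: (half_even_odd k) => E; rewrite [in g k]E; lra.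
have geo p k : (2 ^ p * K.+1 <= k)%N -> g k <= c ^+ p * M.
  elim: p k => [|p IH] k; first by rewrite expn0 mul1n expr0 mul1r => h; apply: gM; exact: ltnW.
  move=> /half_geq_scaled[Kh Kh2].
  have := IH _ Kh; have [gh /andP[_ g1] /andP[_ g2]] := hK _ Kh2.
  rewrite exprS -mulrA => h3.
  have h4 : c * g k./2 <= c * (c ^+ p * M) by rewrite ler_wpM2l// ltW.
  by case: (half_even_odd k) => E; rewrite [in g k]E; lra.
have cl : (fun p => c ^+ p * M) @ \oo --> (0 : R).
  rewrite -[X in _ --> X](mul0r M); apply: cvgM; last exact: cvg_cst.
  by apply: cvg_expr; rewrite ger0_norm// ltW.
have /cvgrPdist_lt/(_ _ e0)[p _ hp] := cl.
exists (2 ^ p * K.+1)%N => k /geo h; apply: le_lt_trans h _.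
by have := hp p (leqnn p); rewrite /= sub0r normrN; apply: le_lt_trans; exact: ler_norm.
Qed.

End regular_covariance.

Lemma regular_covariance_power (R : realType) (g : nat -> R) (L : R -> R) (D c : R)
    (r : nat) (rho : nat -> R) :
  0 < D < 1 -> slowly_varying L ->
  asymp_equiv g (fun k => npow k (- D) * L k%:R) ->
  (0 < r)%N -> D * r%:R < 1 -> 0 < c -> (forall k, rho k = c * g k ^+ r) ->
  exists q K, [/\ 1 / 2 < q,
    forall k, (K <= k)%N -> 0 < rho k,
    forall k, (K <= k)%N -> q * rho k <= rho (2 * k)%N,
    forall k, (K <= k)%N -> q * rho k <= rho (2 * k).+1 &
    forall e, 0 < e -> exists N, forall k, (N <= k)%N -> rho k < e].
Proof.
move=> D01 sL gE r0 Dr c0 rhoE.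
have br : 1 / 2 < (2 `^ (- D)) ^+ r :> R.
  rewrite -powR_mulrn ?powR_ge0// -powRrM mulNr powRN.
  rewrite div1r ltf_pV2 ?posrE ?powR_gt0// -[ltRHS]powRr1// /powR ifF ?pnatr_eq0//.
  by rewrite ltr_expR ltr_pM2r// ln_gt0// ltr1n.
(* [D r < 1] gives the strict inequality [2^(-D r) > 1/2], which by continuity survives a slight
   decrease of the base; [q] will be [b^r]. *)
have [b /andP[b0 bb] bq] : exists2 b : R, 0 < b < 2 `^ (- D) & 1 / 2 < b ^+ r.
  have cx : (fun x : R => x ^+ r) @ (2 `^ (- D))^'- --> (2 `^ (- D)) ^+ r.
    by apply: cvg_at_left_filter; exact: exprn_continuous.
  have : \forall x \near (2 `^ (- D))^'-, 1 / 2 < x ^+ r :> R.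
    exact: (cvgr_gt _ cx).
  move=> H.
  have H2 : \forall x \near ((2 : R) `^ (- D))^'-, 0 < x by apply: nbhs_left_gt; rewrite powR_gt0.
  have H3 : \forall x \near ((2 : R) `^ (- D))^'-, x < 2 `^ (- D) by exact: nbhs_left_lt.
  have [x [[h1 h2] h3]] := filter_ex (filterI (filterI H H2) H3).
  by exists x => //; rewrite h2.
have bc : b < 2 `^ (- D) < 2 `^ (- D) + 1 by rewrite bb ltrDl ltr01.
have [K hK] := @regular_covariance_double _ g L D D01 sL gE b _ bc.
exists (b ^+ r), K; split => //.
- by move=> k /hK[gk _ _]; rewrite rhoE mulr_gt0// exprn_gt0.
- move=> k /hK[gk /andP[/ltW h _] _]; rewrite !rhoE mulrCA ler_wpM2l ?(ltW c0)// -exprMn.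
  have bg := ltW (mulr_gt0 b0 gk).
  by apply: lerXn2r => //; rewrite nnegrE// (le_trans bg h).
- move=> k /hK[gk _ /andP[/ltW h _]]; rewrite !rhoE mulrCA ler_wpM2l ?(ltW c0)// -exprMn.
  have bg := ltW (mulr_gt0 b0 gk).
  by apply: lerXn2r => //; rewrite nnegrE// (le_trans bg h).
- move=> e e0.
  (* The bound [g < 1] reduces the power, [g^r <= g], and [g < e/c] concludes. *)
  have e1 : 0 < Num.min 1 (e / c) by rewrite lt_min ltr01 divr_gt0.
  have [N1 h1] := regular_covariance_lim D01 sL gE e1.
  have [N2 h2] := regular_covariance_gt0 sL gE.
  exists (maxn N1 N2) => k; rewrite geq_max => /andP[/h1 + /h2 g0].
  rewrite lt_min => /andP[g1 gec]; rewrite rhoE mulrC -ltr_pdivlMr//.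
  apply: le_lt_trans gec; rewrite -[leRHS]expr1; apply: ler_wiXn2l => //; exact: ltW.
Qed.

(** * Ranks and sample quantiles *)

Section ranks_quantile.
Variables (R : realType) (X : nat -> R) (n : nat).

Definition count_le (k : nat) (z : R) : R :=
  \sum_(j < k) (if X j <= z then 1 else 0).

(* The strict inequality encodes the left limit [Ghat_k(x-)], see [Ghat_leftE]. *)
Definition rank_count (k : nat) (x : R) : R :=
  \sum_(i < k) (if count_le n (X i) / n.+1%:R < x then 1 else 0).

Lemma count_le_nd k y z : y <= z -> count_le k y <= count_le k z.
Proof.
move=> yz; apply: ler_sum => i _; case: ifP => [h|_]; first by rewrite (le_trans h yz).
by case: ifP.
Qed.

Lemma count_le_ge0 k z : 0 <= count_le k z.
Proof. by apply: sumr_ge0 => i _; case: ifP. Qed.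

Lemma count_le_size k z : count_le k z <= k%:R.
Proof.
rewrite /count_le -[k in k%:R]card_ord -sum1_card natr_sum.
by apply: ler_sum => i _; case: ifP.
Qed.

Lemma count_le_sub k z : (k <= n)%N -> count_le k z <= count_le n z.
Proof.
move=> kn; rewrite /count_le (big_ord_widen n (fun j => if X j <= z then 1 else 0) kn).
by rewrite [leRHS](bigID (fun i : 'I_n => (i < k)%N))/= lerDl sumr_ge0// => i _; case: ifP.
Qed.

Lemma count_gt_sub k z : (k <= n)%N -> k%:R - count_le k z <= n%:R - count_le n z.
Proof.
have E m : m%:R - count_le m z = \sum_(j < m) (if X j <= z then 0 else 1).
  rewrite /count_le -[m in m%:R]card_ord -sum1_card natr_sum -sumrB.
  by apply: eq_bigr => i _; case: ifP => _; rewrite ?subrr ?subr0.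
move=> kn; rewrite !E (big_ord_widen n (fun j => if X j <= z then 0 else 1) kn).
by rewrite [leRHS](bigID (fun i : 'I_n => (i < k)%N))/= lerDl sumr_ge0// => i _; case: ifP.
Qed.

Lemma count_le_self i : (i < n)%N -> 1 <= count_le n (X i).
Proof.
move=> hi; rewrite /count_le (bigD1 (Ordinal hi))//= lexx lerDl.
by apply: sumr_ge0 => j _; case: ifP.
Qed.

Lemma rank_count_small k x : (k <= n)%N -> x <= n.+1%:R^-1 -> rank_count k x = 0.
Proof.
move=> kn xs; apply: big1 => i _; rewrite ifF//; apply/negbTE; rewrite -leNgt.
apply: le_trans xs _; rewrite -[leLHS]mul1r ler_wpM2r// count_le_self//.
exact: leq_trans (ltn_ord i) kn.
Qed.

(* [y] is the least sample point whose rank is at least [(n+1)x] and [z] a point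
   just below [y] separating it from the smaller ones. *)
Lemma rank_quantile x eta : 0 < x -> 0 < eta ->
  (forall i, (i < n)%N -> 0 < X i <= 1) ->
  (forall k, (k <= n)%N -> rank_count k x = k%:R) /\ n%:R / n.+1%:R < x \/
  exists y z, [/\ 0 < z < y, y <= z + eta, y <= 1,
    forall k, (k <= n)%N -> rank_count k x = count_le k z &
    count_le n z < n.+1%:R * x <= count_le n y].
Proof.
move=> x0 e0 X01.
pose inA (i : 'I_n) := count_le n (X i) / n.+1%:R < x.
have n1 : 0 < n.+1%:R :> R by rewrite ltr0n.
(* If all normalized ranks are below [x], so is that of the largest observation, whose rank is
   [n]. *)
have [allA|] := boolP [forall i, inA i].
  have [n0|n0] := posnP n.
    left; split; last by rewrite n0 mul0r.
    by move=> k; rewrite n0 leqn0 => /eqP ->; rewrite /rank_count big_ord0.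
  left; split.
    move=> k kn; rewrite /rank_count -[k in RHS]card_ord -sum1_card natr_sum.
    apply: eq_bigr => i _; rewrite ifT//.
    by have /forallP/(_ (widen_ord kn i)) := allA.
  have [i _ iX] := @arg_maxP _ _ _ (Ordinal n0) xpredT (fun i : 'I_n => X i) isT.
  have /forallP/(_ i) := allA; rewrite /inA.
  suff -> : count_le n (X i) = n%:R by [].
  apply/le_anti; rewrite count_le_size /count_le -[n in n%:R]card_ord -sum1_card natr_sum/=.
  by apply: ler_sum => j _; rewrite ifT//; exact: iX.
rewrite negb_forall => /existsP[i0 i0A]; right.
have [i1 i1A i1X] := @arg_minP _ _ _ i0 (fun i => ~~ inA i) (fun i : 'I_n => X i) i0A.
have AX i j : inA i -> ~~ inA j -> X i < X j.
  rewrite /inA -leNgt => h1 h2; rewrite ltNge; apply/negP => ji.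
  have := lt_le_trans h1 h2; rewrite ltr_pM2r ?invr_gt0// ltNge.
  by rewrite (count_le_nd _ ji).
have /andP[y0 y1] := X01 i1 (ltn_ord i1).
(* The first entry keeps [z] within [eta] of [y], the second keeps it positive. Raising it to the
   largest smaller sample point, if there is one, separates the two groups. *)
pose base := Num.max (X i1 - eta) (X i1 / 2).
have by1 : base < X i1 by rewrite gt_max; apply/andP; split; lra.
have base0 : 0 < base by rewrite lt_max; apply/orP; right; lra.
have bey : X i1 <= base + eta by rewrite -lerBlDr le_max lexx.
have low : n.+1%:R * x <= count_le n (X i1).
  by move: i1A; rewrite /inA -leNgt ler_pdivlMr// mulrC.
have [i2 i2A|noA] := pickP inA.
  have [i3 i3A i3X] := @arg_maxP _ _ _ i2 inA (fun i : 'I_n => X i) i2A.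
  pose z := Num.max base (X i3).
  have zy : z < X i1 by rewrite gt_max by1 AX.
  have Az (i : 'I_n) : inA i = (X i <= z).
    have [iA|iA] := boolP (inA i); first by rewrite le_max (i3X _ iA : X i <= X i3) orbT.
    by apply/esym/negbTE; rewrite -ltNge (lt_le_trans zy)// i1X.
  exists (X i1), z; split => //.
  - by rewrite zy lt_max base0.
  - by apply: le_trans bey _; rewrite lerD2r le_max lexx.
  - move=> k kn; apply: eq_bigr => i _.
    by have := Az (widen_ord kn i); rewrite /inA /= => ->.
  - rewrite low andbT; have := i3A; rewrite /inA ltr_pdivrMr// mulrC; apply: le_lt_trans.
    apply: ler_sum => i _; rewrite -Az; case: ifP => [iA|_]; last by case: ifP.
    by rewrite ifT//; exact: i3X.
have Az (i : 'I_n) : inA i = (X i <= base).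
  rewrite noA; apply/esym/negbTE; rewrite -ltNge (lt_le_trans by1)//; apply: i1X.
  by rewrite noA.
exists (X i1), base; split => //; first by rewrite base0.
  move=> k kn; apply: eq_bigr => i _.
  by have := Az (widen_ord kn i); rewrite /inA /= => ->.
rewrite low andbT /count_le big1; first by rewrite mulr_gt0.
by move=> i _; rewrite -Az noA.
Qed.

End ranks_quantile.

Lemma Ghat_leftE (R : realType) (T : Type) (X : nat -> T -> R) (n k : nat) (w : T) (x : R) :
  Ghat_left X n k w x = rank_count (fun i => X i w) n k x.
Proof.
apply/cvg_lim => //.
have E y : Ghat X n k w y =
    \sum_(i < k) (if count_le (fun i => X i w) n (X i w) / n.+1%:R <= y then 1 else 0).
  apply: eq_bigr => i _; congr (if _ / _ <= _ then _ else _).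
  rewrite /rank_ natr_sum; apply: eq_bigr => j _; by case: ifP.
have {}E := funext E; rewrite {}E /rank_count; elim: k => [|k IH].
  rewrite big_ord0; under eq_fun do rewrite big_ord0; exact: cvg_cst.
rewrite big_ord_recr/=; under eq_fun do rewrite big_ord_recr/=.
apply: cvgD; first exact: IH.
set c := count_le _ _ _ / _; apply: cvg_near_cst.
case: ltP => [cx|xc].
  near=> y; rewrite ifT//; apply: ltW; near: y; exact: nbhs_left_gt.
near=> y; rewrite ifF//; apply/negbTE; rewrite -ltNge; apply: lt_le_trans xc.
near: y; exact: nbhs_left_lt.
Unshelve. all: by end_near. Qed.

(** * Reduction of the rank process to the empirical process *)

Section rank_reduction.
Variables (R : realType) (n : nat) (X H : nat -> R) (J : R -> R).
Variables (d M A lam delta : R).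
Hypothesis n_gt0 : (0 < n)%N.
Hypothesis d0 : 0 < d.
Hypothesis M0 : 0 <= M.
Hypothesis A0 : 0 <= A.
Hypothesis delta0 : 0 <= delta.
Hypothesis X01 : forall i, (i < n)%N -> 0 < X i <= 1.
Hypothesis J0 : J 0 = 0.
Hypothesis J1 : J 1 = 0.
Hypothesis J_holder : forall x y : R, 0 <= x <= 1 -> 0 <= y <= 1 ->
  `|J x - J y| <= A * Num.sqrt `|x - y|.
Hypothesis H_le : forall k, (k <= n)%N -> `|H k| <= M * d.

Local Notation a x := (Num.min x (1 - x)).
Local Notation W x := (powR (a x) (- lam)).
Local Notation S k x := (count_le X k x - k%:R * x).

Hypothesis reduction : forall k (x : R), (k <= n)%N -> 0 <= x <= 1 ->
  d^-1 * W x * `|S k x - J x * H k| <= delta.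

Local Notation V k x := (d^-1 * W x *
  `|(rank_count X n k x - k%:R / n%:R * rank_count X n n x)
    - J x * (H k - k%:R / n%:R * H n)|).

Let nR0 : 0 < n%:R :> R. Proof. by rewrite ltr0n. Qed.

Let n1_le : n.+1%:R <= 2 * n%:R :> R.
Proof. by rewrite -natrM ler_nat mul2n -addnn -addn1 leq_add2l. Qed.

Let frac01 k : (k <= n)%N -> 0 <= (k%:R / n%:R : R) <= 1.
Proof.
by move=> kn; rewrite divr_ge0//= ler_pdivrMr// mul1r ler_nat.
Qed.

Let H_bridge k : (k <= n)%N -> `|H k - k%:R / n%:R * H n| <= 2 * M * d.
Proof.
move=> kn; have /andP[f0 f1] := frac01 kn.
apply: le_trans (ler_normB _ _) _; rewrite normrM (ger0_norm f0).
have h1 := H_le kn; have h2 := H_le (leqnn n).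
have : k%:R / n%:R * `|H n| <= 1 * (M * d) by rewrite ler_pM.
lra.
Qed.

Let J_le (x : R) : 0 <= x <= 1 -> `|J x| <= A * Num.sqrt (a x).
Proof.
move=> x01; have /andP[x0 x1] := x01.
rewrite /Num.min; case: ifP => _.
  have := J_holder x01 (_ : 0 <= 0 <= 1); rewrite J0 !subr0 (ger0_norm x0) => -> //.
  by rewrite lexx ler01.
have e : `|x - 1| = 1 - x by rewrite distrC ger0_norm ?subr_ge0.
have := J_holder x01 (_ : 0 <= 1 <= 1); rewrite J1 subr0 e => -> //.
by rewrite ler01 lexx.
Qed.

Let a01 (x : R) : 0 < x < 1 -> 0 < a x.
Proof. by move=> /andP[x0 x1]; rewrite lt_min x0 subr_gt0. Qed.

Let a_le1 (x : R) : 0 <= x <= 1 -> a x <= 1.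
Proof. by move=> /andP[x0 x1]; rewrite ge_min x1. Qed.

Let a_ge0 (x : R) : 0 <= x <= 1 -> 0 <= a x.
Proof. by move=> /andP[x0 x1]; rewrite le_min x0 subr_ge0. Qed.

Let J_leA (x : R) : 0 <= x <= 1 -> `|J x| <= A.
Proof.
move=> x01; apply: le_trans (J_le x01) _; rewrite -[leRHS]mulr1 ler_wpM2l//.
by rewrite -[leRHS]sqrtr1 ler_wsqrtr// a_le1.
Qed.

Let S_dev k (u : R) : (k <= n)%N -> 0 < u < 1 ->
  `|S k u - J u * H k| <= delta * d * powR (a u) lam.
Proof.
move=> kn u01; have ua := a01 u01; have /andP[u0 u1] := u01.
have p0 : 0 < powR (a u) lam by rewrite powR_gt0.
have u01' : 0 <= u <= 1 by rewrite !ltW.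
have := reduction kn u01'; rewrite powRN -invfM -ler_pdivlMl ?invr_gt0 ?mulr_gt0// invrK.
by move=> h; apply: le_trans h _; rewrite mulrC mulrA.
Qed.

Let S_bound (u : R) : 0 < u < 1 ->
  `|S n u| <= (delta * powR (a u) lam + A * M) * d.
Proof.
move=> u01; have h := S_dev (leqnn n) u01; have /andP[u0 u1] := u01.
have h2 : `|J u * H n| <= A * (M * d).
  by rewrite normrM ler_pM// ?H_le// J_leA// !ltW.
have := ler_normD (S n u - J u * H n) (J u * H n); rewrite subrK; lra.
Qed.

Let W_ge0 (x : R) : 0 <= d^-1 * W x.
Proof. by rewrite mulr_ge0 ?powR_ge0// invr_ge0 ltW. Qed.

Let V_split k (x D : R) : (k <= n)%N -> 0 <= x <= 1 ->
  `|rank_count X n k x - k%:R / n%:R * rank_count X n n x| <= D ->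
  V k x <= W x * (D / d) + 2 * M * A * (W x * Num.sqrt (a x)).
Proof.
move=> kn x01 hD.
have h : `|J x * (H k - k%:R / n%:R * H n)| <= A * Num.sqrt (a x) * (2 * M * d).
  by rewrite normrM ler_pM// ?J_le ?H_bridge.
have e : W x * (D / d) + 2 * M * A * (W x * Num.sqrt (a x)) =
   d^-1 * W x * (D + A * Num.sqrt (a x) * (2 * M * d)).
  by field; rewrite gt_eqF.
rewrite e ler_wpM2l//; apply: le_trans (ler_normB _ _) _; exact: lerD.
Qed.

(** The Hoelder decay of [J] at the endpoints beats the weight: the product is [(a x)^(1/2 - lam)].
    At [a x = 0] the square root vanishes, whatever the value of the weight there. *)
Let edge (x : R) : 0 <= x <= 1 -> lam < 1 / 2 -> a x <= n.+1%:R^-1 ->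
  W x * Num.sqrt (a x) <= powR n.+1%:R^-1 (1 / 2 - lam).
Proof.
move=> x01 lam2 ax; have a0 := a_ge0 x01.
move: a0; rewrite le_eqVlt => /predU1P[<-|a0].
  by rewrite sqrtr0 mulr0 powR_ge0.
rewrite -powR12_sqrt ?(ltW a0)// -powRD; last by apply/implyP => _; rewrite gt_eqF.
rewrite (_ : - lam + 2^-1 = 1 / 2 - lam); last by rewrite div1r addrC.
have r0 : 0 <= 1 / 2 - lam by rewrite subr_ge0 ltW.
by apply: (ge0_ler_powR r0) => //; rewrite nnegrE ?invr_ge0// ltW.
Qed.

Let edge_bound k (x : R) : (k <= n)%N -> 0 <= x <= 1 -> lam < 1 / 2 -> a x <= n.+1%:R^-1 ->
  rank_count X n k x - k%:R / n%:R * rank_count X n n x = 0 ->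
  V k x <= 2 * M * A * powR n.+1%:R^-1 (1 / 2 - lam).
Proof.
move=> kn x01 lam2 ax e0.
have D0 : `|rank_count X n k x - k%:R / n%:R * rank_count X n n x| <= 0.
  by rewrite e0 normr0.
apply: le_trans (V_split kn x01 D0) _; rewrite mul0r mulr0 add0r.
by rewrite ler_wpM2l ?edge// !mulr_ge0.
Qed.

Let rank_bridge k (x z : R) : (k <= n)%N ->
  (forall k, (k <= n)%N -> rank_count X n k x = count_le X k z) ->
  rank_count X n k x - k%:R / n%:R * rank_count X n n x =
  S k z - k%:R / n%:R * S n z.
Proof.
move=> kn rc; rewrite !rc//; field; exact: lt0r_neq0.
Qed.

(** The remainder splits into two reduction errors at the quantile [z], at times [k] and [n], and
    the replacement of [J z] by [J x] against a bridge of size [2 M d]. *)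
Let interior k (x z : R) : (k <= n)%N -> 0 <= x <= 1 -> 0 < z < 1 ->
  (forall k, (k <= n)%N -> rank_count X n k x = count_le X k z) ->
  V k x <= W x * (2 * delta * powR (a z) lam + 2 * M * `|J z - J x|).
Proof.
move=> kn x01 z01 rc; rewrite (rank_bridge kn rc).
have /andP[f0 f1] := frac01 kn.
have e : W x * (2 * delta * powR (a z) lam + 2 * M * `|J z - J x|) =
   d^-1 * W x * (2 * (delta * d * powR (a z) lam) + `|J z - J x| * (2 * M * d)).
  by field; rewrite gt_eqF.
rewrite e ler_wpM2l//.
have -> : S k z - k%:R / n%:R * S n z - J x * (H k - k%:R / n%:R * H n) =
  (S k z - J z * H k) - k%:R / n%:R * (S n z - J z * H n) +
  (J z - J x) * (H k - k%:R / n%:R * H n) by ring.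
apply: le_trans (ler_normD _ _) _; apply: lerD; last first.
  by rewrite normrM ler_pM// H_bridge.
apply: le_trans (ler_normB _ _) _; rewrite normrM (ger0_norm f0).
have h1 := S_dev kn z01; have h2 := S_dev (leqnn n) z01.
have : k%:R / n%:R * `|S n z - J z * H n| <= 1 * (delta * d * powR (a z) lam) by rewrite ler_pM.
lra.
Qed.

Let interior_range k (x : R) : (k <= n)%N -> 0 <= x <= 1 -> lam < 1 / 2 ->
  V k x <= 2 * M * A * powR n.+1%:R^-1 (1 / 2 - lam) \/
  n.+1%:R^-1 < x /\ n.+1%:R^-1 <= 1 - x /\ forall eta, 0 < eta ->
    exists y z, [/\ 0 < z < y, y <= z + eta, y <= 1,
      forall k, (k <= n)%N -> rank_count X n k x = count_le X k z &
      count_le X n z < n.+1%:R * x <= count_le X n y].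
Proof.
move=> kn x01 lam2; have /andP[x0 x1] := x01.
have n1 : 0 < n.+1%:R :> R by [].
have [xs|xs] := leP x n.+1%:R^-1.
  left; apply: edge_bound => //; first by rewrite ge_min xs.
  by rewrite !rank_count_small// mulr0 subrr.
have xp : 0 < x by rewrite (lt_trans _ xs)// invr_gt0.
have nn1 : n%:R / n.+1%:R = 1 - n.+1%:R^-1 :> R.
  by rewrite -[n.+1%:R]natr1; field; rewrite natr1 gt_eqF.
(* The value 1 for [eta] only serves to decide the alternative: the count bound at [y0] then
   excludes the first case for every [eta]. *)
case: (rank_quantile xp ltr01 X01) => [[rc]|[y0 [z0 [_ _ _ _ /andP[_ yc]]]]].
  rewrite nn1 => nx; left; apply: edge_bound => //.
    by rewrite ge_min; apply/orP; right; rewrite lerBlDr -lerBlDl ltW.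
  by rewrite !rc// divfK ?subrr// gt_eqF.
right; split => //; split.
  have := le_trans yc (count_le_size X n y0).
  by rewrite mulrC -ler_pdivlMr// nn1 !lerBrDr addrC.
move=> eta eta0.
case: (rank_quantile xp eta0 X01) => [[_]|]; last by [].
rewrite nn1 => nx; have := le_trans yc (count_le_size X n y0).
by rewrite mulrC -ler_pdivlMr// nn1 leNgt nx.
Qed.

Let powR_mono (u v p : R) : 0 <= p -> 0 <= u -> u <= v -> powR u p <= powR v p.
Proof.
by move=> p0 u0 uv; apply: (ge0_ler_powR p0) => //; rewrite nnegrE// (le_trans u0).
Qed.

Let powR_le1 (u p : R) : 0 <= p -> 0 <= u <= 1 -> powR u p <= 1.
Proof.
move=> p0 /andP[u0 u1]; have := powR_mono p0 u0 u1.
by rewrite [X in _ <= X -> _](_ : _ = 1)// -[1 `^ p]/((fun x => 1 `^ x) p) powR1.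
Qed.

Let WK (x : R) : 0 < x < 1 -> W x * powR (a x) lam = 1.
Proof.
by move=> x01; rewrite powRN mulVf// gt_eqF// powR_gt0// a01.
Qed.

(** The counts at [z] and [y] enclose [(n+1) x] and differ from [n z] and [n y] by at most [K]; the
    extra 1 pays for [x <= 1] above and for [n (y - z) <= 1] below. At [y = 1], where no bound on
    [S] is assumed, [x <= y] is enough. *)
Let close (x y z K : R) : 0 <= x -> 0 <= K -> 0 < z < y -> y <= z + n%:R^-1 -> y <= 1 ->
  x <= 1 -> `|S n z| <= K -> (y < 1 -> `|S n y| <= K) ->
  count_le X n z < n.+1%:R * x <= count_le X n y ->
  `|z - x| <= (1 + K) / n%:R.
Proof.
move=> x0 K0 /andP[z0 zy] yz y1 x1 Sz Sy /andP[cz cy].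
have n1x : n.+1%:R * x = n%:R * x + x by rewrite -natr1 mulrDl mul1r.
rewrite n1x in cz cy.
have yz' : n%:R * y <= n%:R * z + 1.
  have : n%:R * y <= n%:R * (z + n%:R^-1) by rewrite ler_wpM2l.
  by rewrite mulrDr mulfV// gt_eqF.
have zx : n%:R * z <= n%:R * x + 1 + K by move: Sz; rewrite ler_norml => /andP[h1 _]; lra.
have xz : n%:R * x <= n%:R * z + 1 + K.
  have [y1'|y1'] := ltP y 1.
    by move: (Sy y1'); rewrite ler_norml => /andP[_ h1]; lra.
  have : n%:R * x <= n%:R * y by rewrite ler_wpM2l// (le_trans x1).
  lra.
rewrite ler_pdivlMr// -[X in _ * X](ger0_norm (ltW nR0)) -normrM ler_norml mulrBl.
by apply/andP; split; rewrite [z * _]mulrC [x * _]mulrC; lra.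
Qed.

Lemma rank_reduction_nonneg (C : R) k x : 0 <= lam < 1 / 2 -> 0 <= C ->
  1 <= C * d -> delta <= M -> (k <= n)%N -> 0 <= x <= 1 ->
  V k x <= 2 * M * A * powR n.+1%:R^-1 (1 / 2 - lam)
    + (2 * delta * powR ((3 * C + 2 * (M + A * M)) * d) lam
       + 2 * M * A * (powR n.+1%:R lam * Num.sqrt ((C + (M + A * M)) * d / n%:R))).
Proof.
move=> /andP[lam0 lam2] C0 Cd dM kn x01.
set K := M + A * M; have K0 : 0 <= K by rewrite addr_ge0// mulr_ge0.
have t2 : 0 <= 2 * delta * powR ((3 * C + 2 * K) * d) lam
       + 2 * M * A * (powR n.+1%:R lam * Num.sqrt ((C + K) * d / n%:R)).
  by apply: addr_ge0; rewrite !mulr_ge0 ?powR_ge0 ?sqrtr_ge0.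
have t1 : 0 <= 2 * M * A * powR n.+1%:R^-1 (1 / 2 - lam).
  by rewrite !mulr_ge0 ?powR_ge0.
have [h|[xn [xn1 hq]]] := interior_range kn x01 lam2.
  by apply: le_trans h _; rewrite lerDl.
have ni0 : 0 < n%:R^-1 :> R by rewrite invr_gt0.
have [y [z [/andP[z0 zy] yz y1 rc cc]]] := hq _ ni0.
have z1 : z < 1 by exact: lt_le_trans y1.
have z01 : 0 < z < 1 by rewrite z0.
have xp : 0 < x by apply: lt_trans xn; rewrite invr_gt0.
have x1p : 0 < 1 - x by apply: lt_le_trans xn1; rewrite invr_gt0.
have x01s : 0 < x < 1 by rewrite xp -subr_gt0.
have /andP[x0 x1] := x01.
have Sb (u : R) : 0 < u < 1 -> `|S n u| <= K * d.
  move=> u01; apply: le_trans (S_bound u01) _; rewrite ler_wpM2r ?(ltW d0)// lerD2r.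
  rewrite -[leRHS]mulr1 ler_pM ?powR_ge0// powR_le1//.
  by have /andP[? ?] := u01; rewrite a_ge0 ?a_le1// !ltW.
have Kd : 1 + K * d <= (C + K) * d by rewrite (mulrDl C K) lerD2r.
have zx : `|z - x| <= (C + K) * d / n%:R.
  apply: (@le_trans _ _ ((1 + K * d) / n%:R)); last by rewrite ler_wpM2r// ltW.
  apply: (close (y := y)) => //; rewrite ?z0// ?mulr_ge0 ?(ltW d0)//; first exact: Sb.
  by move=> y1'; apply: Sb; rewrite y1' (lt_trans z0).
have CKd : 0 <= (C + K) * d by rewrite mulr_ge0 ?(ltW d0)// addr_ge0.
(* From [1/n <= 2/(n+1) <= 2 s] and [1 <= C d]. It turns the additive error in [z] into a factor, so
   that the weights at [x] and [z] can be compared; [s] will be [x] or [1 - x]. *)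
have step (s : R) : n.+1%:R^-1 <= s -> s + (C + K) * d / n%:R <= (3 * C + 2 * K) * d * s.
  move=> sn; have s0 : 0 <= s by apply: le_trans sn; rewrite invr_ge0.
  have n2 : n%:R^-1 <= 2 * s.
    apply: (@le_trans _ _ (2 * n.+1%:R^-1)); last by rewrite ler_wpM2l.
    by rewrite ler_pdivlMr ?ltr0n// mulrC ler_pdivrMr//; exact: n1_le.
  have h1 : (C + K) * d * n%:R^-1 <= (C + K) * d * (2 * s) by rewrite ler_wpM2l.
  have h2 : 1 * s <= C * d * s by rewrite ler_wpM2r.
  lra.
have Q0 : 0 <= (3 * C + 2 * K) * d by rewrite mulr_ge0 ?addr_ge0 ?mulr_ge0 ?(ltW d0).
have az : a z <= (3 * C + 2 * K) * d * a x.
  move: zx; rewrite ler_norml => /andP[zx1 zx2].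
  have [_|_] := leP x (1 - x).
    apply: le_trans (step x (ltW xn)); rewrite ge_min; apply/orP; left; lra.
  apply: le_trans (step _ xn1); rewrite ge_min; apply/orP; right; lra.
apply: le_trans (interior kn x01 z01 rc) _.
rewrite -[leLHS]add0r lerD// mulrDr lerD//.
  rewrite mulrCA ler_wpM2l ?mulr_ge0//.
  have h := powR_mono lam0 (ltW (a01 z01)) az.
  apply: (@le_trans _ _ (W x * powR ((3 * C + 2 * K) * d * a x) lam)).
    by rewrite ler_wpM2l ?powR_ge0.
  rewrite powRM ?(ltW (a01 x01s))// mulrCA WK// mulr1.
  exact: lexx.
rewrite mulrCA -!mulrA ler_wpM2l// ler_wpM2l//.
have Wn : W x <= powR n.+1%:R lam.
  rewrite powRN -[leRHS]invrK lef_pV2 ?posrE ?invr_gt0 ?powR_gt0 ?a01//.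
  rewrite -powR_inv1 ?powR_ge0// -powRrM mulrC powRrM powR_inv1//.
  by apply: powR_mono => //; rewrite ?invr_ge0// le_min (ltW xn).
rewrite mulrCA; apply: ler_pM => //; first exact: powR_ge0.
have z01' : 0 <= z <= 1 by rewrite !ltW.
by apply: le_trans (J_holder z01' x01) _; rewrite ler_wpM2l// ler_wsqrtr// mulrA.
Qed.

Let powR_anti (u v : R) : lam < 0 -> 0 < u -> u <= v -> powR v lam <= powR u lam.
Proof.
move=> lam0 u0 uv; rewrite -[lam]opprK !(powRN _ (- lam)).
rewrite lef_pV2 ?posrE ?powR_gt0 ?(lt_le_trans u0)//.
by apply: powR_mono => //; [rewrite oppr_ge0|]; exact: ltW.
Qed.

Let bridge_small (g gn : R) k : (k <= n)%N -> 0 <= g <= gn ->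
  `|g - k%:R / n%:R * gn| <= gn.
Proof.
move=> kn /andP[g0 gg]; have /andP[f0 f1] := frac01 kn.
have gn0 := le_trans g0 gg.
have h1 : 0 <= k%:R / n%:R * gn by rewrite mulr_ge0.
have h2 : k%:R / n%:R * gn <= gn by rewrite ler_piMl.
by rewrite ler_norml; apply/andP; split; lra.
Qed.

Section negative_weight.
Variables (C e : R).
Hypothesis lam0 : lam < 0.
Hypothesis C0 : 0 <= C.
Hypothesis Cd : 1 <= C * d.
Hypothesis dM : delta <= M.
Hypothesis e0 : 0 < e.
Hypothesis e4 : e <= 1 / 4.
(** Bounds [|S n u| / d] at points [u] at distance at least [e/4] from the endpoints; closer to them
    [(a u)^lam] is unbounded, as [lam < 0]. *)
Let K := M * powR (e / 4) lam + A * M.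
Hypothesis small : (C + K) * d / n%:R <= e / 8.

Let K0 : 0 <= K. Proof. by rewrite addr_ge0// mulr_ge0// powR_ge0. Qed.

Let Kd_ge0 : 0 <= K * d. Proof. by rewrite mulr_ge0// ltW. Qed.

Let small1 : 1 + K * d <= e / 8 * n%:R.
Proof.
have : (C + K) * d <= e / 8 * n%:R by rewrite -ler_pdivrMr.
by rewrite (mulrDl C K); move: Cd; lra.
Qed.

Let smallK : K * d <= e / 8 * n%:R. Proof. by move: small1; lra. Qed.

Let small_1 : 1 <= e / 8 * n%:R. Proof. by move: small1 Kd_ge0; lra. Qed.

Let ne_gt0 : 0 < e / 8 * n%:R. Proof. by move: small_1; lra. Qed.

Let Skd (u : R) : 0 < u < 1 -> e / 4 <= a u -> `|S n u| <= K * d.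
Proof.
move=> u01 eu; apply: le_trans (S_bound u01) _; rewrite ler_wpM2r ?(ltW d0)// lerD2r.
by apply: ler_pM => //; [exact: powR_ge0|apply: powR_anti => //; exact: divr_gt0].
Qed.

Let We (x : R) : 0 <= x <= 1 -> a x <= e -> W x <= powR e (- lam).
Proof.
by move=> x01 xe; apply: powR_mono => //; [rewrite oppr_ge0 ltW|exact: a_ge0].
Qed.

Let half_weight (x u : R) : 0 < x < 1 -> a x / 2 <= a u -> 0 < u < 1 ->
  W x * powR (a u) lam <= powR 2 (- lam).
Proof.
move=> x01 xu u01; have ax := a01 x01.
have h : powR (a u) lam <= powR (a x / 2) lam.
  by apply: powR_anti => //; exact: divr_gt0.
apply: (@le_trans _ _ (W x * powR (a x / 2) lam)); first by rewrite ler_wpM2l// powR_ge0.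
rewrite powRM ?(ltW ax) ?invr_ge0// mulrA WK// mul1r.
by rewrite -powR_inv1// -powRrM mulN1r.
Qed.

(* If the quantile [z] is within a factor 2 of [x] from the endpoint, the weights
   at [x] and [z] compensate. *)
Let half_interior k (x z : R) : (k <= n)%N -> 0 < x < 1 -> a x <= e ->
  0 < z < 1 -> a x / 2 <= a z ->
  (forall k, (k <= n)%N -> rank_count X n k x = count_le X k z) ->
  V k x <= powR e (- lam) * (C + 12 * (M * A)) + 10 * powR 2 (- lam) * delta.
Proof.
move=> kn x01 xe z01 xz rc.
have x01' : 0 <= x <= 1 by have /andP[? ?] := x01; rewrite !ltW.
have z01' : 0 <= z <= 1 by have /andP[? ?] := z01; rewrite !ltW.
apply: le_trans (interior kn x01' z01 rc) _.
have h1 := half_weight x01 xz z01.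
have h2 : `|J z - J x| <= 2 * A.
  by apply: le_trans (ler_normB _ _) _; have := J_leA x01'; have := J_leA z01'; lra.
have h3 : 2 * delta * (W x * powR (a z) lam) <= 2 * delta * powR 2 (- lam).
  by rewrite ler_wpM2l// mulr_ge0.
have h4 : W x * (2 * M * `|J z - J x|) <= powR e (- lam) * (2 * M * (2 * A)).
  apply: ler_pM => //; [exact: powR_ge0|by rewrite !mulr_ge0|exact: We|].
  by rewrite ler_wpM2l// mulr_ge0.
have p0 : 0 <= powR 2 (- lam) * delta by rewrite mulr_ge0// powR_ge0.
have p1 : 0 <= powR e (- lam) * C by rewrite mulr_ge0// powR_ge0.
have p2 : 0 <= powR e (- lam) * (M * A) by rewrite !mulr_ge0// powR_ge0.
move: (W x) (powR (a z) lam) (powR e (- lam)) (powR 2 (- lam)) h3 h4 p0 p1 p2.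
move=> w1 w2 w3 w4; lra.
Qed.

(* Otherwise [n * a x] is itself dominated by a deviation [S n u] at a point [u]
   between [z] and [x], which bounds the counts crudely by [D]. *)
Let crude_edge k (x u D : R) : (k <= n)%N -> 0 < x < 1 -> a x <= e ->
  `|rank_count X n k x - k%:R / n%:R * rank_count X n n x| <= D ->
  0 < u < 1 -> a x / 2 <= a u -> D <= C * d + 8 * `|S n u| ->
  V k x <= powR e (- lam) * (C + 12 * (M * A)) + 10 * powR 2 (- lam) * delta.
Proof.
move=> kn x01 xe hD u01 xu Du.
have x01' : 0 <= x <= 1 by have /andP[? ?] := x01; rewrite !ltW.
apply: le_trans (V_split kn x01' hD) _.
have Dd : D / d <= C + 8 * (delta * powR (a u) lam + A * M).
  rewrite ler_pdivrMr//; apply: le_trans Du _.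
  have := S_bound u01; lra.
have h0 := We x01' xe; have w0 : 0 <= W x by exact: powR_ge0.
have h1 : W x * (D / d) <= W x * (C + 8 * (delta * powR (a u) lam + A * M)).
  by rewrite ler_wpM2l.
have h2 := half_weight x01 xu u01.
have h3 : 8 * delta * (W x * powR (a u) lam) <= 8 * delta * powR 2 (- lam).
  by rewrite ler_wpM2l// mulr_ge0.
have h4 : W x * (C + 8 * (A * M)) <= powR e (- lam) * (C + 8 * (A * M)).
  by rewrite ler_wpM2r// addr_ge0// !mulr_ge0.
have h5 : 2 * M * A * (W x * Num.sqrt (a x)) <= 2 * M * A * (powR e (- lam) * 1).
  rewrite ler_wpM2l ?mulr_ge0//; apply: ler_pM => //.
  by rewrite -[leRHS]sqrtr1 ler_wsqrtr// a_le1.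
have p0 : 0 <= powR 2 (- lam) * delta by rewrite mulr_ge0// powR_ge0.
have p2 : 0 <= powR e (- lam) * (M * A) by rewrite !mulr_ge0// powR_ge0.
apply: le_trans (lerD h1 h5) _.
move: (W x) (powR (a u) lam) (powR e (- lam)) (powR 2 (- lam)) h3 h4 p0 p2.
move=> w1 w2 w3 w4; lra.
Qed.

Let small_eta : n%:R^-1 <= e / 8.
Proof. by rewrite -[leLHS]mul1r ler_pdivrMr. Qed.

(** The quantile cannot leave [[e/2, 1 - e/2]]: for [z < e/2] the count at [3e/4] would exceed its
    mean by [n e/4], while [K d <= n e/8]; the other side is symmetric. There [K] is available and
    the weight at [x] is at most 1. *)
Let middle k (x : R) : (k <= n)%N -> e <= x <= 1 - e ->
  (forall eta, 0 < eta -> exists y z, [/\ 0 < z < y, y <= z + eta, y <= 1,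
      forall k, (k <= n)%N -> rank_count X n k x = count_le X k z &
      count_le X n z < n.+1%:R * x <= count_le X n y]) ->
  V k x <= 2 * delta * powR (e / 4) lam
    + 2 * M * A * Num.sqrt ((C + K) * d / n%:R).
Proof.
move=> kn /andP[xe xe1] hq.
have ni0 : 0 < n%:R^-1 :> R by rewrite invr_gt0.
have [y [z [/andP[z0 zy] yz y1 rc cc]]] := hq _ ni0.
have /andP[cz cy] := cc.
have nx : n.+1%:R * x = n%:R * x + x by rewrite -natr1 mulrDl mul1r.
rewrite nx in cz cy.
have nex : n%:R * e <= n%:R * x by rewrite ler_wpM2l.
have nex1 : n%:R * x <= n%:R * (1 - e) by rewrite ler_wpM2l.
have z1 : z < 1 by exact: lt_le_trans y1.
have ez : e / 2 <= z.
  rewrite leNgt; apply/negP => ze.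
  have yu : y <= 3 * e / 4 by move: small_eta; lra.
  have u01 : 0 < 3 * e / 4 < 1 by apply/andP; split; move: e0 e4; lra.
  have au : e / 4 <= a (3 * e / 4) by rewrite le_min; apply/andP; split; move: e0 e4; lra.
  have := Skd u01 au; rewrite ler_norml => /andP[_].
  have := count_le_nd X n yu.
  by move: smallK ne_gt0 cy nex; move: e0 e4; lra.
have ze : z <= 1 - e / 2.
  rewrite leNgt; apply/negP => ze.
  have u01 : 0 < 1 - e / 2 < 1 by apply/andP; split; move: e0 e4; lra.
  have au : e / 4 <= a (1 - e / 2) by rewrite le_min; apply/andP; split; move: e0 e4; lra.
  have := Skd u01 au; rewrite ler_norml => /andP[+ _].
  have := count_le_nd X n (ltW ze).
  by move: smallK small_1 cz nex1; move: e0 e4; lra.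
have y0 : 0 < y by exact: lt_trans zy.
have yu : y <= 1 - e / 4 by move: small_eta e0; lra.
have y1' : y < 1 by move: e0; lra.
have z01 : 0 < z < 1 by rewrite z0.
have y01 : 0 < y < 1 by rewrite y0.
have az : e / 4 <= a z by rewrite le_min; apply/andP; split; move: e0; lra.
have ay : e / 4 <= a y by rewrite le_min; apply/andP; split; move: e0; lra.
have x01 : 0 <= x <= 1 by apply/andP; split; move: e0; lra.
have /andP[x0 x1] := x01.
have zx : `|z - x| <= (C + K) * d / n%:R.
  apply: (@le_trans _ _ ((1 + K * d) / n%:R)).
    apply: (close (y := y)) => //; rewrite ?z0//; first exact: Skd.
    by move=> _; exact: Skd.
  by rewrite ler_wpM2r ?invr_ge0// (mulrDl C K) lerD2r.
apply: le_trans (interior kn x01 z01 rc) _.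
have W1 : W x <= 1.
  by apply: powR_le1; rewrite ?oppr_ge0 ?(ltW lam0)// a_ge0// a_le1.
have s0 : 0 <= 2 * delta * powR (a z) lam + 2 * M * `|J z - J x|.
  by rewrite addr_ge0// !mulr_ge0// powR_ge0.
apply: (@le_trans _ _ (1 * (2 * delta * powR (a z) lam + 2 * M * `|J z - J x|))).
  by rewrite ler_wpM2r.
rewrite mul1r; apply: lerD.
  by rewrite ler_wpM2l ?mulr_ge0// powR_anti// divr_gt0.
rewrite -[leRHS]mulrA ler_wpM2l ?mulr_ge0//.
have z01' : 0 <= z <= 1 by rewrite !ltW.
by apply: le_trans (J_holder z01' x01) _; rewrite ler_wpM2l// ler_wsqrtr.
Qed.

Let left_edge k (x : R) : (k <= n)%N -> n.+1%:R^-1 < x -> x < e ->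
  (forall eta, 0 < eta -> exists y z, [/\ 0 < z < y, y <= z + eta, y <= 1,
      forall k, (k <= n)%N -> rank_count X n k x = count_le X k z &
      count_le X n z < n.+1%:R * x <= count_le X n y]) ->
  V k x <= powR e (- lam) * (C + 12 * (M * A)) + 10 * powR 2 (- lam) * delta.
Proof.
move=> kn xn xe hq.
have x0 : 0 < x by apply: lt_trans xn; rewrite invr_gt0.
have x1 : x < 1 by move: e4 x0; lra.
have x01 : 0 < x < 1 by rewrite x0.
have ax : a x = x by rewrite min_l//; move: e4; lra.
have axe : a x <= e by rewrite ax ltW.
have x4 : 0 < x / 4 by rewrite divr_gt0.
(* The precision [x/4] ensures [y <= 3x/4] as soon as [z < x/2]. *)
have [y [z [/andP[z0 zy] yz y1 rc /andP[cz cy]]]] := hq _ x4.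
have nx : n.+1%:R * x = n%:R * x + x by rewrite -natr1 mulrDl mul1r.
rewrite nx in cz cy.
have z01 : 0 < z < 1 by rewrite z0 (lt_le_trans zy y1).
have z34 : z <= 3 / 4.
  rewrite leNgt; apply/negP => z34.
  have u01 : 0 < (3 / 4 : R) < 1 by apply/andP; split; lra.
  have au : e / 4 <= a (3 / 4) by rewrite le_min; apply/andP; split; move: e4; lra.
  have := Skd u01 au; rewrite ler_norml => /andP[+ _].
  have := count_le_nd X n (ltW z34).
  have nx4 : n%:R * x <= n%:R * (1 / 4) by rewrite ler_wpM2l//; move: e4; lra.
  have ne : n%:R * e <= n%:R * (1 / 4) by rewrite ler_wpM2l.
  by move: smallK small_1 e4; lra.
have [xz|zx] := leP (x / 2) z.
  apply: (half_interior kn x01 axe z01 _ rc).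
  by rewrite ax le_min; apply/andP; split; move: e4; lra.
have yu : y <= 3 * x / 4 by lra.
have u01 : 0 < 3 * x / 4 < 1 by apply/andP; split; lra.
have au : a x / 2 <= a (3 * x / 4).
  by rewrite ax le_min; apply/andP; split; move: e4; lra.
have nu := count_le_nd X n yu.
have Su : n%:R * x / 4 <= `|S n (3 * x / 4)|.
  by apply: le_trans (ler_norm _); move: (count_le X n (3 * x / 4)) nu => b; lra.
(* The factor 8 in [crude_edge] comes from here: [n x <= 4 |S|] and [x <= n x], so the count is
   below [(n+1) x <= 8 |S|]. *)
apply: (crude_edge (D := count_le X n z) kn x01 axe _ u01 au).
  rewrite !rc//; apply: bridge_small => //.
  by rewrite count_le_ge0 count_le_sub.
have : x <= n%:R * x by rewrite ler_peMl ?(ltW x0)// ler1n.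
have : 0 <= C * d by move: Cd; lra.
by move: Su cz; move: `|S n _| => b; lra.
Qed.

Let right_edge k (x : R) : (k <= n)%N -> n.+1%:R^-1 <= 1 - x -> 1 - x < e ->
  (forall eta, 0 < eta -> exists y z, [/\ 0 < z < y, y <= z + eta, y <= 1,
      forall k, (k <= n)%N -> rank_count X n k x = count_le X k z &
      count_le X n z < n.+1%:R * x <= count_le X n y]) ->
  V k x <= powR e (- lam) * (C + 12 * (M * A)) + 10 * powR 2 (- lam) * delta.
Proof.
move=> kn xn xe hq; set s := 1 - x in xn xe.
have s0 : 0 < s by apply: lt_le_trans xn; rewrite invr_gt0.
have xE : x = 1 - s by rewrite /s; ring.
have x0 : 0 < x by rewrite xE; move: e4; lra.
have x01 : 0 < x < 1 by rewrite x0 xE; lra.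
have ax : a x = s by rewrite min_r//; move: xE e4; rewrite -/s; lra.
have axe : a x <= e by rewrite ax ltW.
have q4 : 0 < 1 / 4 :> R by lra.
have [y [z [/andP[z0 zy] yz y1 rc /andP[cz cy]]]] := hq _ q4.
have nx : n.+1%:R * x = n%:R * x + x by rewrite -natr1 mulrDl mul1r.
rewrite nx xE in cz cy.
have z1 : z < 1 by exact: lt_le_trans y1.
have z01 : 0 < z < 1 by rewrite z0.
have z14 : 1 / 4 <= z.
  rewrite leNgt; apply/negP => z14.
  have u01 : 0 < (1 / 2 : R) < 1 by apply/andP; split; lra.
  have au : e / 4 <= a (1 / 2) by rewrite le_min; apply/andP; split; move: e4; lra.
  have yu : y <= 1 / 2 by lra.
  have := Skd u01 au; rewrite ler_norml => /andP[_].
  have := count_le_nd X n yu.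
  have nx4 : n%:R * s <= n%:R * (1 / 4) by rewrite ler_wpM2l//; move: e4; lra.
  have ne : n%:R * e <= n%:R * (1 / 4) by rewrite ler_wpM2l.
  by move: smallK small_1 e4; lra.
have [xz|zx] := leP (s / 2) (1 - z).
  apply: (half_interior kn x01 axe z01 _ rc).
  by rewrite ax le_min; apply/andP; split; move: e4; lra.
have uz : 1 - s / 2 <= z by lra.
have u01 : 0 < 1 - s / 2 < 1 by apply/andP; split; move: e4; lra.
have au : a x / 2 <= a (1 - s / 2).
  by rewrite ax le_min; apply/andP; split; move: e4; lra.
have nu := count_le_nd X n uz.
set c := count_le X n (1 - s / 2) in nu.
have Su : n%:R * s / 2 - 1 <= `|S n (1 - s / 2)|.
  rewrite -normrN; apply: le_trans (ler_norm _); rewrite -/c; lra.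
have Su2 : - (S n (1 - s / 2)) <= `|S n (1 - s / 2)| by rewrite -normrN ler_norm.
rewrite -/c in Su2.
(* Near 1 the points above [z] are counted instead, which only changes the sign of the bridge. Here
   [D <= n s/2 + |S| <= 2 |S| + 1], and the 1 is absorbed by [C d]. *)
apply: (crude_edge (D := n%:R - count_le X n z) kn x01 axe _ u01 au).
  rewrite !rc//.
  have -> : count_le X k z - k%:R / n%:R * count_le X n z =
     - ((k%:R - count_le X k z) - k%:R / n%:R * (n%:R - count_le X n z)).
    by field; exact: lt0r_neq0.
  rewrite normrN; apply: bridge_small => //; rewrite subr_ge0 count_le_size/=.
  have := count_gt_sub X z kn; lra.
by have := normr_ge0 (S n (1 - s / 2)); move: Cd Su Su2 nu; move: `|S n _| => b; lra.
Qed.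

Lemma rank_reduction_neg k x : (k <= n)%N -> 0 <= x <= 1 ->
  V k x <= 2 * M * A * powR n.+1%:R^-1 (1 / 2 - lam)
    + (2 * delta * powR (e / 4) lam + 2 * M * A * Num.sqrt ((C + K) * d / n%:R)
       + (powR e (- lam) * (C + 12 * (M * A)) + 10 * powR 2 (- lam) * delta)).
Proof.
move=> kn x01.
have t1 : 0 <= 2 * M * A * powR n.+1%:R^-1 (1 / 2 - lam).
  by rewrite !mulr_ge0 ?powR_ge0.
have t2 : 0 <= 2 * delta * powR (e / 4) lam + 2 * M * A * Num.sqrt ((C + K) * d / n%:R).
  by apply: addr_ge0; rewrite !mulr_ge0 ?powR_ge0 ?sqrtr_ge0.
have t3 : 0 <= powR e (- lam) * (C + 12 * (M * A)) + 10 * powR 2 (- lam) * delta.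
  by rewrite addr_ge0// ?mulr_ge0 ?powR_ge0// addr_ge0// !mulr_ge0.
have lam2 : lam < 1 / 2 by rewrite (lt_trans lam0).
have [h|[xn [xn1 hq]]] := interior_range kn x01 lam2.
  by apply: le_trans h _; rewrite lerDl addr_ge0.
have [xe|xe] := ltP x e.
  apply: le_trans (left_edge kn xn xe hq) _.
  by rewrite addrA lerDr addr_ge0.
have [xe1|xe1] := ltP (1 - x) e.
  apply: le_trans (right_edge kn xn1 xe1 hq) _.
  by rewrite addrA lerDr addr_ge0.
have xm : e <= x <= 1 - e by rewrite xe lerBrDl -lerBrDr.
apply: le_trans (middle kn xm hq) _.
by rewrite [leRHS]addrCA lerDl addr_ge0.
Qed.

End negative_weight.

End rank_reduction.

(** * The coefficient [J] *)

Section indicator_moment.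
Context d (T : measurableType d) (R : realType) (P : probability T R).
Variables (h : T -> R) (B : R).
Hypothesis Ih : P.-integrable setT (EFin \o h).
Hypothesis Ih2 : P.-integrable setT (EFin \o (fun w => h w * h w)).
Hypothesis EB : \int[P]_w (h w * h w) = B.

Lemma integrable_indicator_mul (E : set T) : measurable E ->
  P.-integrable setT (EFin \o (fun w => \1_E w * h w)).
Proof.
move=> mE; apply: le_integrable Ih => //.
  apply/measurable_EFinP; apply: measurable_funM => //.
  by apply/measurable_EFinP; exact: measurable_int Ih.
move=> w _; rewrite /= lee_fin normrM indicE.
by case: (w \in E); rewrite ?normr1 ?normr0 ?mul1r// mul0r.
Qed.

(** Cauchy-Schwarz by way of AM-GM: the integral is at most [p/(2u) + u B/2] for every [u > 0], and
    [u = sqrt p] gives the bound. *)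
Lemma indicator_moment_le (E : set T) (p : R) : measurable E -> P E = p%:E ->
  `|\int[P]_w (\1_E w * h w)| <= (1 + B) / 2 * Num.sqrt p.
Proof.
move=> mE PE; have p0 : 0 <= p by rewrite -lee_fin -PE measure_ge0.
have B0 : 0 <= B by rewrite -EB; apply: Rintegral_ge0 => w _; rewrite -expr2 sqr_ge0.
have IE : P.-integrable setT (EFin \o (\1_E : T -> R)).
  by apply: integrable_indic.
have EE : \int[P]_w (\1_E w) = p.
  rewrite /Rintegral integral_indic// setIT. exact: (congr1 fine PE).
have amgm u : 0 < u -> `|\int[P]_w (\1_E w * h w)| <= p / (2 * u) + u / 2 * B.
  move=> u0; have I1 := integrable_indicator_mul mE.
  apply: le_trans (le_normr_Rintegral _ I1) _ => //.
  have I2 := integrableZl measurableT (2 * u)^-1 IE.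
  have I3 := integrableZl measurableT (u / 2) Ih2.
  have -> : p / (2 * u) + u / 2 * B =
      \int[P]_w ((2 * u)^-1 * \1_E w + u / 2 * (h w * h w)).
    by rewrite RintegralD// !RintegralZl// EE EB mulrC.
  apply: le_Rintegral => //.
  - exact: (integrable_norm I1).
  - exact: (integrableD measurableT I2 I3).
  - move=> w _; rewrite normrM indicE; have hh : h w * h w = `|h w| ^+ 2.
      by rewrite real_normK ?num_real// expr2.
    rewrite hh; case: (w \in E) => /=; rewrite ?normr1 ?normr0 ?mul1r ?mul0r ?mulr1 ?mulr0 ?add0r.
      (* AM-GM: [t <= 1 / (2 u) + u t^2 / 2] *)
      rewrite -subr_ge0.
      have -> : (2 * u)^-1 + u / 2 * `|h w| ^+ 2 - `|h w| = (2 * u)^-1 * (u * `|h w| - 1) ^+ 2.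
        by field; rewrite gt_eqF.
      by rewrite mulr_ge0 ?sqr_ge0// invr_ge0 mulr_ge0// ltW.
    by rewrite mulr_ge0 ?sqr_ge0// divr_ge0// ltW.
move: p0; rewrite le_eqVlt => /predU1P[p0|p0].
  (* For a null event [u = sqrt p] is not allowed; [u] is sent to 0 instead. *)
  rewrite -p0 sqrtr0 mulr0; apply/ler_addgt0Pr => e e0; rewrite add0r.
  have B1 : 0 < B + 1 by rewrite ltr_wpDl.
  have u0 : 0 < e / (B + 1) by rewrite divr_gt0.
  apply: le_trans (amgm _ u0) _; rewrite -p0 mul0r add0r.
  have -> : e / (B + 1) / 2 * B = e * (B / ((B + 1) * 2)) by field; rewrite gt_eqF.
  by rewrite ler_piMr ?(ltW e0)// ler_pdivrMr ?mulr_gt0// mul1r; lra.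
have s0 : 0 < Num.sqrt p by rewrite sqrtr_gt0.
apply: le_trans (amgm _ s0) _; rewrite -{1}(sqr_sqrtr (ltW p0)).
rewrite le_eqVlt; apply/orP; left; apply/eqP; field; exact: lt0r_neq0.
Qed.

Variable X : T -> R.
Hypothesis mX : measurable_fun setT X.
Hypothesis PX : forall x, 0 <= x <= 1 -> P [set w | X w <= x] = x%:E.
Hypothesis Eh : \int[P]_w h w = 0.

Let J x := \int[P]_w ((if X w <= x then 1 else 0) * h w).

Let mle (x : R) : measurable [set w | X w <= x].
Proof.
rewrite -[X in measurable X]setTI; have := mX measurableT (measurable_itv `]-oo, x]).
rewrite (_ : X @^-1` _ = [set w | X w <= x])//.
Qed.

Let JE (x : R) : J x = \int[P]_w (\1_[set w | X w <= x] w * h w).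
Proof.
apply: eq_Rintegral => w _; rewrite indicE; congr (_ * _).
by case: ifP => h1; [rewrite mem_set|rewrite memNset//= h1].
Qed.

Lemma indicator_moment0 : J 0 = 0.
Proof.
apply/eqP; rewrite -normr_le0 JE.
have P0 : P [set w | X w <= 0] = 0%:E by apply: PX; rewrite lexx ler01.
by have := indicator_moment_le (mle 0) P0; rewrite sqrtr0 mulr0.
Qed.

Lemma indicator_moment1 : J 1 = 0.
Proof.
have m1 := mle 1; have mC := measurableC m1.
have PC : P (~` [set w | X w <= 1]) = 0%:E.
  by rewrite probability_setC// PX ?lexx ?ler01// subee.
have := indicator_moment_le mC PC; rewrite sqrtr0 mulr0 normr_le0 => /eqP E0.
have := Eh; have -> : \int[P]_w h w = J 1 + \int[P]_w (\1_(~` [set w | X w <= 1]) w * h w).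
  rewrite JE -RintegralD//; last 2 first.
  - exact: integrable_indicator_mul.
  - exact: integrable_indicator_mul.
  by apply: eq_Rintegral => w _; rewrite -mulrDl !indicE in_setC; case: (w \in _); rewrite ?addr0 ?add0r mul1r.
by rewrite E0 addr0.
Qed.

Lemma indicator_moment_holder (x y : R) : 0 <= x <= 1 -> 0 <= y <= 1 ->
  `|J x - J y| <= (1 + B) / 2 * Num.sqrt `|x - y|.
Proof.
wlog xy : x y / x <= y.
  move=> H; have [/H|/ltW/H hyx x01 y01] := leP x y; first by [].
  by rewrite distrC [`|x - y|]distrC; apply: hyx.
move=> x01 y01; rewrite distrC [`|x - y|]distrC [`|y - x|]ger0_norm ?subr_ge0//.
pose E := [set w | X w <= y] `\` [set w | X w <= x].
have mE : measurable E by exact: measurableD.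
have PE : P E = (y - x)%:E.
  have fy : (P [set w | (X w <= y)%R] < +oo)%E by rewrite [P _]PX// ltry.
  have I0 : [set w | X w <= y] `&` [set w | X w <= x] = [set w | X w <= x].
    by apply/seteqP; split => w /=; [case|move=> h1; split => //; exact: le_trans xy].
  have D := measureD (mle y) (mle x) fy; rewrite I0 in D.
  by rewrite EFinB; exact: (etrans D (f_equal2 (fun a b => (a - b)%E) (PX y01) (PX x01))).
have := indicator_moment_le mE PE; congr (`|_| <= _).
rewrite !JE -RintegralB//; last 2 first.
- exact: integrable_indicator_mul.
- exact: integrable_indicator_mul.
apply: eq_Rintegral => w _; rewrite -mulrBl; congr (_ * _); rewrite !indicE.
have me z : (w \in [set w | X w <= z]) = (X w <= z) by apply/idP/idP; rewrite inE.
rewrite in_setD !me; have [h1|h1] := leP (X w) x; have [h2|h2] := leP (X w) y.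
- by rewrite subrr.
- by move: h2; rewrite ltNge (le_trans h1 xy).
- by rewrite subr0.
- by rewrite subrr.
Qed.

End indicator_moment.

(** * Asymptotics *)

(** One-sided, so that it passes to smaller functions without a lower bound; for nonnegative error
    bounds it is convergence to 0. *)
Definition vanishing (R : realType) (u : nat -> R) :=
  forall e, 0 < e -> exists N, forall n, (N <= n)%N -> u n <= e.

Section vanishing_theory.
Variable R : realType.
Implicit Types u v : nat -> R.

Lemma vanishingD u v : vanishing u -> vanishing v -> vanishing (fun n => u n + v n).
Proof.
move=> hu hv e e0; have e2 : 0 < e / 2 by rewrite divr_gt0.
have [N1 h1] := hu _ e2; have [N2 h2] := hv _ e2.
exists (maxn N1 N2) => n; rewrite geq_max => /andP[/h1 a1 /h2 a2].
by rewrite (splitr e) lerD.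
Qed.

Lemma vanishingZ (c : R) u : 0 <= c -> vanishing u -> vanishing (fun n => c * u n).
Proof.
move=> c0 hu e e0; have c1 : 0 < c + 1 by rewrite ltr_wpDl.
have [N h] := hu _ (divr_gt0 e0 c1); exists N => n /h a1.
apply: (@le_trans _ _ (c * (e / (c + 1)))); first by rewrite ler_wpM2l.
by rewrite mulrCA ler_piMr ?(ltW e0)// ler_pdivrMr// mul1r lerDl.
Qed.

Lemma vanishing_le u v N : (forall n, (N <= n)%N -> u n <= v n) ->
  vanishing v -> vanishing u.
Proof.
move=> uv hv e e0; have [N1 h1] := hv _ e0.
exists (maxn N N1) => n; rewrite geq_max => /andP[/uv a1 /h1 a2]; exact: le_trans a2.
Qed.

Lemma vanishing_cvg u : u @ \oo --> (0 : R) -> vanishing u.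
Proof.
move=> /cvgrPdist_le h e e0; have [N _ hN] := h _ e0; exists N => n Nn.
by have := hN n Nn; rewrite /= sub0r normrN; apply: le_trans; exact: ler_norm.
Qed.

Lemma vanishing_powR u p : 0 < p -> (forall n, 0 <= u n) -> vanishing u ->
  vanishing (fun n => powR (u n) p).
Proof.
move=> p0 u0 hu e e0; have [N h] := hu _ (powR_gt0 p^-1 e0).
exists N => n /h a1.
have -> : e = powR (powR e p^-1) p by rewrite -powRrM mulVf ?gt_eqF// powRr1// ltW.
by apply: (ge0_ler_powR (ltW p0)) => //; rewrite nnegrE ?powR_ge0.
Qed.

Lemma vanishing_sqrt u : (forall n, 0 <= u n) -> vanishing u ->
  vanishing (fun n => Num.sqrt (u n)).
Proof.
move=> u0 hu; apply: (@vanishing_le _ (fun n => powR (u n) (2^-1)) 0).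
  by move=> n _; rewrite powR12_sqrt.
by apply: vanishing_powR => //; rewrite invr_gt0.
Qed.

Lemma vanishing_inv : vanishing (fun n => n.+1%:R^-1 : R).
Proof. by apply: vanishing_cvg; exact: cvg_harmonic. Qed.

Lemma invS_ge0 (n : nat) : 0 <= n.+1%:R^-1 :> R.
Proof. by rewrite invr_ge0. Qed.

Lemma vanishing_npowN (p : R) : 0 < p -> vanishing (fun n => npow n (- p)).
Proof.
move=> p0 e e0; have [N h] := vanishing_powR p0 invS_ge0 vanishing_inv e0.
exists N.+1 => -[//|n] Nn; apply: le_trans (h n Nn).
by rewrite /npow -powR_inv1// -powRrM mulN1r.
Qed.

End vanishing_theory.

Section limits.
Variables (R : realType) (dn : nat -> R) (lam vth C M A : R).
Hypothesis C0 : 0 <= C.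
Hypothesis M0 : 0 <= M.
Hypothesis A0 : 0 <= A.
Hypothesis dn_ge0 : forall n, 0 <= dn n.
Hypothesis vth0 : 0 < vth.

(** The endpoint term decays because [1/2 - lam > 0], the reduction term because
    [d_n^lam = o(n^vth)], and the Hoelder term is up to constants the square root of
    [n^(2 lam) d_n / n]. *)
Lemma rank_error_nonneg : 0 <= lam < 1 / 2 ->
  little_o (fun n => npow n (2 * lam) * dn n) (fun n => n%:R) ->
  little_o (fun n => powR (dn n) lam) (fun n => npow n vth) ->
  vanishing (fun n => 2 * M * A * powR n.+1%:R^-1 (1 / 2 - lam)
    + (2 * (M * npow n (- vth)) * powR ((3 * C + 2 * (M + A * M)) * dn n) lam
     + 2 * M * A * (powR n.+1%:R lam * Num.sqrt ((C + (M + A * M)) * dn n / n%:R)))).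
Proof.
move=> /andP[lam0 lam2] H1 H2.
have K0 : 0 <= M + A * M by rewrite addr_ge0// mulr_ge0.
apply: vanishingD.
  apply: vanishingZ; first by rewrite !mulr_ge0.
  apply: vanishing_powR; [by move: lam2; lra|exact: invS_ge0|exact: vanishing_inv].
apply: vanishingD.
  have Q0 : 0 <= 3 * C + 2 * (M + A * M) by rewrite addr_ge0 ?mulr_ge0.
  have h := vanishingZ (c := 2 * M * powR (3 * C + 2 * (M + A * M)) lam) _ (vanishing_cvg H2).
  apply: (vanishing_le (N := 0)) (h _); last by rewrite !mulr_ge0// powR_ge0.
  move=> n _; rewrite powRM// /npow powRN; set a := powR _ _; set b := (powR _ _)^-1.
  by rewrite le_eqVlt; apply/orP; left; apply/eqP; ring.
apply: vanishingZ; first by rewrite !mulr_ge0.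
have s0 n : 0 <= npow n (2 * lam) * dn n / n%:R.
  by rewrite divr_ge0// mulr_ge0// powR_ge0.
have h := vanishingZ (c := powR 2 lam * Num.sqrt (C + (M + A * M))) _
  (vanishing_sqrt s0 (vanishing_cvg H1)).
apply: (vanishing_le (N := 1)) (h _); last by rewrite mulr_ge0 ?powR_ge0 ?sqrtr_ge0.
move=> n n1; have nR : 0 < n%:R :> R by rewrite ltr0n.
have E : Num.sqrt (npow n (2 * lam) * dn n / n%:R) = npow n lam * Num.sqrt (dn n / n%:R).
  rewrite -mulrA sqrtrM ?powR_ge0//; congr (_ * _).
  by rewrite /npow mulrC powRrM (powR_mulrn 2) ?powR_ge0// sqrtr_sqr ger0_norm ?powR_ge0.
have E2 : Num.sqrt ((C + (M + A * M)) * dn n / n%:R) =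
    Num.sqrt (C + (M + A * M)) * Num.sqrt (dn n / n%:R).
  by rewrite -mulrA sqrtrM// addr_ge0.
rewrite /= E E2.
have e1 : powR n.+1%:R lam <= powR 2 lam * npow n lam.
  rewrite /npow -powRM//; apply: (ge0_ler_powR lam0); rewrite ?nnegrE ?mulr_ge0//.
  by rewrite -natrM ler_nat; lia.
set s1 := Num.sqrt _; set s2 := Num.sqrt _.
have s10 : 0 <= s1 by exact: sqrtr_ge0.
have s20 : 0 <= s2 by exact: sqrtr_ge0.
have -> : powR 2 lam * s1 * (npow n lam * s2) = (powR 2 lam * npow n lam) * (s1 * s2) by ring.
by rewrite ler_wpM2r// mulr_ge0.
Qed.

(** The order of choice matters: [e1] is fixed first, to make the term [e1^(-lam) (C + 12 M A)]
    small uniformly in [n]; the terms with [(e1/4)^lam], which explode as [e1] tends to 0, are then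
    killed by taking [n] large. *)
Lemma rank_error_neg (e : R) : lam < 0 -> 0 < e ->
  vanishing (fun n => dn n / n%:R) ->
  exists e1, [/\ 0 < e1, e1 <= 1 / 4 & exists N, forall n, (N <= n)%N ->
    (C + (M * powR (e1 / 4) lam + A * M)) * dn n / n%:R <= e1 / 8 /\
    2 * M * A * powR n.+1%:R^-1 (1 / 2 - lam)
    + (2 * (M * npow n (- vth)) * powR (e1 / 4) lam
       + 2 * M * A * Num.sqrt ((C + (M * powR (e1 / 4) lam + A * M)) * dn n / n%:R)
       + (powR e1 (- lam) * (C + 12 * (M * A)) + 10 * powR 2 (- lam) * (M * npow n (- vth))))
    <= e].
Proof.
move=> lam0 e0 Hd.
have k0 : 0 < - lam by rewrite oppr_gt0.
have c0 : 0 <= C + 12 * (M * A) by rewrite addr_ge0// !mulr_ge0.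
have [N1 h1] := vanishingZ c0 (vanishing_powR k0 (@invS_ge0 R) (@vanishing_inv R))
  (divr_gt0 e0 (ltr0n R 2)).
pose e1 : R := (maxn N1 4).+1%:R^-1.
have e10 : 0 < e1 by rewrite invr_gt0.
have e14 : e1 <= 1 / 4.
  rewrite div1r lef_pV2 ?posrE ?ltr0n// ler_nat; exact: leqW (leq_maxr _ _).
have {}h1 := h1 _ (leq_maxl N1 4); rewrite -/e1 in h1.
exists e1; split => //.
set K := M * powR (e1 / 4) lam + A * M.
have K0 : 0 <= K by rewrite addr_ge0 ?mulr_ge0// powR_ge0.
have s0 n : 0 <= (C + K) * (dn n / n%:R) by rewrite mulr_ge0 ?divr_ge0// addr_ge0.
have HK := vanishingZ (addr_ge0 C0 K0) Hd.
have [N2 h2] := HK _ (divr_gt0 e10 (ltr0n R 8)).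
have V : vanishing (fun n => 2 * M * A * powR n.+1%:R^-1 (1 / 2 - lam)
    + (2 * M * powR (e1 / 4) lam * npow n (- vth)
       + 2 * M * A * Num.sqrt ((C + K) * (dn n / n%:R))
       + 10 * powR 2 (- lam) * M * npow n (- vth))).
  apply: vanishingD; [|apply: vanishingD; [apply: vanishingD|]].
  - apply: vanishingZ; first by rewrite !mulr_ge0.
    by apply: vanishing_powR; [move: lam0; lra|exact: invS_ge0|exact: vanishing_inv].
  - by apply: vanishingZ; [rewrite !mulr_ge0 ?powR_ge0|exact: vanishing_npowN].
  - by apply: vanishingZ; [rewrite !mulr_ge0|exact: vanishing_sqrt].
  - by apply: vanishingZ; [rewrite !mulr_ge0 ?powR_ge0|exact: vanishing_npowN].
have [N3 h3] := V _ (divr_gt0 e0 (ltr0n R 2)).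
exists (maxn N2 N3) => n; rewrite geq_max => /andP[/h2 {}h2 /h3 {}h3].
rewrite -[(C + K) * dn n / n%:R]mulrA; split => //.
move: h1 h3; move: (powR e1 _) (powR (e1 / 4) _) (npow n _) (powR 2 _) (Num.sqrt _) (powR _ (1 / 2 - lam)).
by move=> x1 x2 x3 x4 x5 x6; lra.
Qed.

End limits.

(** * Partial sums of the Hermite functionals *)

Section hermite_sums.
Context d (T : measurableType d) (R : realType) (P : probability T R).
Variables (xi : nat -> T -> R) (D : R) (L : R -> R) (r : nat).
Hypothesis mxi : forall n, measurable_fun [set: T] (xi n).
Hypothesis gxi : gaussian_sequence P xi.
Hypothesis sxi : stationary P xi.
Hypothesis Exi : ('E_P[xi 0%N] = 0)%E.
Hypothesis Vxi : ('V_P[xi 0%N] = 1)%E.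
Hypothesis D01 : 0 < D < 1.
Hypothesis sL : slowly_varying L.
Hypothesis gE : asymp_equiv (fun k => fine (covariance P (xi 0%N) (xi k)))
  (fun k => npow k (- D) * L k%:R).
Hypothesis r0 : (0 < r)%N.
Hypothesis Dr : D * r%:R < 1.

Local Notation h := (fun i w => hermite r (xi i w)).
Let rho k : R := r`!%:R * fine (covariance P (xi 0%N) (xi k)) ^+ r.
Local Notation v := (sum_var rho).

Let Ih i : P.-integrable setT (EFin \o h i).
Proof. exact: integrable_hermite_stationary. Qed.

Let Ihh i j : P.-integrable setT (EFin \o (fun w => h i w * h j w)).
Proof. exact: integrable_hermite_stationary_prod. Qed.

Let covh i k : \int[P]_w (h i w * h (i + k)%N w) = rho k.
Proof. exact: hermite_stationary_covariance. Qed.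

Lemma dnrE n : dnr P xi r n = Num.sqrt (v n).
Proof.
have [_ Es] := Rintegral_finsum n Ih.
have E0 : fine ('E_P[fun w => \sum_(i < n) h i w]) = 0.
  rewrite unlock -[LHS]/(\int[P]_w (\sum_(i < n) h i w)) Es big1// => i _.
  exact: hermite_stationary_mean.
have [_ <-] := partial_sum_var Ihh covh 0 n.
rewrite /dnr /variance unlock E0 unlock /Rintegral; congr (Num.sqrt (fine _)).
by apply: eq_integral => w _; rewrite /= /GRing.mul/= subr0 expr2.
Qed.

Let f0 : 0 < r`!%:R :> R. Proof. by rewrite ltr0n fact_gt0. Qed.

Let growth : exists theta, 2 < theta /\ exists m0, (0 < m0)%N /\
  (forall m, (m0 <= m)%N -> 0 < v m /\ theta * v m <= v (2 * m)) /\
  (forall m n, (m0 <= m)%N -> (m <= n)%N -> v m <= v n).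
Proof.
have [q [K [q2 h1 h2 h3 h4]]] := regular_covariance_power D01 sL gE r0 Dr f0 (rho := rho) (fun=> erefl).
have H := sum_var_growth h4 q2 h1 h2 h3; exact: H.
Qed.

(** A lower bound on [d_n] away from 0 lets the unit rounding errors of counts be absorbed into
    multiples of [d_n]. *)
Lemma dnr_lower : exists C N, 0 <= C /\ forall n, (N <= n)%N ->
  0 < dnr P xi r n /\ 1 <= C * dnr P xi r n.
Proof.
have [th [_ [m0 [_ [Hp Hm]]]]] := growth.
have [vm _] := Hp m0 (leqnn m0).
have sm : 0 < Num.sqrt (v m0) by rewrite sqrtr_gt0.
exists (Num.sqrt (v m0))^-1, m0; split; first by rewrite invr_ge0 ltW.
move=> n mn; have s : Num.sqrt (v m0) <= Num.sqrt (v n) by rewrite ler_wsqrtr// Hm.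
by rewrite dnrE (lt_le_trans sm s) ler_pdivlMl// mulr1.
Qed.

(** Serves [lam < 0], where the assumption [n^(2 lam) d_n = o(n)] is weaker than [d_n = o(n)]. *)
Lemma dnr_sublinear : vanishing (fun n => dnr P xi r n / n%:R).
Proof.
move=> e e0.
have [q [K [q2 h1 h2 h3 h4]]] := regular_covariance_power D01 sL gE r0 Dr f0 (rho := rho) (fun=> erefl).
have [N hN] := sum_var_subquadratic h4 (exprn_gt0 2 e0).
exists N.+1 => n Nn; have n0 : 0 < n%:R :> R by rewrite ltr0n (leq_trans _ Nn).
have -> : e = Num.sqrt ((e * n%:R) ^+ 2) / n%:R.
  by rewrite sqrtr_sqr ger0_norm ?mulfK ?gt_eqF// mulr_ge0// ltW.
rewrite dnrE ler_wpM2r ?invr_ge0 ?(ltW n0)// ler_wsqrtr// exprMn.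
by apply: hN; exact: ltnW.
Qed.

Lemma hermite_sum_max (eps : R) : 0 < eps -> exists M N, 0 <= M /\
  forall n, (N <= n)%N -> exists B, [/\ measurable B, (P B < eps%:E)%E &
    forall w k, ~ B w -> (k <= n)%N ->
      `|\sum_(i < k) hermite r (xi i w)| <= M * dnr P xi r n].
Proof.
move=> eps0.
have [q [K [q2 h1 h2 h3 h4]]] := regular_covariance_power D01 sL gE r0 Dr f0 (rho := rho) (fun=> erefl).
have [th [C [p0 [th2 [C0 [vp vC]]]]]] := sum_var_dyadic h4 q2 h1 h2 h3.
have [_ [_ [m0 [m00 [_ Hm]]]]] := growth.
have [Kc [Kc0 Hmax]] := dyadic_maximal_inequality Ihh covh th2 C0 vp vC.
(* [M <= M^2] and [2 Kc <= eps M] give [Kc / M^2 <= eps/2]. *)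
pose M : R := Num.max 1 (2 * Kc / eps).
have M1 : 1 <= M by rewrite le_max lexx.
have M0 : 0 < M by exact: lt_le_trans M1.
have KM : Kc / M ^+ 2 < eps.
  rewrite ltr_pdivrMr ?exprn_gt0//.
  have hM : 2 * Kc / eps <= M by rewrite le_max lexx orbT.
  rewrite ler_pdivrMr// in hM.
  have hM2 : M <= M ^+ 2 by rewrite expr2 ler_peMr// ltW.
  have : eps * M <= eps * M ^+ 2 by rewrite ler_wpM2l// ltW.
  by rewrite mulrC in hM; move: Kc0; lra.
exists (Kc * M * 2), (maxn (2 ^ p0) (2 * m0)); split.
  by rewrite !mulr_ge0// ltW.
move=> n; rewrite geq_max => /andP[np nm].
have n0 : (0 < n)%N by apply: leq_trans np; rewrite expn_gt0.
(* As [2^p <= n < 2^(p+1)], the maximal inequality is used at [2^(p+1)];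
   [v(2^(p+1)) <= 4 v(2^p) <= 4 v(n)] costs a factor 2 in [d_n]. *)
pose p := trunc_log 2 n.
have pn : (2 ^ p <= n)%N by apply: trunc_logP.
have np1 : (n < 2 ^ p.+1)%N by apply: trunc_log_ltn.
have pp0 : (p0 <= p.+1)%N.
  by apply: ltnW; rewrite -(ltn_exp2l _ _ (ltnSn 1)); exact: leq_ltn_trans np1.
have [B [mB [PB HB]]] := Hmax M p.+1 M0 pp0.
exists B; split => //; first by apply: le_lt_trans PB _; rewrite lte_fin.
move=> w k Bw kn; apply: le_trans (HB w k Bw (leq_ltn_trans kn np1)) _.
rewrite -[leRHS]mulrA ler_wpM2l ?mulr_ge0 ?(ltW M0) ?(ltW Kc0)// dnrE.
have mp : (m0 <= 2 ^ p)%N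
  by apply: ltnW; rewrite -(ltn_pmul2l (isT : 0 < 2)%N) -expnS; exact: leq_ltn_trans np1.
have -> : 2 * Num.sqrt (v n) = Num.sqrt (4 * v n).
  by rewrite sqrtrM// (_ : 4 = 2 ^+ 2 :> R) ?sqrtr_sqr ?ger0_norm// -natrX.
rewrite ler_wsqrtr// expnS; apply: le_trans (sum_var_double Ihh covh _) _.
by rewrite ler_wpM2l// Hm.
Qed.

End hermite_sums.

(** The distribution function only places the first variable in [(0, 1]] almost surely; stationarity
    carries this to each index, and a finite union of null sets remains null. Strict positivity is
    what leaves room for a positive quantile in [rank_quantile]. *)
Lemma stationary_uniform_ae d (T : measurableType d) (R : realType)
    (P : probability T R) (xi : nat -> T -> R) (G : R -> R) (n : nat) :
  (forall n, measurable_fun [set: T] (xi n)) -> stationary P xi ->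
  measurable_fun [set: R] G ->
  (forall x, 0 <= x <= 1 -> P [set w | G (xi 0%N w) <= x] = x%:E) ->
  exists B, [/\ measurable B, P B = 0%E &
    forall w, ~ B w -> forall i, (i < n)%N -> 0 < G (xi i w) <= 1].
Proof.
move=> mxi sxi mG PG.
pose E := [set x | ~~ (0 < G x <= 1)].
have mGx : measurable (G @^-1` `]0, 1]%classic).
  by rewrite -[X in measurable X]setTI; exact: mG.
have EE : E = ~` (G @^-1` `]0, 1]%classic).
  by apply/seteqP; split => x /=; rewrite in_itv/= => /negP.
have mE : measurable E by rewrite EE; exact: measurableC.
have mA (A : set R) i : measurable A -> measurable (xi i @^-1` A).
  by move=> mA; rewrite -[X in measurable X]setTI; exact: mxi.
have mle (x : R) : measurable [set w | G (xi 0%N w) <= x].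
  have := mA (G @^-1` `]-oo, x]%classic) 0%N.
  rewrite (_ : _ @^-1` _ = [set w | G (xi 0%N w) <= x])//; apply.
  by rewrite -[X in measurable X]setTI; exact: mG.
have P0E : P (xi 0%N @^-1` E) = 0%E.
  apply/eqP; rewrite eq_le measure_ge0 andbT.
  have m0 := mle 0; have m1 := measurableC (mle 1).
  apply: (@le_trans _ _ (P ([set w | (G (xi 0%N w) <= 0)%R] `|` ~` [set w | (G (xi 0%N w) <= 1)%R]))).
    apply: le_measure; rewrite ?inE; [exact: mA|exact: measurableU|].
    move=> w; rewrite /E/= negb_and -!leNgt => /orP[h|h]; [by left|right => /=].
    by apply/negP; rewrite -ltNge ltNge.
  apply: le_trans (measureU2 _ m0 m1) _.
  have PC : P (~` [set w | G (xi 0%N w) <= 1]) = 0%:E.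
    by rewrite probability_setC// PG ?lexx ?ler01// subee.
  have P0 : P [set w | G (xi 0%N w) <= 0] = 0%:E by apply: PG; rewrite lexx ler01.
  rewrite -[leRHS]adde0 le_eqVlt; apply/orP; left; apply/eqP.
  exact: (f_equal2 adde P0 PC).
have PE i : P (xi i @^-1` E) = 0%E.
  have := stationary_pair sxi i 0 mE mE.
  by rewrite addn0 !setIid => ->.
exists (\big[setU/set0]_(i < n) (xi i @^-1` E)); split.
- by apply: bigsetU_measurable => i _; exact: mA.
- elim: n => [|n IH]; first by rewrite big_ord0 measure0.
  rewrite big_ord_recr/=; apply/eqP; rewrite eq_le measure_ge0 andbT.
  apply: le_trans (measureU2 _ _ _) _; [|exact: mA|].
    by apply: bigsetU_measurable => i _; exact: mA.
  rewrite -[leRHS]adde0 le_eqVlt; apply/orP; left; apply/eqP.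
  exact: (f_equal2 adde IH (PE n)).
- move=> w Bw i hi; apply/negPn/negP => h; apply: Bw.
  by rewrite (bigD1 (Ordinal hi))//=; left.
Qed.

Theorem theorem1 (R : realType) (d : measure_display) (T : measurableType d)
  (P : probability T R) (xi : nat -> T -> R) (D : R) (L : R -> R) (G : R -> R)
  (r : nat) (lam vth : R) :
  (* (xi_n) is a stationary Gaussian sequence; xi 0 plays the role of xi_1 *)
  (forall n, measurable_fun [set: T] (xi n)) ->
  gaussian_sequence P xi -> stationary P xi ->
  ('E_P[xi 0%N] = 0)%E -> ('V_P[xi 0%N] = 1)%E ->
  (* long-range dependence: gamma(k) ~ k^{-D} L(k) *)
  0 < D < 1 -> slowly_varying L ->
  asymp_equiv (fun k => fine (covariance P (xi 0%N) (xi k)))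
              (fun k => npow k (- D) * L k%:R) ->
  (* X_n = G(xi_n) uniformly distributed on [0,1] *)
  measurable_fun [set: R] G ->
  (forall x, 0 <= x <= 1 -> P [set w | G (xi 0%N w) <= x] = x%:E) ->
  hermite_rank P G xi r ->
  D * r%:R < 1 ->
  lam < 1 / 3 -> 0 < vth ->
  bigO_P P
    (fun n w => ereal_sup [set y | exists t x : R, 0 <= t <= 1 /\ 0 <= x <= 1 /\
       y = ((dnr P xi r n)^-1 * powR (Num.min x (1 - x)) (- lam) *
            `| \sum_(j < nfloor n t) ((if G (xi j w) <= x then 1 else 0) - x)
               - (r`!%:R)^-1 * Jcoef P G xi r x *
                 \sum_(j < nfloor n t) hermite r (xi j w) |)%:E])
    (fun n => npow n (- vth)) ->
  little_o (fun n => npow n lam) (fun n => powR (dnr P xi r n) (1 - lam)) ->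
  little_o (fun n => npow n (2 * lam) * dnr P xi r n) (fun n => n%:R) ->
  little_o (fun n => powR (dnr P xi r n) lam) (fun n => npow n vth) ->
  smallo_P1 P
    (fun n w => ereal_sup [set y | exists t x : R, 0 <= t <= 1 /\ 0 <= x <= 1 /\
       y = ((dnr P xi r n)^-1 * powR (Num.min x (1 - x)) (- lam) *
            `| (Ghat_left (fun j w' => G (xi j w')) n (nfloor n t) w x
                - (nfloor n t)%:R / n%:R *
                  Ghat_left (fun j w' => G (xi j w')) n n w x)
               - (r`!%:R)^-1 * Jcoef P G xi r x *
                 (\sum_(i < nfloor n t) hermite r (xi i w)
                  - (nfloor n t)%:R / n%:R * \sum_(i < n) hermite r (xi i w)) |)%:E]).
Proof.
move=> mxi gxi sxi Exi Vxi D01 sL gE mG PG [r0 _] Dr lam13 vth0 HO _ Hb Hc.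
set dn := dnr P xi r in HO Hb Hc *.
pose h w := hermite r (xi 0%N w).
pose B2 := \int[P]_w (h w * h w).
have Ih : P.-integrable setT (EFin \o h).
  exact: (integrable_hermite_stationary mxi gxi sxi Exi).
have Ihh : P.-integrable setT (EFin \o (fun w => h w * h w)).
  exact: (integrable_hermite_stationary_prod mxi gxi sxi Exi).
have Eh : \int[P]_w h w = 0.
  exact: (hermite_stationary_mean mxi gxi sxi Exi Vxi 0%N r0).
have mX : measurable_fun setT (fun w => G (xi 0%N w)) by exact: measurableT_comp.
have JE x : Jcoef P G xi r x =
    \int[P]_w ((if G (xi 0%N w) <= x then 1 else 0) * h w).
  by rewrite /Jcoef unlock.
pose c : R := (r`!%:R)^-1.
have c0 : 0 <= c by rewrite invr_ge0.
pose J x := c * Jcoef P G xi r x.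
have J0 : J 0 = 0.
  by rewrite /J JE (indicator_moment0 Ih Ihh erefl mX PG) mulr0.
have J1 : J 1 = 0.
  by rewrite /J JE (indicator_moment1 Ih Ihh erefl mX PG Eh) mulr0.
have B20 : 0 <= B2 by apply: Rintegral_ge0 => w _; rewrite -expr2 sqr_ge0.
pose A := c * ((1 + B2) / 2).
have A0 : 0 <= A by rewrite mulr_ge0// divr_ge0// addr_ge0.
have JH (x y : R) : 0 <= x <= 1 -> 0 <= y <= 1 -> `|J x - J y| <= A * Num.sqrt `|x - y|.
  move=> x01 y01; rewrite /J !JE -mulrBr normrM ger0_norm// -mulrA ler_wpM2l//.
  exact: (indicator_moment_holder Ih Ihh erefl mX PG).
have [C [N0 [C0 HC]]] := dnr_lower mxi gxi sxi Exi Vxi D01 sL gE r0 Dr.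
have dsub := dnr_sublinear mxi gxi sxi Exi Vxi D01 sL gE r0 Dr.
have dn0 n : 0 <= dn n by exact: sqrtr_ge0.
move=> eps delta eps0 delta0.
have d3 : 0 < delta / 2 by rewrite divr_gt0.
have [M1 [M10 [N1 H1]]] := HO _ d3.
have [M2 [N2 [M20 H2]]] := hermite_sum_max mxi gxi sxi Exi Vxi D01 sL gE r0 Dr d3.
pose M := Num.max M1 M2.
have M0 : 0 <= M by rewrite le_max (ltW M10).
have lam2 : lam < 1 / 2 by lra.
(* The threshold is fixed before the paths [X] and [H], so the bound is uniform over all outcomes
   outside the exceptional sets. *)
have [N3 H3] : exists N, forall n, (N <= n)%N ->
   forall (X H : nat -> R), (forall i, (i < n)%N -> 0 < X i <= 1) ->
    (forall k, (k <= n)%N -> `|H k| <= M * dn n) ->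
    (forall k x, (k <= n)%N -> 0 <= x <= 1 ->
      (dn n)^-1 * powR (Num.min x (1 - x)) (- lam) *
        `|count_le X k x - k%:R * x - J x * H k| <= M * npow n (- vth)) ->
    forall k x, (k <= n)%N -> 0 <= x <= 1 ->
      (dn n)^-1 * powR (Num.min x (1 - x)) (- lam) *
      `|(rank_count X n k x - k%:R / n%:R * rank_count X n n x)
        - J x * (H k - k%:R / n%:R * H n)| <= eps.
  have dM n : (0 < n)%N -> M * npow n (- vth) <= M.
    move=> n0; rewrite -[leRHS]mulr1 ler_wpM2l// /npow powRN invf_le1.
      by rewrite -[leLHS](powRr0 n%:R) ler_powR ?ler1n// ltW.
    by rewrite powR_gt0// ltr0n.
  have del0 n : 0 <= M * npow n (- vth) by rewrite mulr_ge0// powR_ge0.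
  have [lam0|lam0] := leP 0 lam.
    have l01 : 0 <= lam < 1 / 2 by rewrite lam0.
    have [N HN] := rank_error_nonneg C0 M0 A0 dn0 vth0 l01 Hb Hc eps0.
    exists (maxn N (maxn N0 1)) => n; rewrite !geq_max => /and3P[Nn N0n n0].
    move=> X H hX hH hE k x kn x01; have [dpos Cd] := HC n N0n.
    apply: le_trans (HN n Nn).
    exact: (rank_reduction_nonneg n0 dpos M0 A0 (del0 n) hX J0 J1 JH hH hE l01 C0 Cd (dM n n0) kn x01).
  have [e1 [e10 e14 [N HN]]] := rank_error_neg C0 M0 A0 dn0 vth0 lam0 eps0 dsub.
  exists (maxn N (maxn N0 1)) => n; rewrite !geq_max => /and3P[Nn N0n n0].
  move=> X H hX hH hE k x kn x01; have [dpos Cd] := HC n N0n.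
  have [sm HB] := HN n Nn; apply: le_trans HB.
  exact: (rank_reduction_neg n0 dpos M0 A0 (del0 n) hX J0 J1 JH hH hE lam0 C0 Cd (dM n n0) e10 e14 sm kn x01).
exists (maxn (maxn N1 N2) (maxn N3 1)) => n.
rewrite !geq_max => /andP[/andP[N1n N2n] /andP[N3n n0]].
have [E1 [mE1 [sE1 PE1]]] := H1 n N1n.
have [E2 [mE2 PE2 HE2]] := H2 n N2n.
have [E3 [mE3 PE3 HE3]] := stationary_uniform_ae n mxi sxi mG PG.
exists (E1 `|` E2 `|` E3); split; first by apply: measurableU => //; exact: measurableU.
have nR : 0 < n%:R :> R by rewrite ltr0n.
have floor_le (t : R) : 0 <= t <= 1 -> (nfloor n t <= n)%N.
  move=> /andP[t0 t1]; rewrite /nfloor -(ler_nat R).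
  have /andP[tn _] := truncn_itv (mulr_ge0 (ltW nR) t0).
  by apply: le_trans tn _; rewrite ler_piMr// ltW.
(* Every [k <= n] is attained at [t = k/n], so the supremum over [t] in the reduction principle
   controls all partial sums up to [n]. *)
have floorK k : (k <= n)%N -> 0 <= (k%:R / n%:R : R) <= 1 /\ nfloor n (k%:R / n%:R : R) = k.
  move=> kn; split; first by rewrite divr_ge0//= ler_pdivrMr// mul1r ler_nat.
  by rewrite /nfloor mulrC divfK ?gt_eqF// natrK.
split; last first.
  apply: le_lt_trans (measureU2 _ (measurableU _ _ mE1 mE2) mE3) _.
  apply: (@le_lt_trans _ _ (P (E1 `|` E2) + 0)%E).
    by rewrite le_eqVlt; apply/orP; left; apply/eqP; exact: (f_equal2 adde erefl PE3).
  rewrite adde0; apply: le_lt_trans (measureU2 _ mE1 mE2) _.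
  by rewrite (splitr delta) EFinD; exact: lteD.
move=> w; apply: contraPP => /not_orP[/not_orP[nE1 nE2] nE3].
pose X i := G (xi i w); pose H k := \sum_(j < k) hermite r (xi j w).
have hX i : (i < n)%N -> 0 < X i <= 1 by exact: HE3.
have hH k : (k <= n)%N -> `|H k| <= M * dn n.
  move=> kn; apply: le_trans (HE2 w k nE2 kn) _; rewrite ler_wpM2r//.
  by rewrite le_max lexx orbT.
have SE k (x : R) : \sum_(j < k) ((if G (xi j w) <= x then 1 else 0) - x) =
    count_le X k x - k%:R * x.
  by rewrite sumrB sumr_const card_ord mulr_natl.
have hE k (x : R) : (k <= n)%N -> 0 <= x <= 1 ->
    (dn n)^-1 * powR (Num.min x (1 - x)) (- lam) *
      `|count_le X k x - k%:R * x - J x * H k| <= M * npow n (- vth).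
  move=> kn x01; apply: (@le_trans _ _ (M1 * npow n (- vth))); last first.
    by rewrite ler_wpM2r ?powR_ge0// le_max lexx.
  have : ~ ([set w0 | ((M1 * npow n (- vth))%:E < _)%E] w) := fun hw => nE1 (sE1 w hw).
  move=> /= /negP; rewrite -leNgt => hs; rewrite -lee_fin.
  apply: le_trans hs; apply: le_trans (lee_abs _); apply: ereal_sup_ubound => /=.
  have [t01 tk] := floorK k kn.
  by exists (k%:R / n%:R), x; rewrite tk -SE.
have V := H3 n N3n X H hX hH hE.
move=> /=; apply/negP; rewrite -leNgt; set Z := ereal_sup _.
have Zle : (Z <= eps%:E)%E.
  apply: ub_ereal_sup => _ [t [x [t01 [x01 ->]]]]; rewrite lee_fin !Ghat_leftE.
  exact: (V (nfloor n t) x (floor_le t t01) x01).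
(* A nonnegative member of the set, at [t = x = 0], shows that the supremum equals its absolute
   value. *)
have Z0 : (0 <= Z)%E.
  have [t01 _] := floorK 0%N (leq0n n).
  apply: (@le_trans _ _ _ _ _ _ (ereal_sup_ubound (ex_intro _ _ (ex_intro _ 0
    (conj t01 (conj _ erefl)))))).
    by rewrite lee_fin !mulr_ge0 ?powR_ge0// invr_ge0.
  by rewrite lexx ler01.
by rewrite gee0_abs.
Qed.
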